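(* Let $\theta\in\mathbb{R}$ and let $\Phi:\mathbb{C}_\theta\to\mathbb{C}_{1/2}$ be holomorphic. Then $\Phi$ generates a composition-differentiation operator $D_\Phi f=f'\circ\Phi$ on $\mathcal{D}$ (that is, $f'\circ\Phi\in\mathcal{D}$ for every $f\in\mathcal{D}$) if, and only if, $\Phi$ has the form $$\Phi(s)=c_0s+\phi(s),$$ where $c_0$ is a non-negative integer and $\phi\in\mathcal{D}$.
   Context: For $\theta\in\mathbb{R}$, $\mathbb{C}_\theta=\{s\in\mathbb{C}:\Re(s)>\theta\}$. $\mathcal{D}$ denotes the class of functions on a half-plane that are represented by a Dirichlet series $\sum_{n\ge1}a_nn^{-s}$ converging in some half-plane $\mathbb{C}_\sigma$. *)

(* Defs.v *)
(* Stdlib reals + Coquelicot complex numbers C = R * R.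
   Over C, Coquelicot's [is_derive] is the complex derivative
   (@is_derive C_AbsRing C_NormedModule) and [is_series] is convergence in C. *)
From Stdlib Require Import Reals.
From Coquelicot Require Import Coquelicot.
Open Scope R_scope.

Definition in_halfplane (theta : R) (s : C) : Prop := theta < Re s.

(* n^{-s} = exp(-s log n) for a positive integer n. *)
Definition npow_neg (n : nat) (s : C) : C :=
  let r := ln (INR n) in
  (exp (- Re s * r) * cos (- Im s * r), exp (- Re s * r) * sin (- Im s * r)).

Definition holomorphic_on (P : C -> Prop) (g : C -> C) : Prop :=
  forall s, P s -> ex_derive g s.

(* g belongs to the class D: there are coefficients (a_n)_{n>=1} and a
   half-plane C_sigma on which the Dirichlet series sum_{n>=1} a_n n^{-s}
   converges and equals g.  (a 0 is ignored.) *)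
Definition in_D (g : C -> C) : Prop :=
  exists (a : nat -> C) (sigma : R),
    forall s, in_halfplane sigma s ->
      is_series (fun k => Cmult (a (S k)) (npow_neg (S k) s)) (g s).

(* Phi generates a composition-differentiation operator on D:
   for every f in D (holomorphic on C_{1/2}, the target of Phi), with complex
   derivative f', the function f' o Phi belongs to D. *)
Definition generates_CD_operator (Phi : C -> C) : Prop :=
  forall f f' : C -> C,
    (forall z, in_halfplane (1/2) z -> is_derive f z (f' z)) ->
    in_D f ->
    in_D (fun s => f' (Phi s)).

(* Main.v *)
(* Sufficiency. Write [phi = c + E], with [c] the constant term of the Dirichlet series and [E] the rest, so
   that [E] is small far to the right, in the norm [sum |e_n| n^-x] of a Banach algebra. If [c0 = 0], then
   [Re c > 1/2] and the Taylor series of [f'] at [c] can be composed with [E]; as [f] is only assumed to be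
   complex differentiable, the Taylor series comes from Goursat's theorem. If [c0 >= 1], then [Phi] maps far
   half-planes into the domain of convergence of [f], and each [n^-Phi = (n^c0)^-s n^-c exp (-E ln n)] is expanded.

   Necessity. Testing on [f = -k^-s / ln k] gives Dirichlet series [A_k = k^-Phi], and
   [ln l * A_k' * A_l = ln k * A_k * A_l']. Comparing coefficients at the product of the leading indices [N_k]
   and [N_l] shows [N_k = k^c] with [c] independent of [k]; finite differences of [x^c] force [c] to be an
   integer [c0]. Comparing coefficients of the relation between [A_2] and [A_3] at the indices [n 3^c0] shows
   that [2^c0] divides all [n] in the support of [A_2]. So [2^-(Phi - c0 s)] is an ordinary Dirichlet series
   with nonzero constant term, and its logarithm is one as well. *)
Require Import Defs.
From Stdlib Require Import Reals Lra Lia Arith ClassicalEpsilon.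
From Coquelicot Require Import Coquelicot.
Open Scope R_scope.

(** * Series in C *)

(** Membership in [in_D] concerns only some far half-plane, so abscissae may be given away freely:
    conditional convergence is traded at once for absolute convergence further right, and all later
    work takes place in the weighted l1 spaces [dbd x]. Products, powers, composed power series and
    expanded exponentials are all rearrangements covered by one statement, [dfamily]. For [c0 = 0]
    the Dirichlet series of [f] may converge only to the right of all values of [Phi], so
    differentiability near [c] is all there is to use. The limit far to the right only gives
    [Re c >= 1/2]; strictness comes from turning the leading term of [E] towards the left.
    Conversely, [Phi] is seen only through the powers [k^-Phi], and a logarithm cannot be taken
    before a nonzero constant term is available. Eliminating [Phi'] between two bases gives
    identities of coefficients without any logarithm of a function. Base 3 controls the support of
    [A_2] because its leading index [3^c0] is odd: a power of 2 dividing [n 3^c0] divides [n]. *)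

Fixpoint Rsum (u : nat -> R) (n : nat) : R :=
  match n with O => 0 | S m => Rsum u m + u m end.

Fixpoint Csum (u : nat -> C) (n : nat) : C :=
  match n with O => RtoC 0 | S m => Cplus (Csum u m) (u m) end.

Definition clim (u : nat -> C) (l : C) : Prop :=
  forall eps, 0 < eps -> exists N, forall n, (N <= n)%nat -> Cmod (u n - l) < eps.

Definition csums (u : nat -> C) (l : C) : Prop := clim (Csum u) l.

Lemma Rsum_ext u v n : (forall k, (k < n)%nat -> u k = v k) -> Rsum u n = Rsum v n.
Proof.
  induction n as [|n IH]; intros H; simpl; [easy|].
  rewrite IH, H; [easy|lia|]. intros; apply H; lia.
Qed.

Lemma Rsum_le u v n : (forall k, (k < n)%nat -> u k <= v k) -> Rsum u n <= Rsum v n.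
Proof.
  induction n as [|n IH]; intros H; simpl; [lra|].
  apply Rplus_le_compat; [apply IH; intros; apply H|apply H]; lia.
Qed.

Lemma Rsum_scal c u n : Rsum (fun k => c * u k) n = c * Rsum u n.
Proof. induction n; simpl; [|rewrite IHn]; ring. Qed.

Lemma Rsum_plus u v n : Rsum (fun k => u k + v k) n = Rsum u n + Rsum v n.
Proof. induction n; simpl; [|rewrite IHn]; ring. Qed.

Lemma Rsum_nonneg u n : (forall k, 0 <= u k) -> 0 <= Rsum u n.
Proof. intros H; induction n; simpl; [lra|]. specialize (H n); lra. Qed.

Lemma Rsum_mono u n m : (forall k, 0 <= u k) -> (n <= m)%nat -> Rsum u n <= Rsum u m.
Proof. intros H; induction 1; simpl; [lra|]. specialize (H m); lra. Qed.

Lemma Rsum_term u n k : (forall i, 0 <= u i) -> (k < n)%nat -> u k <= Rsum u n.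
Proof.
  intros H Hk. apply Rle_trans with (Rsum u (S k)).
  - simpl. assert (H0 := Rsum_nonneg u k H). lra.
  - now apply Rsum_mono.
Qed.

Lemma Csum_ext u v n : (forall k, (k < n)%nat -> u k = v k) -> Csum u n = Csum v n.
Proof.
  induction n as [|n IH]; intros H; simpl; [easy|].
  rewrite IH, H; [easy|lia|]. intros; apply H; lia.
Qed.

Lemma Csum_plus u v n : Csum (fun k => u k + v k)%C n = (Csum u n + Csum v n)%C.
Proof. induction n; simpl; [|rewrite IHn]; ring. Qed.

Lemma Csum_scal c u n : Csum (fun k => c * u k)%C n = (c * Csum u n)%C.
Proof. induction n; simpl; [|rewrite IHn]; ring. Qed.

Lemma Csum_0 n : Csum (fun _ => RtoC 0) n = RtoC 0.
Proof. induction n; simpl; [easy|]. rewrite IHn; ring. Qed.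

Lemma Csum_only u n k : (k < n)%nat -> (forall i, (i < n)%nat -> i <> k -> u i = RtoC 0) ->
  Csum u n = u k.
Proof.
  induction n as [|n IH]; intros Hk H; [lia|]. simpl.
  destruct (Nat.eq_dec k n) as [->|Hn].
  - rewrite (Csum_ext u (fun _ => RtoC 0) n), Csum_0; [ring|].
    intros i Hi; apply H; lia.
  - rewrite IH, (H n) by first [lia | intros; apply H; lia]. ring.
Qed.

Lemma Csum_stable u n m : (forall i, (n <= i)%nat -> u i = RtoC 0) -> (n <= m)%nat ->
  Csum u m = Csum u n.
Proof. intros H; induction 1; simpl; [easy|]. rewrite IHle, H by lia. ring. Qed.

Lemma Cmod_Csum u n : Cmod (Csum u n) <= Rsum (fun k => Cmod (u k)) n.
Proof.
  induction n; simpl; [rewrite Cmod_0; lra|].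
  eapply Rle_trans; [apply Cmod_triangle|]. lra.
Qed.

Lemma Cmod_minus_sym a b : Cmod (a - b) = Cmod (b - a).
Proof. rewrite <- Cmod_opp. f_equal; ring. Qed.

Lemma Cmod_triangle3 a b c : Cmod (a - c) <= Cmod (a - b) + Cmod (b - c).
Proof. replace (a - c)%C with ((a - b) + (b - c))%C by ring. apply Cmod_triangle. Qed.

Lemma Cmod_triangle_rev a b : Cmod a - Cmod b <= Cmod (a - b).
Proof.
  assert (H := Cmod_triangle (a - b) b).
  replace (a - b + b)%C with a in H by ring. lra.
Qed.

Lemma Re_le_Cmod z : Rabs (Re z) <= Cmod z.
Proof. eapply Rle_trans; [apply Rmax_l|apply Rmax_Cmod]. Qed.

Lemma Im_le_Cmod z : Rabs (Im z) <= Cmod z.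
Proof. eapply Rle_trans; [apply Rmax_r|apply Rmax_Cmod]. Qed.

Lemma Cmod_le_Re_Im z : Cmod z <= Rabs (Re z) + Rabs (Im z).
Proof.
  assert (E : z = (RtoC (Re z) + Ci * RtoC (Im z))%C) by (destruct z; apply injective_projections; simpl; ring).
  rewrite E at 1. eapply Rle_trans; [apply Cmod_triangle|].
  rewrite Cmod_mult, Cmod_Ci, !Cmod_R. lra.
Qed.

Lemma clim_unique u l l' : clim u l -> clim u l' -> l = l'.
Proof.
  intros H H'. apply Ceq_minus, Cmod_eq_0.
  destruct (Req_dec (Cmod (l - l')) 0) as [|Hne]; [easy|exfalso].
  assert (Hp : 0 < Cmod (l - l') / 2) by (assert (H0 := Cmod_ge_0 (l - l')); lra).
  destruct (H _ Hp) as [N HN]; destruct (H' _ Hp) as [N' HN'].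
  specialize (HN (max N N') ltac:(lia)); specialize (HN' (max N N') ltac:(lia)).
  assert (H0 := Cmod_triangle3 l (u (max N N')) l').
  rewrite (Cmod_minus_sym l (u _)) in H0. lra.
Qed.

Lemma clim_ext u v l : (forall n, u n = v n) -> clim u l -> clim v l.
Proof. intros E H eps He. destruct (H eps He) as [N HN]. exists N; intros; rewrite <- E; auto. Qed.

Lemma clim_const c : clim (fun _ => c) c.
Proof. intros eps He; exists O; intros. replace (c - c)%C with (RtoC 0) by ring. now rewrite Cmod_0. Qed.

Lemma clim_plus u v l m : clim u l -> clim v m -> clim (fun n => u n + v n)%C (l + m)%C.
Proof.
  intros H H' eps He.
  destruct (H (eps/2) ltac:(lra)) as [N HN]; destruct (H' (eps/2) ltac:(lra)) as [N' HN'].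
  exists (max N N'); intros n Hn.
  specialize (HN n ltac:(lia)); specialize (HN' n ltac:(lia)).
  replace (u n + v n - (l + m))%C with ((u n - l) + (v n - m))%C by ring.
  eapply Rle_lt_trans; [apply Cmod_triangle|]. lra.
Qed.

Lemma clim_scal c u l : clim u l -> clim (fun n => c * u n)%C (c * l)%C.
Proof.
  intros H eps He. assert (Hc := Cmod_ge_0 c).
  destruct (H (eps / (Cmod c + 1))) as [N HN]; [apply Rdiv_lt_0_compat; lra|].
  exists N; intros n Hn. specialize (HN n Hn).
  replace (c * u n - c * l)%C with (c * (u n - l))%C by ring.
  rewrite Cmod_mult. assert (H0 := Cmod_ge_0 (u n - l)).
  apply Rle_lt_trans with ((Cmod c + 1) * Cmod (u n - l)); [nra|].
  apply Rmult_lt_reg_l with (/ (Cmod c + 1)); [apply Rinv_0_lt_compat; lra|].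
  rewrite <- Rmult_assoc, Rinv_l, Rmult_1_l by lra. rewrite Rmult_comm. exact HN.
Qed.

Lemma clim_bound u l M : (forall n, Cmod (u n) <= M) -> clim u l -> Cmod l <= M.
Proof.
  intros B H. apply Rnot_lt_le; intros Hl.
  destruct (H (Cmod l - M) ltac:(lra)) as [N HN]. specialize (HN N (le_n _)). specialize (B N).
  assert (H0 := Cmod_triangle_rev l (u N)). rewrite Cmod_minus_sym in H0. lra.
Qed.

Lemma csums_unique u l l' : csums u l -> csums u l' -> l = l'.
Proof. apply clim_unique. Qed.

Lemma csums_ext u v l : (forall n, u n = v n) -> csums u l -> csums v l.
Proof. intros E. apply clim_ext; intros; apply Csum_ext; auto. Qed.

Lemma csums_plus u v l m : csums u l -> csums v m -> csums (fun n => u n + v n)%C (l + m)%C.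
Proof.
  intros H H'. eapply clim_ext; [|apply (clim_plus _ _ _ _ H H')].
  intros n; symmetry; apply Csum_plus.
Qed.

Lemma csums_scal c u l : csums u l -> csums (fun n => c * u n)%C (c * l)%C.
Proof.
  intros H. eapply clim_ext; [|apply (clim_scal c _ _ H)].
  intros n; symmetry; apply Csum_scal.
Qed.

Lemma csums_minus u v l m : csums u l -> csums v m -> csums (fun n => u n - v n)%C (l - m)%C.
Proof.
  intros H H'. replace (l - m)%C with (l + (-(1)) * m)%C by ring.
  apply csums_ext with (fun n => u n + (-(1)) * v n)%C; [intros; ring|].
  apply csums_plus; [easy|now apply csums_scal].
Qed.

Lemma csums_finite u n : (forall i, (n <= i)%nat -> u i = RtoC 0) -> csums u (Csum u n).
Proof.
  intros H eps He; exists n; intros m Hm. rewrite (Csum_stable u n m H Hm).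
  replace (Csum u n - Csum u n)%C with (RtoC 0) by ring. now rewrite Cmod_0.
Qed.

Lemma csums_single u k : (forall i, i <> k -> u i = RtoC 0) -> csums u (u k).
Proof.
  intros H. rewrite <- (Csum_only u (S k) k) by auto. apply csums_finite.
  intros i Hi; apply H; lia.
Qed.

Lemma csums_shift1 u l : csums u l -> csums (fun k => u (S k)) (l - u O)%C.
Proof.
  assert (E : forall n, Csum (fun k => u (S k)) n = (Csum u (S n) - u O)%C).
  { induction n; simpl in *; [ring|]. rewrite IHn; ring. }
  intros H eps He. destruct (H eps He) as [N HN]. exists N; intros n Hn.
  rewrite E. replace (Csum u (S n) - u O - (l - u O))%C with (Csum u (S n) - l)%C by ring.
  apply HN; lia.
Qed.

Lemma csums_unshift1 u l : csums (fun k => u (S k)) l -> csums u (l + u O)%C.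
Proof.
  assert (E : forall n, Csum (fun k => u (S k)) n = (Csum u (S n) - u O)%C).
  { induction n; simpl in *; [ring|]. rewrite IHn; ring. }
  intros H eps He. destruct (H eps He) as [N HN]. exists (S N); intros n Hn.
  destruct n as [|n]; [lia|]. specialize (HN n ltac:(lia)). rewrite E in HN.
  replace (Csum u (S n) - (l + u O))%C with (Csum u (S n) - u O - l)%C by ring. exact HN.
Qed.

Lemma csums_is_series u l : csums u l <-> is_series (K := C_AbsRing) (V := C_NormedModule) u l.
Proof.
  assert (E : forall n, sum_n u n = Csum u (S n)).
  { induction n; simpl; [rewrite sum_O|rewrite sum_Sn, IHn]; simpl; [|easy].
    change (u O = 0 + u O)%C. ring. }
  unfold is_series, csums. rewrite (filterlim_locally_ball_norm (K := C_AbsRing) (U := C_NormedModule)). split.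
  - intros H eps. destruct (H eps (cond_pos eps)) as [N HN]. exists N; intros n Hn.
    unfold ball_norm. rewrite E. apply (HN (S n)); lia.
  - intros H eps He. destruct (H (mkposreal eps He)) as [N HN]. exists (S N); intros n Hn.
    destruct n as [|n]; [lia|]. specialize (HN n ltac:(lia)). unfold ball_norm in HN.
    rewrite E in HN. exact HN.
Qed.

Lemma Rsum_tail m M : (forall k, 0 <= m k) -> (forall n, Rsum m n <= M) ->
  forall eps, 0 < eps -> exists J, forall n, (J <= n)%nat -> Rsum m n - Rsum m J <= eps.
Proof.
  intros Hp HM eps He.
  destruct (growing_cv (Rsum m)) as [l Hl].
  - intros n; simpl. specialize (Hp n); lra.
  - exists M. intros x [n ->]. apply HM.
  - assert (Hlb : forall n, Rsum m n <= l).
    { apply growing_ineq; [|easy]. intros n; simpl. specialize (Hp n); lra. }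
    destruct (Hl eps He) as [J HJ]. exists J; intros n Hn.
    specialize (HJ J (le_n _)). unfold Rdist in HJ. apply Rabs_def2 in HJ. specialize (Hlb n). lra.
Qed.

Lemma Csum_tail_bound u m J n : (forall k, Cmod (u k) <= m k) -> (J <= n)%nat ->
  Cmod (Csum u n - Csum u J) <= Rsum m n - Rsum m J.
Proof.
  intros H; induction 1.
  - replace (Csum u J - Csum u J)%C with (RtoC 0) by ring. rewrite Cmod_0; lra.
  - simpl. replace (Csum u m0 + u m0 - Csum u J)%C with ((Csum u m0 - Csum u J) + u m0)%C by ring.
    eapply Rle_trans; [apply Cmod_triangle|]. specialize (H m0). lra.
Qed.

(** The Weierstrass test. Limit and bound come together, since norms of sums are later estimated
    through a majorant only. *)
Lemma csums_abs u m M : (forall k, Cmod (u k) <= m k) -> (forall n, Rsum m n <= M) ->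
  exists l, csums u l /\ Cmod l <= M.
Proof.
  intros Hu HM.
  assert (Hp : forall k, 0 <= m k) by (intros k; assert (H0 := Cmod_ge_0 (u k)); specialize (Hu k); lra).
  assert (HB : forall n, Cmod (Csum u n) <= M).
  { intros n. eapply Rle_trans; [apply Cmod_Csum|]. eapply Rle_trans; [|apply (HM n)].
    apply Rsum_le; auto. }
  assert (HC : forall eps, 0 < eps -> exists J, forall p q, (J <= p)%nat -> (J <= q)%nat ->
    Cmod (Csum u p - Csum u q) < eps).
  { intros eps He. destruct (Rsum_tail m M Hp HM (eps/2/2) ltac:(lra)) as [J HJ].
    exists J; intros p q Hpq Hq.
    assert (H1 := Csum_tail_bound u m J p Hu Hpq). assert (H2 := Csum_tail_bound u m J q Hu Hq).
    assert (H3 := HJ p Hpq). assert (H4 := HJ q Hq).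
    assert (H5 := Cmod_triangle3 (Csum u p) (Csum u J) (Csum u q)).
    rewrite (Cmod_minus_sym (Csum u J)) in H5. lra. }
  destruct (Rcomplete.R_complete (fun n => Re (Csum u n))) as [l1 Hl1].
  { intros eps He. destruct (HC eps He) as [J HJ]. exists J; intros p q Hpq Hq.
    unfold Rdist. eapply Rle_lt_trans; [|apply (HJ p q Hpq Hq)].
    apply (Re_le_Cmod (Csum u p - Csum u q)). }
  destruct (Rcomplete.R_complete (fun n => Im (Csum u n))) as [l2 Hl2].
  { intros eps He. destruct (HC eps He) as [J HJ]. exists J; intros p q Hpq Hq.
    unfold Rdist. eapply Rle_lt_trans; [|apply (HJ p q Hpq Hq)].
    apply (Im_le_Cmod (Csum u p - Csum u q)). }
  assert (H : csums u (l1, l2)).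
  { intros eps He. destruct (Hl1 (eps/2) ltac:(lra)) as [N1 H1]. destruct (Hl2 (eps/2) ltac:(lra)) as [N2 H2].
    exists (max N1 N2); intros n Hn. specialize (H1 n ltac:(lia)). specialize (H2 n ltac:(lia)).
    eapply Rle_lt_trans; [apply Cmod_le_Re_Im|]. unfold Rdist in *.
    change (Re (Csum u n - (l1, l2))) with (Re (Csum u n) - l1).
    change (Im (Csum u n - (l1, l2))) with (Im (Csum u n) - l2). lra. }
  exists (l1, l2); split; [easy|]. now apply clim_bound with (Csum u).
Qed.

(** Dominated convergence for series: the majorant [m] makes the tails small uniformly in [N], and
    the finitely many remaining terms converge one by one. *)
Lemma tannery (t : nat -> nat -> C) (m : nat -> R) (M : R) (r s : nat -> C) (S : C) :
  (forall j N, Cmod (t j N) <= m j) -> (forall n, Rsum m n <= M) ->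
  (forall j, clim (t j) (r j)) -> (forall N, csums (fun j => t j N) (s N)) -> csums r S ->
  clim s S.
Proof.
  intros Ht HM Hr Hs HS eps He.
  assert (Hp : forall k, 0 <= m k) by (intros k; assert (H0 := Cmod_ge_0 (t k O)); specialize (Ht k O); lra).
  assert (Hrm : forall j, Cmod (r j) <= m j) by (intros j; apply clim_bound with (t j); auto).
  destruct (Rsum_tail m M Hp HM (eps/8) ltac:(lra)) as [J HJ].
  (* One index [J] serves for every dominated series, the limit series included. *)
  assert (T : forall u l, (forall j, Cmod (u j) <= m j) -> csums u l -> Cmod (l - Csum u J) <= eps/4).
  { intros u l Hu Hl. destruct (Hl (eps/8) ltac:(lra)) as [N HN].
    specialize (HN (max J N) ltac:(lia)). assert (H1 := Csum_tail_bound u m J (max J N) Hu ltac:(lia)).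
    specialize (HJ (max J N) ltac:(lia)). assert (H2 := Cmod_triangle3 l (Csum u (max J N)) (Csum u J)).
    rewrite Cmod_minus_sym in HN. lra. }
  assert (F : forall J', clim (fun N => Csum (fun j => t j N) J') (Csum r J')).
  { induction J'; simpl; [apply clim_const|]. now apply clim_plus. }
  destruct (F J (eps/4) ltac:(lra)) as [N HN]. exists N; intros n Hn. specialize (HN n Hn).
  assert (H1 := T _ _ (fun j => Ht j n) (Hs n)). assert (H2 := T _ _ Hrm HS).
  assert (H3 := Cmod_triangle3 (s n) (Csum (fun j => t j n) J) S).
  assert (H4 := Cmod_triangle3 (Csum (fun j => t j n) J) (Csum r J) S).
  rewrite (Cmod_minus_sym S) in H2. lra.
Qed.

(** [tannery] applied to the partial sums of the rows, which [m j] dominates uniformly in their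
    length. *)
Lemma csums_fubini (y : nat -> nat -> C) (m : nat -> R) (M : R) (r c : nat -> C) :
  (forall j n, Rsum (fun k => Cmod (y j k)) n <= m j) -> (forall n, Rsum m n <= M) ->
  (forall j, csums (y j) (r j)) -> (forall n, csums (fun j => y j n) (c n)) ->
  exists l, csums r l /\ csums c l.
Proof.
  intros Hy HM Hr Hc.
  assert (Ht : forall j N, Cmod (Csum (y j) N) <= m j).
  { intros; eapply Rle_trans; [apply Cmod_Csum|apply Hy]. }
  destruct (csums_abs r m M) as [l [Hl _]]; [|easy|].
  { intros j. apply clim_bound with (Csum (y j)); [apply Ht|apply Hr]. }
  exists l; split; [easy|].
  apply (tannery (fun j N => Csum (y j) N) m M r); auto.
  intros N. induction N; simpl.
  - apply (csums_finite (fun _ => RtoC 0) 0). easy.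
  - now apply csums_plus.
Qed.

(** A total sum, with no meaning for divergent series; it lets [deval] be a function that carries no
    convergence proof. *)
Definition cser (u : nat -> C) : C := epsilon (inhabits (RtoC 0)) (csums u).

Lemma cser_correct u : (exists l, csums u l) -> csums u (cser u).
Proof. intros H. unfold cser. now apply epsilon_spec. Qed.

Lemma cser_unique u l : csums u l -> cser u = l.
Proof. intros H. apply csums_unique with u; [|easy]. apply cser_correct; now exists l. Qed.

(** * Complex differentiation *)

(** Free of division, so [h = 0] is allowed and the inequality can be inserted directly into
    estimates; [cderiv_is_derive] links it to the notion used in the theorem. *)
Definition cderiv (f : C -> C) (z l : C) : Prop :=
  forall eps, 0 < eps -> exists d, 0 < d /\
    forall h, Cmod h < d -> Cmod (f (z + h)%C - f z - l * h) <= eps * Cmod h.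

Definition ccont (f : C -> C) (z : C) : Prop :=
  forall eps, 0 < eps -> exists d, 0 < d /\
    forall h, Cmod h < d -> Cmod (f (z + h)%C - f z) < eps.

Lemma cderiv_is_derive f z l :
  cderiv f z l <-> is_derive (K := C_AbsRing) (V := C_NormedModule) f z l.
Proof.
  split.
  - intros H. split; [apply is_linear_scal_l|].
    intros x Hx. apply (is_filter_lim_locally_unique (K := C_AbsRing) (V := AbsRing_NormedModule C_AbsRing)) in Hx. subst x.
    intros eps. destruct (H eps (cond_pos eps)) as [d [Hd Hd']].
    apply (locally_le_locally_norm (V := AbsRing_NormedModule C_AbsRing)). exists (mkposreal d Hd). intros y Hy. change C in y.
    specialize (Hd' (y - z)%C Hy). replace (z + (y - z))%C with y in Hd' by ring.
    eapply Rle_trans; [|exact Hd'].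
    right. change (Cmod (f y - f z - (y - z) * l) = Cmod (f y - f z - l * (y - z))).
    f_equal; ring.
  - intros [_ H] eps He. specialize (H z (fun P HP => HP) (mkposreal eps He)).
    apply (locally_norm_le_locally (V := AbsRing_NormedModule C_AbsRing)) in H. destruct H as [d Hd].
    exists d; split; [apply cond_pos|]. intros h Hh.
    assert (E : (z + h - z)%C = h) by ring.
    specialize (Hd (z + h)%C).
    assert (Hb : ball_norm z d (z + h)%C).
    { unfold ball_norm. change (Cmod (z + h - z) < d). now rewrite E. }
    specialize (Hd Hb). simpl in Hd.
    change (Cmod (f (z + h)%C - f z - (z + h - z) * l) <= eps * Cmod (z + h - z)) in Hd.
    rewrite E in Hd. now rewrite (Cmult_comm l).
Qed.

Lemma cderiv_unique f z l l' : cderiv f z l -> cderiv f z l' -> l = l'.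
Proof.
  intros H H'. apply Ceq_minus, Cmod_eq_0. apply Rle_antisym; [|apply Cmod_ge_0].
  apply Rnot_lt_le; intros Hp.
  destruct (H (Cmod (l - l') / 4) ltac:(lra)) as [d [Hd H1]].
  destruct (H' (Cmod (l - l') / 4) ltac:(lra)) as [d' [Hd' H2]].
  set (e := Rmin d d' / 2). assert (He : 0 < e /\ e < d /\ e < d').
  { unfold e. assert (H3 := Rmin_l d d'). assert (H4 := Rmin_r d d').
    assert (0 < Rmin d d') by now apply Rmin_pos. lra. }
  assert (Hm : Cmod e = e) by (rewrite Cmod_R; apply Rabs_pos_eq; lra).
  specialize (H1 (RtoC e) ltac:(rewrite Hm; lra)). specialize (H2 (RtoC e) ltac:(rewrite Hm; lra)).
  assert (H3 := Cmod_triangle3 (l * e) (f (z + e)%C - f z) (l' * e)).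
  rewrite (Cmod_minus_sym (l * e) (f (z + e)%C - f z)) in H3.
  replace (l * e - l' * e)%C with ((l - l') * e)%C in H3 by ring.
  rewrite Cmod_mult in H3. rewrite Hm in *. nra.
Qed.

Lemma cderiv_ccont f z l : cderiv f z l -> ccont f z.
Proof.
  intros H eps He. destruct (H 1 ltac:(lra)) as [d [Hd H1]].
  assert (Hl := Cmod_ge_0 l).
  exists (Rmin d (eps / (Cmod l + 2))). split.
  - apply Rmin_pos; [easy|]. apply Rdiv_lt_0_compat; lra.
  - intros h Hh. assert (Hh1 := Rlt_le_trans _ _ _ Hh (Rmin_l _ _)).
    assert (Hh2 := Rlt_le_trans _ _ _ Hh (Rmin_r _ _)).
    specialize (H1 h Hh1).
    assert (H2 := Cmod_triangle (f (z + h)%C - f z - l * h) (l * h)).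
    replace (f (z + h)%C - f z - l * h + l * h)%C with (f (z + h)%C - f z)%C in H2 by ring.
    rewrite Cmod_mult in H2. assert (H3 := Cmod_ge_0 h).
    assert (H4 : Cmod h * (Cmod l + 2) < eps).
    { replace eps with (eps / (Cmod l + 2) * (Cmod l + 2)) by (field; lra).
      apply Rmult_lt_compat_r; lra. }
    nra.
Qed.

Lemma cderiv_ext_loc f g z l d : 0 < d -> (forall h, Cmod h < d -> f (z + h)%C = g (z + h)%C) ->
  cderiv f z l -> cderiv g z l.
Proof.
  intros Hd E H eps He. destruct (H eps He) as [d' [Hd' H']].
  exists (Rmin d d'); split; [now apply Rmin_pos|]. intros h Hh.
  assert (Hh1 := Rlt_le_trans _ _ _ Hh (Rmin_l _ _)).
  assert (Hh2 := Rlt_le_trans _ _ _ Hh (Rmin_r _ _)).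
  assert (E0 := E (RtoC 0) ltac:(now rewrite Cmod_0)). rewrite Cplus_0_r in E0.
  rewrite <- E0, <- E by easy. now apply H'.
Qed.

Lemma cderiv_ext f g z l : (forall w, f w = g w) -> cderiv f z l -> cderiv g z l.
Proof. intros E. apply (cderiv_ext_loc f g z l 1); [lra|auto]. Qed.

Lemma cderiv_const c z : cderiv (fun _ => c) z 0.
Proof.
  intros eps He; exists 1; split; [lra|]. intros h _.
  replace (c - c - 0 * h)%C with (RtoC 0) by ring. rewrite Cmod_0. assert (H := Cmod_ge_0 h). nra.
Qed.

Lemma cderiv_lin a b z : cderiv (fun w => a * w + b)%C z a.
Proof.
  intros eps He; exists 1; split; [lra|]. intros h _.
  replace (a * (z + h) + b - (a * z + b) - a * h)%C with (RtoC 0) by ring.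
  rewrite Cmod_0. assert (H := Cmod_ge_0 h). nra.
Qed.

Lemma cderiv_id z : cderiv (fun w => w) z 1.
Proof. apply cderiv_ext with (fun w => 1 * w + 0)%C; [intros; ring|apply cderiv_lin]. Qed.

Lemma cderiv_plus f g z l m : cderiv f z l -> cderiv g z m ->
  cderiv (fun w => f w + g w)%C z (l + m)%C.
Proof.
  intros H H' eps He. destruct (H (eps/2) ltac:(lra)) as [d [Hd H1]].
  destruct (H' (eps/2) ltac:(lra)) as [d' [Hd' H2]].
  exists (Rmin d d'); split; [now apply Rmin_pos|]. intros h Hh.
  specialize (H1 h (Rlt_le_trans _ _ _ Hh (Rmin_l _ _))).
  specialize (H2 h (Rlt_le_trans _ _ _ Hh (Rmin_r _ _))).
  replace (f (z + h)%C + g (z + h)%C - (f z + g z) - (l + m) * h)%C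
    with ((f (z + h)%C - f z - l * h) + (g (z + h)%C - g z - m * h))%C by ring.
  eapply Rle_trans; [apply Cmod_triangle|]. lra.
Qed.

Lemma cderiv_comp f g z l m : cderiv g z m -> cderiv f (g z) l ->
  cderiv (fun w => f (g w)) z (l * m)%C.
Proof.
  intros Hg Hf eps He. assert (Hl := Cmod_ge_0 l). assert (Hm := Cmod_ge_0 m).
  set (e1 := eps / 2 / (Cmod m + 1)).
  assert (He1 : 0 < e1) by (unfold e1; apply Rdiv_lt_0_compat; lra).
  (* The cap 1 bounds the increment of [g] by [(|m| + 1) |h|]; the other entry absorbs the factor
     [|l|]. *)
  set (e2 := Rmin 1 (eps / 2 / (Cmod l + 1))).
  assert (He2 : 0 < e2) by (unfold e2; apply Rmin_pos; [lra|apply Rdiv_lt_0_compat; lra]).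
  destruct (Hf e1 He1) as [d1 [Hd1 H1]]. destruct (Hg e2 He2) as [d2 [Hd2 H2]].
  destruct (cderiv_ccont g z m Hg d1 Hd1) as [d3 [Hd3 H3]].
  exists (Rmin d2 d3); split; [now apply Rmin_pos|]. intros h Hh.
  specialize (H2 h (Rlt_le_trans _ _ _ Hh (Rmin_l _ _))).
  specialize (H3 h (Rlt_le_trans _ _ _ Hh (Rmin_r _ _))).
  specialize (H1 _ H3). replace (g z + (g (z + h)%C - g z))%C with (g (z + h)%C) in H1 by ring.
  set (k := (g (z + h)%C - g z)%C) in *.
  replace (f (g (z + h)%C) - f (g z) - l * m * h)%C
    with ((f (g (z + h)%C) - f (g z) - l * k) + l * (k - m * h))%C by ring.
  eapply Rle_trans; [apply Cmod_triangle|]. rewrite Cmod_mult.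
  assert (Hk : Cmod k <= (Cmod m + 1) * Cmod h).
  { replace k with ((k - m * h) + m * h)%C by ring. eapply Rle_trans; [apply Cmod_triangle|].
    rewrite Cmod_mult. assert (e2 <= 1) by apply Rmin_l. assert (H0 := Cmod_ge_0 h). nra. }
  assert (A : e1 * Cmod k <= eps / 2 * Cmod h).
  { apply Rle_trans with (e1 * ((Cmod m + 1) * Cmod h)).
    - apply Rmult_le_compat_l; lra.
    - right; unfold e1; field; lra. }
  assert (B : Cmod l * Cmod (k - m * h) <= eps / 2 * Cmod h).
  { assert (H0 := Cmod_ge_0 h). assert (H4 := Cmod_ge_0 (k - m * h)).
    apply Rle_trans with ((Cmod l + 1) * (eps / 2 / (Cmod l + 1) * Cmod h)).
    - apply Rmult_le_compat; try lra. eapply Rle_trans; [exact H2|].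
      apply Rmult_le_compat_r; [easy|apply Rmin_r].
    - right; field; lra. }
  lra.
Qed.

Lemma cderiv_sqr z : cderiv (fun w => w * w)%C z (2 * z)%C.
Proof.
  intros eps He; exists eps; split; [easy|]. intros h Hh.
  replace ((z + h) * (z + h) - z * z - 2 * z * h)%C with (h * h)%C by ring.
  rewrite Cmod_mult. assert (H := Cmod_ge_0 h). nra.
Qed.

Lemma cderiv_scal c f z l : cderiv f z l -> cderiv (fun w => c * f w)%C z (c * l)%C.
Proof.
  intros H. apply (cderiv_ext (fun w => c * f w + 0)%C); [intros; ring|].
  apply (cderiv_comp (fun w => c * w + 0)%C f); [easy|apply cderiv_lin].
Qed.

(* Polarization: [f g = ((f + g)^2 - (f - g)^2) / 4] *)
Lemma cderiv_mult f g z l m : cderiv f z l -> cderiv g z m ->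
  cderiv (fun w => f w * g w)%C z (l * g z + f z * m)%C.
Proof.
  intros Hf Hg.
  assert (H1 := cderiv_plus _ _ _ _ _ Hf Hg).
  assert (H2 := cderiv_plus _ _ _ _ _ Hf (cderiv_scal (RtoC (-1)) _ _ _ Hg)).
  assert (H3 := cderiv_comp _ _ _ _ _ H1 (cderiv_sqr _)).
  assert (H4 := cderiv_comp _ _ _ _ _ H2 (cderiv_sqr _)).
  assert (H5 := cderiv_plus _ _ _ _ _ (cderiv_scal (RtoC (/4)) _ _ _ H3) (cderiv_scal (RtoC (-/4)) _ _ _ H4)).
  assert (E : (l * g z + f z * m)%C = (RtoC (/4) * (2 * (f z + g z) * (l + m)) + RtoC (-/4) * (2 * (f z + RtoC (-1) * g z) * (l + RtoC (-1) * m)))%C).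
  { rewrite RtoC_opp, RtoC_inv by lra. field. }
  rewrite E. revert H5. apply cderiv_ext.
  intros w. rewrite RtoC_opp, RtoC_inv by lra. field.
Qed.

Lemma cderiv_inv z : z <> RtoC 0 -> cderiv Cinv z (- / (z * z))%C.
Proof.
  intros Hz eps He. assert (Hp := proj1 (Cmod_gt_0 z) Hz).
  set (r := Cmod z) in *.
  (* Below [r / 2] one has [|z + h| >= r / 2], so the remainder [h^2 / ((z + h) z^2)] is at most
     [2 |h|^2 / r^3]; the second entry turns this into [eps |h|]. *)
  exists (Rmin (r / 2) (eps * (r * r * r) / 2)). split.
  { apply Rmin_pos; [lra|]. apply Rdiv_lt_0_compat; [|lra]. repeat apply Rmult_lt_0_compat; lra. }
  intros h Hh. assert (Hh1 := Rlt_le_trans _ _ _ Hh (Rmin_l _ _)).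
  assert (Hh2 := Rlt_le_trans _ _ _ Hh (Rmin_r _ _)).
  assert (Hz' : r / 2 <= Cmod (z + h)).
  { assert (H := Cmod_triangle_rev z (- h)). rewrite Cmod_opp in H. fold r in H.
    replace (z - - h)%C with (z + h)%C in H by ring. lra. }
  assert (Hn : (z + h)%C <> RtoC 0) by (apply Cmod_gt_0; lra).
  replace (/ (z + h) - / z - - / (z * z) * h)%C with (h * (h * (/ (z + h) * (/ z * / z))))%C by (field; split; easy).
  rewrite !Cmod_mult, !Cmod_inv by easy. fold r. rewrite (Rmult_comm eps).
  apply Rmult_le_compat_l; [apply Cmod_ge_0|].
  assert (H0 := Cmod_ge_0 h).
  apply Rle_trans with (eps * (r * r * r) / 2 * (/ (r / 2) * (/ r * / r))).
  - apply Rmult_le_compat; try lra.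
    + repeat apply Rmult_le_pos; left; apply Rinv_0_lt_compat; lra.
    + apply Rmult_le_compat_r; [apply Rmult_le_pos; left; apply Rinv_0_lt_compat; lra|].
      apply Rinv_le_contravar; lra.
  - right; field; lra.
Qed.

(** The bridge to real analysis: on a line, the two components are real functions to which the mean
    value theorem and the fundamental theorem of calculus apply. *)
Lemma cderiv_line f z d t l : cderiv f (z + RtoC t * d)%C l ->
  is_derive (fun t => Re (f (z + RtoC t * d)%C)) t (Re (l * d)) /\
  is_derive (fun t => Im (f (z + RtoC t * d)%C)) t (Im (l * d)).
Proof.
  intros H.
  assert (A : forall eps : posreal, exists del : posreal, forall y, Rabs (y - t) < del ->
    Cmod (f (z + y * d)%C - f (z + t * d)%C - RtoC (y - t) * (l * d)) <= eps * Rabs (y - t)).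
  { intros eps. assert (Hd := Cmod_ge_0 d). assert (He := cond_pos eps).
    destruct (H (eps / (Cmod d + 1))) as [e [He' H1]]; [apply Rdiv_lt_0_compat; lra|].
    assert (Hp : 0 < e / (Cmod d + 1)) by (apply Rdiv_lt_0_compat; lra).
    exists (mkposreal _ Hp). simpl. intros y Hy. assert (Hy0 := Rabs_pos (y - t)).
    specialize (H1 (RtoC (y - t) * d)%C). rewrite Cmod_mult, Cmod_R in H1.
    replace (z + t * d + RtoC (y - t) * d)%C with (z + y * d)%C in H1
      by (rewrite RtoC_minus; ring).
    replace (l * (RtoC (y - t) * d))%C with (RtoC (y - t) * (l * d))%C in H1 by ring.
    eapply Rle_trans; [apply H1|].
    - apply Rle_lt_trans with (Rabs (y - t) * (Cmod d + 1)); [nra|].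
      replace e with (e / (Cmod d + 1) * (Cmod d + 1)) by (field; lra).
      apply Rmult_lt_compat_r; lra.
    - apply Rle_trans with (eps / (Cmod d + 1) * (Rabs (y - t) * (Cmod d + 1))).
      + apply Rmult_le_compat_l; [left; apply Rdiv_lt_0_compat; lra|nra].
      + right; field; lra. }
  split; split; try apply is_linear_scal_l; intros x Hx;
    apply (is_filter_lim_locally_unique (K := R_AbsRing) (V := R_NormedModule)) in Hx; subst x; intros eps;
    destruct (A eps) as [del H1]; exists del; intros y Hy; specialize (H1 y Hy);
    (eapply Rle_trans; [|exact H1]).
  - eapply Rle_trans; [|apply Re_le_Cmod]. right.
    change (Rabs (Re (f (z + y * d)%C) - Re (f (z + t * d)%C) - (y - t) * Re (l * d)) =
      Rabs (Re (f (z + y * d)%C - f (z + t * d)%C - RtoC (y - t) * (l * d)))).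
    f_equal. unfold Cminus. rewrite !re_plus, !re_opp, re_scal_l. ring.
  - eapply Rle_trans; [|apply Im_le_Cmod]. right.
    change (Rabs (Im (f (z + y * d)%C) - Im (f (z + t * d)%C) - (y - t) * Im (l * d)) =
      Rabs (Im (f (z + y * d)%C - f (z + t * d)%C - RtoC (y - t) * (l * d)))).
    f_equal. unfold Cminus. rewrite !im_plus, !im_opp, im_scal_l. ring.
Qed.

Lemma is_derive_0_eq (g : R -> R) : (forall t, 0 <= t <= 1 -> is_derive g t 0) -> g 1 = g 0.
Proof.
  intros H. destruct (MVT_gen g 0 1 (fun _ => 0)) as [c [_ Hc]].
  - intros t Ht. rewrite Rmin_left, Rmax_right in Ht by lra. apply H; lra.
  - intros t Ht. rewrite Rmin_left, Rmax_right in Ht by lra.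
    apply continuity_pt_filterlim. apply (ex_derive_continuous g). exists 0. apply H; lra.
  - lra.
Qed.

Lemma cderiv_0_eq f z w :
  (forall t, 0 <= t <= 1 -> cderiv f (z + RtoC t * (w - z))%C 0) -> f w = f z.
Proof.
  intros H.
  assert (A := fun t Ht => cderiv_line f z (w - z) t 0 (H t Ht)).
  assert (E1 : (z + 1%R * (w - z))%C = w) by ring.
  assert (E0 : (z + 0%R * (w - z))%C = z) by ring.
  assert (R0 := is_derive_0_eq (fun t => Re (f (z + RtoC t * (w - z))%C))).
  assert (I0 := is_derive_0_eq (fun t => Im (f (z + RtoC t * (w - z))%C))).
  cbv beta in R0, I0. rewrite E1, E0 in R0, I0. apply injective_projections.
  - apply R0. intros t Ht. destruct (A t Ht) as [A1 _]. now rewrite Cmult_0_l in A1.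
  - apply I0. intros t Ht. destruct (A t Ht) as [_ A2]. now rewrite Cmult_0_l in A2.
Qed.

Lemma cderiv_0_halfplane f th z w : (forall s, th < Re s -> cderiv f s 0) ->
  th < Re z -> th < Re w -> f w = f z.
Proof.
  intros H Hz Hw. apply cderiv_0_eq. intros t Ht. apply H.
  unfold Cminus. rewrite re_plus, re_scal_l, re_plus, re_opp.
  destruct (Rle_lt_dec (Re z) (Re w)); nra.
Qed.

(** * Termwise differentiation and power series *)

Lemma csums_le u m M l : (forall k, Cmod (u k) <= m k) -> (forall n, Rsum m n <= M) ->
  csums u l -> Cmod l <= M.
Proof.
  intros H1 H2 H. destruct (csums_abs u m M H1 H2) as [l' [H3 H4]].
  now rewrite (csums_unique _ _ _ H H3).
Qed.

(** Summable second-order remainder constants give a total remainder of at most [M |h|^2]. Power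
    series and Dirichlet series are both differentiated this way. *)
Lemma cderiv_termwise (u : nat -> C -> C) (du : nat -> C) (F : C -> C) z l m M d :
  0 < d -> (forall n, Rsum m n <= M) ->
  (forall k h, Cmod h < d -> Cmod (u k (z + h)%C - u k z - du k * h) <= m k * (Cmod h * Cmod h)) ->
  (forall h, Cmod h < d -> csums (fun k => u k (z + h)%C) (F (z + h)%C)) ->
  csums du l -> cderiv F z l.
Proof.
  intros Hd HM Hu HF Hl eps He.
  assert (HM0 : 0 <= M) by (apply (HM O)).
  exists (Rmin d (eps / (M + 1))). split.
  { apply Rmin_pos; [easy|apply Rdiv_lt_0_compat; lra]. }
  intros h Hh. assert (Hh1 := Rlt_le_trans _ _ _ Hh (Rmin_l _ _)).
  assert (Hh2 := Rlt_le_trans _ _ _ Hh (Rmin_r _ _)). assert (H0 := Cmod_ge_0 h).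
  assert (HF0 := HF (RtoC 0) ltac:(now rewrite Cmod_0)). rewrite Cplus_0_r in HF0.
  assert (Hs := csums_minus _ _ _ _ (csums_minus _ _ _ _ (HF h Hh1) HF0) (csums_scal h _ _ Hl)).
  replace (F (z + h)%C - F z - l * h)%C with (F (z + h)%C - F z - h * l)%C by ring.
  apply Rle_trans with ((Cmod h * Cmod h) * M).
  - apply (csums_le _ (fun k => (Cmod h * Cmod h) * m k) _ _) with (3 := Hs).
    + intros k. cbv beta. rewrite (Cmult_comm h), (Rmult_comm _ (m k)). now apply Hu.
    + intros n. rewrite Rsum_scal. apply Rmult_le_compat_l; [nra|apply HM].
  - assert (Cmod h * (M + 1) < eps).
    { replace eps with (eps / (M + 1) * (M + 1)) by (field; lra). apply Rmult_lt_compat_r; lra. }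
    nra.
Qed.

Lemma Rsum_geom q n : 0 <= q < 1 -> Rsum (fun k => q ^ k) n <= / (1 - q).
Proof.
  intros Hq. assert (E : Rsum (fun k => q ^ k) n = (1 - q ^ n) / (1 - q)).
  { induction n; simpl; [field; lra|]. rewrite IHn. field; lra. }
  rewrite E. unfold Rdiv. rewrite <- (Rmult_1_l (/ (1 - q))) at 2.
  apply Rmult_le_compat_r; [left; apply Rinv_0_lt_compat; lra|].
  assert (0 <= q ^ n) by (apply pow_le; lra). lra.
Qed.

Lemma Rsum_ge_last u n c : (forall k, (k < n)%nat -> c <= u k) -> INR n * c <= Rsum u n.
Proof.
  induction n as [|n IH]; intros H; [simpl; lra|].
  rewrite S_INR. simpl. assert (H1 := IH ltac:(intros; apply H; lia)).
  assert (H2 := H n ltac:(lia)). lra.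
Qed.

(** Each [r^j] with [j < k] is at least [r^k], so [k r^k] is at most a partial geometric sum. *)
Lemma INR_pow_bound r k : 0 <= r < 1 -> INR k * r ^ k <= / (1 - r).
Proof.
  intros Hr. eapply Rle_trans; [|apply (Rsum_geom r k Hr)]. apply Rsum_ge_last.
  intros j Hj. replace k with (j + (k - j))%nat by lia. rewrite pow_add.
  assert (H1 : 0 <= r ^ j) by (apply pow_le; lra).
  assert (H2 : r ^ (k - j) <= 1).
  { rewrite <- (pow1 (k - j)). apply pow_incr; lra. }
  nra.
Qed.

Lemma Rsum_sqr_geom q : 0 <= q < 1 -> exists M, forall n, Rsum (fun k => INR k * INR k * q ^ k) n <= M.
Proof.
  (* With [r] the fourth root of [q], [k^2 q^k = (k r^k)^2 (r^2)^k]: the first factor is bounded and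
     the second is geometric. *)
  intros Hq. set (r := sqrt (sqrt q)).
  assert (E : q = (r * r) * (r * r)).
  { unfold r. rewrite !sqrt_sqrt; [easy|lra|apply sqrt_pos]. }
  assert (Hr0 : 0 <= r) by apply sqrt_pos.
  clearbody r.
  assert (Hr : r < 1).
  { apply Rnot_le_lt; intros H. assert (1 <= r * r) by nra. nra. }
  exists (/ (1 - r) * / (1 - r) * / (1 - r * r)). intros n.
  apply Rle_trans with (Rsum (fun k => / (1 - r) * / (1 - r) * (r * r) ^ k) n).
  - apply Rsum_le. intros k _.
    assert (Eq : q ^ k = (r * r) ^ k * (r * r) ^ k) by (rewrite E, (Rpow_mult_distr (r * r)); easy).
    rewrite Eq.
    assert (H := INR_pow_bound r k ltac:(lra)).
    assert (0 <= INR k * r ^ k) by (apply Rmult_le_pos; [apply pos_INR|apply pow_le; lra]).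
    replace (INR k * INR k * ((r * r) ^ k * (r * r) ^ k)) with ((INR k * r ^ k) * (INR k * r ^ k) * (r * r) ^ k)
      by (rewrite Rpow_mult_distr; ring).
    apply Rmult_le_compat_r; [apply pow_le; nra|]. apply Rmult_le_compat; lra.
  - rewrite Rsum_scal. apply Rmult_le_compat_l.
    + apply Rmult_le_pos; left; apply Rinv_0_lt_compat; lra.
    + apply Rsum_geom. nra.
Qed.

(** Induction through [D_(k+1) = (z + h) D_k + k z^(k-1) h^2]. The factor [r * r] on the left
    replaces the exponent [k - 2], which truncated subtraction would spoil for small [k]. *)
Lemma Cpow_remainder z h r k : 0 < r -> Cmod z <= r -> Cmod (z + h) <= r ->
  Cmod ((z + h) ^ k - z ^ k - INR k * z ^ (k - 1) * h) * (r * r) <= INR k * INR k * r ^ k * (Cmod h * Cmod h).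
Proof.
  intros Hr Hz Hzh. assert (Hh := Cmod_ge_0 h). assert (Hz0 := Cmod_ge_0 z).
  induction k as [|k IH].
  - simpl. replace (1 - 1 - 0 * 1 * h)%C with (RtoC 0) by ring. rewrite Cmod_0. lra.
  - set (D := ((z + h) ^ k - z ^ k - INR k * z ^ (k - 1) * h)%C) in *.
    assert (E : ((z + h) ^ S k - z ^ S k - INR (S k) * z ^ (S k - 1) * h)%C
      = ((z + h) * D + INR k * z ^ (k - 1) * (h * h))%C).
    { unfold D. rewrite S_INR, RtoC_plus, !Cpow_S. destruct k as [|k].
      - simpl. ring.
      - replace (S (S k) - 1)%nat with (S k) by lia. replace (S k - 1)%nat with k by lia.
        rewrite !Cpow_S. ring. }
    rewrite E.
    assert (B : INR k * Cmod z ^ (k - 1) * (r * r) <= INR k * r ^ S k).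
    { destruct k as [|k]; [simpl; lra|]. replace (S k - 1)%nat with k by lia.
      rewrite Rmult_assoc. apply Rmult_le_compat_l; [apply pos_INR|].
      replace (r ^ S (S k)) with (r ^ k * (r * r)) by (simpl; ring).
      apply Rmult_le_compat_r; [nra|]. apply pow_incr; lra. }
    assert (T := Cmod_triangle ((z + h) * D) (INR k * z ^ (k - 1) * (h * h))).
    rewrite !Cmod_mult, Cmod_pow, Cmod_R, (Rabs_pos_eq (INR k)) in T by apply pos_INR.
    assert (HD := Cmod_ge_0 D).
    assert (B1 : Cmod (z + h) * Cmod D * (r * r) <= INR k * INR k * r ^ S k * (Cmod h * Cmod h)).
    { simpl. apply Rle_trans with (r * (Cmod D * (r * r))).
      - rewrite Rmult_assoc. apply Rmult_le_compat_r; [|easy]. apply Rmult_le_pos; nra.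
      - replace (INR k * INR k * (r * r ^ k) * (Cmod h * Cmod h)) with (r * (INR k * INR k * r ^ k * (Cmod h * Cmod h))) by ring.
        apply Rmult_le_compat_l; lra. }
    assert (Hrr : 0 < r * r) by nra.
    apply Rle_trans with ((Cmod (z + h) * Cmod D + INR k * Cmod z ^ (k - 1) * (Cmod h * Cmod h)) * (r * r)).
    { apply Rmult_le_compat_r; lra. }
    rewrite S_INR. assert (HP : 0 <= r ^ S k) by (apply pow_le; lra).
    assert (Hk := pos_INR k). assert (Hhh : 0 <= Cmod h * Cmod h) by nra.
    assert (B2 : INR k * Cmod z ^ (k - 1) * (Cmod h * Cmod h) * (r * r) <= INR k * r ^ S k * (Cmod h * Cmod h)).
    { replace (INR k * Cmod z ^ (k - 1) * (Cmod h * Cmod h) * (r * r)) with ((INR k * Cmod z ^ (k - 1) * (r * r)) * (Cmod h * Cmod h)) by ring.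
      now apply Rmult_le_compat_r. }
    assert (0 <= r ^ S k * (Cmod h * Cmod h)) by now apply Rmult_le_pos.
    rewrite Rmult_plus_distr_r. nra.
Qed.

Lemma power_series_bound b R M w : 0 < R -> Cmod w < R -> (forall k, Cmod (b k) * R ^ k <= M) ->
  forall n, Rsum (fun k => Cmod (b k * w ^ k)) n <= M * / (1 - Cmod w / R).
Proof.
  intros HR Hw Hb n. assert (Hw0 := Cmod_ge_0 w).
  assert (Hq : 0 <= Cmod w / R < 1).
  { split; [apply Rdiv_le_0_compat; lra|]. apply Rmult_lt_reg_r with R; [easy|].
    unfold Rdiv. rewrite Rmult_assoc, Rinv_l; lra. }
  assert (HM : 0 <= M) by (specialize (Hb O); simpl in Hb; assert (H := Cmod_ge_0 (b O)); lra).
  apply Rle_trans with (Rsum (fun k => M * (Cmod w / R) ^ k) n).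
  - apply Rsum_le. intros k _. rewrite Cmod_mult, Cmod_pow.
    apply Rle_trans with (Cmod (b k) * R ^ k * (Cmod w / R) ^ k).
    + right. unfold Rdiv. rewrite Rpow_mult_distr, pow_inv. field. apply pow_nonzero; lra.
    + apply Rmult_le_compat_r; [apply pow_le; lra|apply Hb].
  - rewrite Rsum_scal. apply Rmult_le_compat_l; [easy|now apply Rsum_geom].
Qed.

Lemma cderiv_power_series (b : nat -> C) (F : C -> C) R M : 0 < R ->
  (forall k, Cmod (b k) * R ^ k <= M) ->
  (forall w, Cmod w < R -> csums (fun k => b k * w ^ k)%C (F w)) ->
  forall w, Cmod w < R -> exists l,
    csums (fun k => b (S k) * INR (S k) * w ^ k)%C l /\ cderiv F w l.
Proof.
  intros HR Hb HF w Hw. assert (Hw0 := Cmod_ge_0 w).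
  (* Room on both sides of [r]: increments shorter than [r - |w|] stay in the disc of radius [r],
     and [r / R < 1] beats the factor [k^2]. *)
  set (r := (Cmod w + R) / 2). assert (Hr : Cmod w < r < R) by (unfold r; lra).
  destruct (Rsum_sqr_geom (r / R)) as [M' HM'].
  { split; [apply Rdiv_le_0_compat; lra|]. apply Rmult_lt_reg_r with R; [easy|].
    unfold Rdiv. rewrite Rmult_assoc, Rinv_l; lra. }
  assert (HM : 0 <= M) by (specialize (Hb O); simpl in Hb; assert (H := Cmod_ge_0 (b O)); lra).
  assert (Bk : forall k, Cmod (b k) * (INR k * INR k * r ^ k) <= M * (INR k * INR k * (r / R) ^ k)).
  { intros k. apply Rle_trans with (Cmod (b k) * R ^ k * (INR k * INR k * (r / R) ^ k)).
    - right. unfold Rdiv. rewrite Rpow_mult_distr, pow_inv. field. apply pow_nonzero; lra.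
    - apply Rmult_le_compat_r; [|apply Hb]. apply Rmult_le_pos; [apply Rmult_le_pos; apply pos_INR|].
      apply pow_le, Rdiv_le_0_compat; lra. }
  (* [m] majorizes the second-order remainders and [r * m] the derivative terms, so one convergent
     sum serves twice. *)
  set (m := fun k => M / (r * r) * (INR k * INR k * (r / R) ^ k)).
  set (du := fun k => (b k * INR k * w ^ (k - 1))%C).
  assert (Hdu : forall k, Cmod (du k) <= r * m k).
  { intros k. unfold du, m. rewrite !Cmod_mult, Cmod_pow, Cmod_R, Rabs_pos_eq by apply pos_INR.
    apply Rle_trans with (/ r * (Cmod (b k) * (INR k * INR k * r ^ k))).
    - destruct k as [|k]; [simpl; lra|]. replace (S k - 1)%nat with k by lia.
      replace (/ r * (Cmod (b (S k)) * (INR (S k) * INR (S k) * r ^ S k)))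
        with (Cmod (b (S k)) * INR (S k) * (INR (S k) * r ^ k)) by (simpl; field; lra).
      apply Rmult_le_compat_l; [apply Rmult_le_pos; [apply Cmod_ge_0|apply pos_INR]|].
      rewrite <- (Rmult_1_l (Cmod w ^ k)). apply Rmult_le_compat; try lra.
      + apply pow_le; lra.
      + rewrite S_INR. assert (H := pos_INR k). lra.
      + apply pow_incr; lra.
    - apply Rle_trans with (/ r * (M * (INR k * INR k * (r / R) ^ k))).
      + apply Rmult_le_compat_l; [left; apply Rinv_0_lt_compat; lra|apply Bk].
      + right; field; lra. }
  assert (Hm : forall n, Rsum m n <= M / (r * r) * M').
  { intros n. unfold m. rewrite Rsum_scal. apply Rmult_le_compat_l; [|apply HM'].
    apply Rdiv_le_0_compat; [easy|nra]. }
  destruct (csums_abs du (fun k => r * m k) (r * (M / (r * r) * M')) Hdu) as [l [Hl _]].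
  { intros n. rewrite Rsum_scal. apply Rmult_le_compat_l; [lra|apply Hm]. }
  exists l. split.
  - assert (H := csums_shift1 _ _ Hl). unfold du in H. simpl (RtoC (INR 0)) in H.
    replace (l - b O * 0 * w ^ (0 - 1))%C with l in H by ring. revert H.
    apply csums_ext. intros k. now replace (S k - 1)%nat with k by lia.
  - apply (cderiv_termwise (fun k w => b k * w ^ k)%C du F w l m (M / (r * r) * M') (r - Cmod w)); auto.
    + lra.
    + intros k h Hh. assert (Hzh : Cmod (w + h) <= r) by (eapply Rle_trans; [apply Cmod_triangle|lra]).
      assert (H := Cpow_remainder w h r k ltac:(lra) ltac:(lra) Hzh).
      replace (b k * (w + h) ^ k - b k * w ^ k - du k * h)%C with
        (b k * ((w + h) ^ k - w ^ k - INR k * w ^ (k - 1) * h))%C by (unfold du; ring).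
      rewrite Cmod_mult. unfold m.
      apply Rmult_le_reg_r with (r * r); [nra|].
      apply Rle_trans with (Cmod (b k) * (INR k * INR k * r ^ k) * (Cmod h * Cmod h)).
      * rewrite (Rmult_assoc (Cmod (b k))), (Rmult_assoc (Cmod (b k))).
        apply Rmult_le_compat_l; [apply Cmod_ge_0|easy].
      * apply Rle_trans with (M * (INR k * INR k * (r / R) ^ k) * (Cmod h * Cmod h)).
        { apply Rmult_le_compat_r; [assert (H0 := Cmod_ge_0 h); nra|apply Bk]. }
        right; field; lra.
    + intros h Hh. apply HF. eapply Rle_lt_trans; [apply Cmod_triangle|]. lra.
Qed.

(** * The complex exponential *)

Definition cexp (z : C) : C := (exp (Re z) * cos (Im z), exp (Re z) * sin (Im z)).

Lemma cexp_plus z w : cexp (z + w) = (cexp z * cexp w)%C.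
Proof.
  unfold cexp. rewrite re_plus, im_plus, exp_plus, cos_plus, sin_plus.
  apply injective_projections; simpl; ring.
Qed.

Lemma cexp_0 : cexp (RtoC 0) = RtoC 1.
Proof.
  unfold cexp, Re, Im; simpl. rewrite exp_0, cos_0, sin_0.
  apply injective_projections; simpl; ring.
Qed.

Lemma cexp_R x : cexp (RtoC x) = RtoC (exp x).
Proof.
  unfold cexp, Re, Im; simpl. rewrite cos_0, sin_0.
  apply injective_projections; simpl; ring.
Qed.

Lemma Cmod_cexp z : Cmod (cexp z) = exp (Re z).
Proof.
  unfold Cmod, cexp. simpl fst; simpl snd.
  replace ((exp (Re z) * cos (Im z)) ^ 2 + (exp (Re z) * sin (Im z)) ^ 2)
    with (exp (Re z) ^ 2 * (Rsqr (sin (Im z)) + Rsqr (cos (Im z)))) by (unfold Rsqr; ring).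
  rewrite sin2_cos2, Rmult_1_r. apply sqrt_pow2. left; apply exp_pos.
Qed.

Lemma cexp_neq_0 z : cexp z <> RtoC 0.
Proof. apply Cmod_gt_0. rewrite Cmod_cexp. apply exp_pos. Qed.

Lemma derivable_pt_lim_0_bound f l : derivable_pt_lim f 0 l ->
  forall eps, 0 < eps -> exists d, 0 < d /\ forall h, Rabs h < d -> Rabs (f h - f 0 - l * h) <= eps * Rabs h.
Proof.
  intros H eps He. destruct (H eps He) as [d Hd]. exists d; split; [apply cond_pos|].
  intros h Hh. destruct (Req_dec h 0) as [->|Hn].
  - replace (f 0 - f 0 - l * 0) with 0 by ring. rewrite Rabs_R0. lra.
  - specialize (Hd h Hn Hh). rewrite Rplus_0_l in Hd.
    replace (f h - f 0 - l * h) with (((f h - f 0) / h - l) * h) by (field; easy).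
    rewrite Rabs_mult. apply Rmult_le_compat_r; [apply Rabs_pos|lra].
Qed.

(** At 0 the claim reduces to the first-order expansions of [exp], [cos] and [sin]; the addition
    formula carries it to [z]. *)
Lemma cderiv_cexp z : cderiv cexp z (cexp z).
Proof.
  assert (H0 : cderiv cexp (RtoC 0) (RtoC 1)).
  { intros eps He.
    destruct (derivable_pt_lim_0_bound _ _ (derivable_pt_lim_exp 0) (eps / 8) ltac:(lra)) as [d1 [Hd1 H1]].
    destruct (derivable_pt_lim_0_bound _ _ (derivable_pt_lim_cos 0) (eps / 8) ltac:(lra)) as [d2 [Hd2 H2]].
    destruct (derivable_pt_lim_0_bound _ _ (derivable_pt_lim_sin 0) (eps / 8) ltac:(lra)) as [d3 [Hd3 H3]].
    rewrite exp_0 in H1. rewrite cos_0, sin_0 in H2. rewrite cos_0, sin_0 in H3.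
    (* Below, the real part costs three errors [eps / 8 * Cmod h] and the imaginary part four. The
       entry [eps / 8] handles the product [x * y]. *)
    set (d := Rmin (Rmin d1 d2) (Rmin d3 (Rmin 1 (eps / 8)))).
    assert (Hd : 0 < d /\ d <= d1 /\ d <= d2 /\ d <= d3 /\ d <= 1 /\ d <= eps / 8).
    { unfold d, Rmin. repeat destruct Rle_dec; lra. }
    exists d; split; [easy|]. intros h Hh.
    rewrite cexp_0, Cplus_0_l. set (x := Re h); set (y := Im h).
    assert (Hx := Re_le_Cmod h). assert (Hy := Im_le_Cmod h). fold x in Hx; fold y in Hy.
    specialize (H1 x ltac:(lra)). specialize (H2 y ltac:(lra)). specialize (H3 y ltac:(lra)).
    eapply Rle_trans; [apply Cmod_le_Re_Im|].
    assert (Er : Re (cexp h - 1 - 1 * h) = (exp x - 1 - 1 * x) * cos y + (1 + x) * (cos y - 1 - - 0 * y)).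
    { unfold Cminus. rewrite !re_plus, !re_opp, re_scal_l, re_RtoC. fold x. unfold cexp; simpl.
      fold x y. ring. }
    assert (Ei : Im (cexp h - 1 - 1 * h) = (exp x - 1 - 1 * x) * sin y + (1 + x) * (sin y - 0 - 1 * y) + x * y).
    { unfold Cminus. rewrite !im_plus, !im_opp, im_scal_l, im_RtoC. unfold cexp; simpl.
      fold x y. ring. }
    rewrite Er, Ei.
    assert (Hc : Rabs (cos y) <= 1) by (apply Rabs_le; apply COS_bound).
    assert (Hs : Rabs (sin y) <= 1) by (apply Rabs_le; apply SIN_bound).
    assert (Hx1 : Rabs (1 + x) <= 2).
    { eapply Rle_trans; [apply Rabs_triang|]. rewrite Rabs_R1. lra. }
    assert (P := Rabs_pos). assert (HC := Cmod_ge_0 h).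
    assert (A : Rabs ((exp x - 1 - 1 * x) * cos y + (1 + x) * (cos y - 1 - - 0 * y)) <= 3 * (eps / 8 * Cmod h)).
    { eapply Rle_trans; [apply Rabs_triang|]. rewrite !Rabs_mult.
      assert (A1 : Rabs (exp x - 1 - 1 * x) * Rabs (cos y) <= eps / 8 * Cmod h * 1).
      { apply Rmult_le_compat; auto. eapply Rle_trans; [exact H1|]. apply Rmult_le_compat_l; lra. }
      assert (A2 : Rabs (1 + x) * Rabs (cos y - 1 - - 0 * y) <= 2 * (eps / 8 * Cmod h)).
      { apply Rmult_le_compat; auto. eapply Rle_trans; [exact H2|]. apply Rmult_le_compat_l; lra. }
      lra. }
    assert (B : Rabs ((exp x - 1 - 1 * x) * sin y + (1 + x) * (sin y - 0 - 1 * y) + x * y) <= 4 * (eps / 8 * Cmod h)).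
    { eapply Rle_trans; [apply Rabs_triang|]. eapply Rle_trans; [apply Rplus_le_compat_r, Rabs_triang|].
      rewrite !Rabs_mult.
      assert (A1 : Rabs (exp x - 1 - 1 * x) * Rabs (sin y) <= eps / 8 * Cmod h * 1).
      { apply Rmult_le_compat; auto. eapply Rle_trans; [exact H1|]. apply Rmult_le_compat_l; lra. }
      assert (A2 : Rabs (1 + x) * Rabs (sin y - 0 - 1 * y) <= 2 * (eps / 8 * Cmod h)).
      { apply Rmult_le_compat; auto. eapply Rle_trans; [exact H3|]. apply Rmult_le_compat_l; lra. }
      assert (A3 : Rabs x * Rabs y <= eps / 8 * Cmod h).
      { apply Rmult_le_compat; auto. lra. }
      lra. }
    nra. }
  intros eps He. assert (Hm := proj1 (Cmod_gt_0 _) (cexp_neq_0 z)).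
  destruct (H0 (eps / Cmod (cexp z)) ltac:(apply Rdiv_lt_0_compat; lra)) as [d [Hd H1]].
  exists d; split; [easy|]. intros h Hh. specialize (H1 h Hh).
  rewrite cexp_0, Cplus_0_l in H1. rewrite cexp_plus.
  replace (cexp z * cexp h - cexp z - cexp z * h)%C with (cexp z * (cexp h - 1 - 1 * h))%C by ring.
  rewrite Cmod_mult. apply Rle_trans with (Cmod (cexp z) * (eps / Cmod (cexp z) * Cmod h)).
  - apply Rmult_le_compat_l; lra.
  - right; field; lra.
Qed.

Lemma exp_partial_sum x n : 0 <= x -> Rsum (fun k => / INR (fact k) * x ^ k) n <= exp x.
Proof.
  intros Hx. assert (H := is_exp_Reals x). apply is_pseries_R in H.
  assert (Hp : forall k, 0 <= / INR (fact k) * x ^ k).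
  { intros k. apply Rmult_le_pos; [left; apply Rinv_0_lt_compat, INR_fact_lt_0|now apply pow_le]. }
  assert (E : forall m, sum_n (fun k => / INR (fact k) * x ^ k) m = Rsum (fun k => / INR (fact k) * x ^ k) (S m)).
  { induction m; [rewrite sum_O; simpl; ring|]. rewrite sum_Sn, IHm. easy. }
  assert (L := is_lim_seq_incr_compare _ _ H). rewrite <- (Rplus_0_r (Rsum _ n)).
  eapply Rle_trans; [|apply (L ltac:(intros m; rewrite !E; apply Rsum_mono; auto) n)].
  rewrite E. rewrite Rplus_0_r. apply Rsum_mono; auto.
Qed.

(** The series defines an entire [P] with [P' = P] and [P 0 = 1], so [cexp (-z) * P z] has
    derivative 0 and is constantly 1. *)
Lemma cexp_series z : csums (fun k => RtoC (/ INR (fact k)) * z ^ k)%C (cexp z).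
Proof.
  set (b := fun k => RtoC (/ INR (fact k))).
  assert (Hb : forall k, Cmod (b k) = / INR (fact k)).
  { intros k. unfold b. rewrite Cmod_R. apply Rabs_pos_eq. left; apply Rinv_0_lt_compat, INR_fact_lt_0. }
  set (P := fun w => cser (fun k => b k * w ^ k)%C).
  assert (HP : forall w, csums (fun k => b k * w ^ k)%C (P w)).
  { intros w. apply cser_correct.
    destruct (csums_abs (fun k => b k * w ^ k)%C (fun k => / INR (fact k) * Cmod w ^ k) (exp (Cmod w))) as [l [Hl _]].
    - intros k. rewrite Cmod_mult, Cmod_pow, Hb. lra.
    - intros n. apply exp_partial_sum, Cmod_ge_0.
    - now exists l. }
  assert (HD : forall w, cderiv P w (P w)).
  { intros w. assert (Hw := Cmod_ge_0 w).
    destruct (cderiv_power_series b P (Cmod w + 1) (exp (Cmod w + 1))) with (w := w) as [l [Hl HD]]; auto; try lra.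
    - intros k. rewrite Hb. eapply Rle_trans; [|apply (exp_partial_sum _ (S k)); lra].
      apply (Rsum_term (fun k => / INR (fact k) * (Cmod w + 1) ^ k)); [|lia].
      intros i. apply Rmult_le_pos; [left; apply Rinv_0_lt_compat, INR_fact_lt_0|apply pow_le; lra].
    - replace (P w) with l; [easy|]. apply csums_unique with (2 := HP w). revert Hl. apply csums_ext.
      intros k. unfold b. rewrite fact_simpl, mult_INR. f_equal. rewrite <- RtoC_mult. f_equal.
      field. split; [apply INR_fact_neq_0|apply not_0_INR; lia]. }
  set (f := fun w => (cexp (RtoC (-1) * w + 0) * P w)%C).
  assert (Hf : forall w, cderiv f w 0).
  { intros w. assert (H := cderiv_mult _ _ _ _ _ (cderiv_comp cexp (fun w => RtoC (-1) * w + 0)%C w _ _ (cderiv_lin _ _ _) (cderiv_cexp _)) (HD w)).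
    cbv beta in H. replace (RtoC 0) with (cexp (RtoC (-1) * w + 0) * RtoC (-1) * P w + cexp (RtoC (-1) * w + 0) * P w)%C at 1; [exact H|ring]. }
  assert (E : f z = f (RtoC 0)) by (apply cderiv_0_eq; auto).
  assert (P0 : P (RtoC 0) = RtoC 1).
  { apply csums_unique with (1 := HP (RtoC 0)).
    assert (H := csums_single (fun k => b k * 0 ^ k)%C 0). cbv beta in H.
    replace (RtoC 1) with (b 0%nat * 0 ^ 0)%C; [apply H|].
    - intros [|i] Hi; [easy|]. rewrite Cpow_S; ring.
    - unfold b. simpl. rewrite Rinv_1. ring. }
  unfold f in E. rewrite P0 in E.
  replace (RtoC (-1) * 0 + 0)%C with (RtoC 0) in E by ring.
  rewrite cexp_0 in E. replace (cexp z) with (P z); [apply HP|].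
  transitivity (cexp z * (cexp (RtoC (-1) * z + 0) * P z))%C.
  - rewrite Cmult_assoc, <- cexp_plus. replace (z + (RtoC (-1) * z + 0))%C with (RtoC 0) by ring. rewrite cexp_0; ring.
  - rewrite E; ring.
Qed.

(** After the first two terms a factor [h^2] comes out, and [(k + 2)! >= k!] compares the rest with
    the real exponential series. *)
Lemma cexp_remainder h : Cmod (cexp h - 1 - h) <= Cmod h * Cmod h * exp (Cmod h).
Proof.
  assert (H := csums_shift1 _ _ (csums_shift1 _ _ (cexp_series h))). cbv beta in H.
  replace (cexp h - RtoC (/ INR (fact 0)) * h ^ 0 - RtoC (/ INR (fact 1)) * h ^ 1)%C with (cexp h - 1 - h)%C in H
    by (simpl; rewrite Rinv_1; ring).
  apply (csums_le _ (fun k => Cmod h * Cmod h * (/ INR (fact k) * Cmod h ^ k)) _ _) with (3 := H).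
  - intros k. rewrite Cmod_mult, Cmod_pow, Cmod_R, Rabs_pos_eq by (left; apply Rinv_0_lt_compat, INR_fact_lt_0).
    replace (Cmod h * Cmod h * (/ INR (fact k) * Cmod h ^ k)) with (/ INR (fact k) * Cmod h ^ S (S k)) by (simpl; ring).
    apply Rmult_le_compat_r; [apply pow_le, Cmod_ge_0|].
    apply Rinv_le_contravar; [apply INR_fact_lt_0|]. apply le_INR, fact_le. lia.
  - intros n. rewrite Rsum_scal. apply Rmult_le_compat_l.
    + apply Rmult_le_pos; apply Cmod_ge_0.
    + apply exp_partial_sum, Cmod_ge_0.
Qed.

(** * Absolutely convergent Dirichlet series *)

(** The real power [n^-x]; since [ln 0 = 0] here, [wt 0 x = 1]. *)
Definition wt (n : nat) (x : R) : R := exp (- x * ln (INR n)).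

Lemma npow_cexp n s : npow_neg n s = cexp (RtoC (- ln (INR n)) * s).
Proof.
  unfold npow_neg, cexp. rewrite re_scal_l, im_scal_l.
  apply injective_projections; simpl; f_equal; f_equal; ring.
Qed.

Lemma Cmod_npow n s : Cmod (npow_neg n s) = wt n (Re s).
Proof. rewrite npow_cexp, Cmod_cexp, re_scal_l. unfold wt. f_equal; ring. Qed.

Lemma wt_pos n x : 0 < wt n x.
Proof. apply exp_pos. Qed.

Lemma ln_INR_nonneg n : 0 <= ln (INR n).
Proof.
  destruct n as [|n].
  - simpl. unfold ln. destruct (Rlt_dec 0 0) as [r|_]; [exfalso; lra|apply Rle_refl].
  - rewrite <- ln_1. apply ln_le; [lra|]. rewrite S_INR. assert (H := pos_INR n). lra.
Qed.

Lemma ln_INR_pos n : (2 <= n)%nat -> 0 < ln (INR n).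
Proof. intros H. rewrite <- ln_1. apply ln_increasing; [lra|]. apply (lt_INR 1). lia. Qed.

Lemma ln_INR_mult n m : (1 <= n)%nat -> (1 <= m)%nat -> ln (INR (n * m)) = ln (INR n) + ln (INR m).
Proof. intros Hn Hm. rewrite mult_INR. apply ln_mult; apply (lt_INR 0); lia. Qed.

Lemma wt_le n x y : x <= y -> wt n y <= wt n x.
Proof.
  intros H. unfold wt. assert (H0 := ln_INR_nonneg n).
  apply Rnot_lt_le; intros H1. apply exp_lt_inv in H1. nra.
Qed.

Lemma wt_plus n x y : wt n (x + y) = wt n x * wt n y.
Proof. unfold wt. rewrite <- exp_plus. f_equal; ring. Qed.

Lemma wt_mult n m x : (1 <= n)%nat -> (1 <= m)%nat -> wt (n * m) x = wt n x * wt m x.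
Proof. intros. unfold wt. rewrite ln_INR_mult, <- exp_plus by easy. f_equal; ring. Qed.

Lemma npow_mult n m s : (1 <= n)%nat -> (1 <= m)%nat ->
  npow_neg (n * m) s = (npow_neg n s * npow_neg m s)%C.
Proof.
  intros. rewrite !npow_cexp, ln_INR_mult, <- cexp_plus by easy. f_equal.
  rewrite Ropp_plus_distr, RtoC_plus. ring.
Qed.

Lemma npow_plus n s t : npow_neg n (s + t)%C = (npow_neg n s * npow_neg n t)%C.
Proof. rewrite !npow_cexp, <- cexp_plus. f_equal; ring. Qed.

Lemma npow_1 s : npow_neg 1 s = RtoC 1.
Proof.
  rewrite npow_cexp. simpl. rewrite ln_1. replace (RtoC (-0) * s)%C with (RtoC 0).
  - apply cexp_0.
  - rewrite Ropp_0; ring.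
Qed.

Lemma npow_neq_0 n s : npow_neg n s <> RtoC 0.
Proof. rewrite npow_cexp. apply cexp_neq_0. Qed.

Lemma wt_1 x : wt 1 x = 1.
Proof. unfold wt. simpl. rewrite ln_1, Rmult_0_r. apply exp_0. Qed.

Lemma wt_inv n : (1 <= n)%nat -> wt n 1 = / INR n.
Proof.
  intros H. unfold wt. replace (- (1) * ln (INR n)) with (- ln (INR n)) by ring.
  rewrite exp_Ropp, exp_ln; [easy|]. apply (lt_INR 0); lia.
Qed.

Lemma wt_nonpos_exp n d : wt n (- d) * wt n d = 1.
Proof. rewrite <- wt_plus. unfold wt. replace (- (- d + d)) with 0 by ring. rewrite Rmult_0_l. apply exp_0. Qed.

Lemma ln_le_self x : 0 < x -> ln x <= x.
Proof.
  intros H. rewrite <- (ln_exp x) at 2. apply ln_le; [easy|].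
  assert (H0 := exp_ineq1 x ltac:(lra)). lra.
Qed.

(** One unit of abscissa pays for one factor [ln n]; this is the price of each differentiation. *)
Lemma ln_wt_1 n : (1 <= n)%nat -> ln (INR n) * wt n 1 <= 1.
Proof.
  intros H. assert (Hp : 0 < INR n) by (apply (lt_INR 0); lia). rewrite wt_inv by easy.
  apply Rmult_le_reg_r with (INR n); [easy|]. rewrite Rmult_assoc, Rinv_l by lra.
  assert (H0 := ln_le_self _ Hp). lra.
Qed.

(* Coefficients are indexed from 0; [a 0 = 0] makes the junk value [npow_neg 0 s = 1] harmless. *)
Definition dbd (x : R) (a : nat -> C) (M : R) : Prop :=
  a O = RtoC 0 /\ forall n, Rsum (fun k => Cmod (a k) * wt k x) n <= M.

Definition deval (a : nat -> C) (s : C) : C := cser (fun k => a k * npow_neg k s)%C.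

Lemma dbd_term_nonneg (a : nat -> C) x k : 0 <= Cmod (a k) * wt k x.
Proof. apply Rmult_le_pos; [apply Cmod_ge_0|left; apply wt_pos]. Qed.

Lemma dbd_nonneg x a M : dbd x a M -> 0 <= M.
Proof. intros [_ H]. apply (H O). Qed.

Lemma dbd_le x y a M M' : x <= y -> M <= M' -> dbd x a M -> dbd y a M'.
Proof.
  intros Hx HM [H0 H]. split; [easy|]. intros n. eapply Rle_trans; [|eapply Rle_trans; [apply (H n)|easy]].
  apply Rsum_le. intros k _. apply Rmult_le_compat_l; [apply Cmod_ge_0|now apply wt_le].
Qed.

Lemma dterm_bound x a M s : dbd x a M -> x <= Re s ->
  (forall k, Cmod (a k * npow_neg k s) <= Cmod (a k) * wt k x).
Proof.
  intros [H0 H] Hs k. rewrite Cmod_mult, Cmod_npow.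
  apply Rmult_le_compat_l; [apply Cmod_ge_0|now apply wt_le].
Qed.

Lemma deval_correct x a M s : dbd x a M -> x <= Re s ->
  csums (fun k => a k * npow_neg k s)%C (deval a s).
Proof.
  intros H Hs. apply cser_correct.
  destruct (csums_abs _ _ M (dterm_bound x a M s H Hs) (proj2 H)) as [l [Hl _]]. now exists l.
Qed.

Lemma deval_unique a s l : csums (fun k => a k * npow_neg k s)%C l -> deval a s = l.
Proof. apply cser_unique. Qed.

Lemma deval_bound x a M s : dbd x a M -> x <= Re s -> Cmod (deval a s) <= M.
Proof.
  intros H Hs. apply (csums_le _ _ M _ (dterm_bound x a M s H Hs) (proj2 H)).
  now apply deval_correct with x M.
Qed.

(** Norm bounds pass to coefficientwise limits, as in Fatou's lemma, because each partial sum
    involves only finitely many coefficients. *)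
Lemma dbd_lim x (u : nat -> nat -> C) (X : nat -> C) M :
  (forall n, clim (u n) (X n)) -> (forall J n, Rsum (fun k => Cmod (u k J) * wt k x) n <= M) ->
  forall n, Rsum (fun k => Cmod (X k) * wt k x) n <= M.
Proof.
  intros HX HM n.
  assert (A : forall eps, 0 < eps -> exists J0, forall J, (J0 <= J)%nat ->
    Rsum (fun k => Cmod (X k) * wt k x) n <= Rsum (fun k => Cmod (u k J) * wt k x) n + eps).
  { clear HM. induction n as [|n IH]; intros eps He; [exists O; intros; simpl; lra|].
    destruct (IH (eps/2) ltac:(lra)) as [J0 HJ0]. assert (Hw := wt_pos n x).
    destruct (HX n (eps / 2 / wt n x)) as [J1 HJ1]; [apply Rdiv_lt_0_compat; lra|].
    exists (max J0 J1); intros J HJ. specialize (HJ0 J ltac:(lia)). specialize (HJ1 J ltac:(lia)).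
    simpl. assert (T := Cmod_triangle_rev (X n) (u n J)). rewrite Cmod_minus_sym in T.
    assert (Cmod (X n) * wt n x <= Cmod (u n J) * wt n x + eps / 2).
    { replace (eps / 2) with (eps / 2 / wt n x * wt n x) by (field; lra).
      rewrite <- Rmult_plus_distr_r. apply Rmult_le_compat_r; lra. }
    lra. }
  apply Rnot_lt_le; intros Hlt.
  destruct (A ((Rsum (fun k => Cmod (X k) * wt k x) n - M) / 2) ltac:(lra)) as [J0 HJ0].
  specialize (HJ0 J0 (le_n _)). specialize (HM J0 n). lra.
Qed.

Lemma dbd_coef x a M n : dbd x a M -> Cmod (a n) <= M / wt n x.
Proof.
  intros [_ H]. assert (Hw := wt_pos n x). apply Rmult_le_reg_r with (wt n x); [easy|].
  replace (M / wt n x * wt n x) with M by (field; lra).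
  eapply Rle_trans; [|apply (H (S n))].
  apply (Rsum_term (fun k => Cmod (a k) * wt k x)); [|lia]. intros; apply dbd_term_nonneg.
Qed.

(** Completeness of the weighted l1 space in the form used throughout: a family with summable norms
    may be summed coefficient by coefficient or value by value with the same result, by
    [csums_fubini]. *)
Lemma dfamily x (y : nat -> nat -> C) m M :
  (forall j, dbd x (y j) (m j)) -> (forall n, Rsum m n <= M) ->
  exists X, (forall n, csums (fun j => y j n) (X n)) /\ dbd x X M /\
    forall s, x <= Re s -> csums (fun j => deval (y j) s) (deval X s).
Proof.
  intros Hy HM.
  assert (HX : forall n, csums (fun j => y j n) (cser (fun j => y j n))).
  { intros n. apply cser_correct.
    destruct (csums_abs (fun j => y j n) (fun j => / wt n x * m j) (/ wt n x * M)) as [l [Hl _]].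
    - intros j. rewrite Rmult_comm. now apply dbd_coef.
    - intros N. rewrite Rsum_scal. apply Rmult_le_compat_l; [left; apply Rinv_0_lt_compat, wt_pos|apply HM].
    - now exists l. }
  exists (fun n => cser (fun j => y j n)). split; [exact HX|]. split; [split|].
  - apply csums_unique with (1 := HX O). apply csums_ext with (fun _ => RtoC 0).
    + intros j. now destruct (Hy j) as [-> _].
    + apply (csums_finite (fun _ => RtoC 0) 0). easy.
  - apply (dbd_lim x (fun n J => Csum (fun j => y j n) J)); [exact HX|].
    intros J n. eapply Rle_trans; [|apply (HM J)].
    induction J; simpl.
    + rewrite Cmod_0. induction n; simpl; lra.
    + destruct (Hy J) as [_ HJ]. specialize (HJ n).
      eapply Rle_trans; [|apply Rplus_le_compat; [apply IHJ|apply HJ]].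
      rewrite <- Rsum_plus. apply Rsum_le. intros k _.
      rewrite <- Rmult_plus_distr_r. apply Rmult_le_compat_r; [left; apply wt_pos|apply Cmod_triangle].
  - intros s Hs.
    destruct (csums_fubini (fun j n => y j n * npow_neg n s)%C m M (fun j => deval (y j) s)
      (fun n => cser (fun j => y j n) * npow_neg n s)%C) as [l [H1 H2]].
    + intros j n. eapply Rle_trans; [|apply (proj2 (Hy j) n)]. apply Rsum_le. intros k _.
      now apply (dterm_bound x _ (m j)).
    + exact HM.
    + intros j. now apply deval_correct with x (m j).
    + intros n. apply csums_ext with (fun j => npow_neg n s * y j n)%C; [intros; ring|].
      rewrite Cmult_comm. apply csums_scal, HX.
    + now rewrite (deval_unique _ _ _ H2).
Qed.

(** * The algebra of absolutely convergent Dirichlet series *)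

Definition dscal (c : C) (a : nat -> C) (n : nat) : C := (c * a n)%C.
Definition dadd (a b : nat -> C) (n : nat) : C := (a n + b n)%C.
Definition dconst (c : C) (n : nat) : C := if Nat.eqb n 1 then c else RtoC 0.
(** Coefficients of [N^-s] times the series. *)
Definition dshift (N : nat) (a : nat -> C) (n : nat) : C :=
  if Nat.eqb (n mod N) 0 then a (n / N)%nat else RtoC 0.
(** Dirichlet convolution, written as a sum of shifted copies of [b] rather than over divisors, so
    that [dfamily] applies directly. *)
Definition dconv (a b : nat -> C) (n : nat) : C := Csum (fun j => a j * dshift j b n)%C (S n).
Fixpoint dpow (a : nat -> C) (k : nat) : nat -> C :=
  match k with O => dconst (RtoC 1) | S k' => dconv a (dpow a k') end.
(** Coefficients of the termwise derivative. *)
Definition dlog (a : nat -> C) (n : nat) : C := (RtoC (- ln (INR n)) * a n)%C.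

Lemma dbd_scal c x a M : dbd x a M -> dbd x (dscal c a) (Cmod c * M).
Proof.
  intros [H0 H]. split; [unfold dscal; rewrite H0; ring|]. intros n.
  rewrite <- (Rsum_ext (fun k => Cmod c * (Cmod (a k) * wt k x))).
  - rewrite Rsum_scal. apply Rmult_le_compat_l; [apply Cmod_ge_0|apply H].
  - intros k _. unfold dscal. rewrite Cmod_mult. ring.
Qed.

Lemma deval_scal c x a M s : dbd x a M -> x <= Re s -> deval (dscal c a) s = (c * deval a s)%C.
Proof.
  intros H Hs. apply deval_unique. apply csums_ext with (fun k => c * (a k * npow_neg k s))%C.
  - intros; unfold dscal; ring.
  - apply csums_scal. now apply deval_correct with x M.
Qed.

Lemma dbd_add x a b M M' : dbd x a M -> dbd x b M' -> dbd x (dadd a b) (M + M').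
Proof.
  intros [H0 H] [H0' H']. split; [unfold dadd; rewrite H0, H0'; ring|]. intros n.
  eapply Rle_trans; [|apply Rplus_le_compat; [apply (H n)|apply (H' n)]].
  rewrite <- Rsum_plus. apply Rsum_le. intros k _. rewrite <- Rmult_plus_distr_r.
  apply Rmult_le_compat_r; [left; apply wt_pos|apply Cmod_triangle].
Qed.

Lemma deval_add x a b M M' s : dbd x a M -> dbd x b M' -> x <= Re s ->
  deval (dadd a b) s = (deval a s + deval b s)%C.
Proof.
  intros H H' Hs. apply deval_unique.
  apply csums_ext with (fun k => a k * npow_neg k s + b k * npow_neg k s)%C.
  - intros; unfold dadd; ring.
  - apply csums_plus; [now apply deval_correct with x M|now apply deval_correct with x M'].
Qed.

Lemma dbd_const c x : dbd x (dconst c) (Cmod c).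
Proof.
  assert (H := Cmod_ge_0 c). split; [easy|]. intros [|[|n]].
  - easy.
  - unfold dconst; simpl. rewrite Cmod_0. lra.
  - induction n as [|n IH].
    + unfold dconst; simpl. rewrite Cmod_0, wt_1. lra.
    + eapply Rle_trans; [|exact IH]. change (Rsum (fun k => Cmod (dconst c k) * wt k x) (S (S n)) + Cmod (dconst c (S (S n))) * wt (S (S n)) x <= Rsum (fun k => Cmod (dconst c k) * wt k x) (S (S n))).
      unfold dconst at 2; simpl. rewrite Cmod_0. lra.
Qed.

Lemma deval_const c s : deval (dconst c) s = c.
Proof.
  apply deval_unique. assert (H := csums_single (fun k => dconst c k * npow_neg k s)%C 1).
  cbv beta in H. replace (dconst c 1 * npow_neg 1 s)%C with c in H.
  - apply H. intros i Hi. unfold dconst. destruct (Nat.eqb_spec i 1); [easy|ring].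
  - rewrite npow_1. unfold dconst; simpl; ring.
Qed.

(** The ceiling of [n / N] counts the multiples of [N] below [n], and it steps up exactly when [n]
    is itself such a multiple. *)
Lemma ceil_div_step N n : (1 <= N)%nat ->
  if Nat.eqb (n mod N) 0 then ((n + N - 1) / N = n / N /\ (S n + N - 1) / N = S (n / N))%nat
  else ((S n + N - 1) / N = (n + N - 1) / N)%nat.
Proof.
  intros HN. assert (H := Nat.div_mod n N ltac:(lia)). assert (Hr := Nat.mod_upper_bound n N ltac:(lia)).
  set (q := (n / N)%nat) in *. set (r := (n mod N)%nat) in *.
  destruct (Nat.eqb_spec r 0) as [E|E].
  - split; symmetry; [apply (Nat.div_unique _ _ _ (N - 1)%nat)|apply (Nat.div_unique _ _ _ 0%nat)]; nia.
  - transitivity (S q); [symmetry; apply (Nat.div_unique _ _ _ r)|apply (Nat.div_unique _ _ _ (r - 1)%nat)]; nia.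
Qed.

Lemma Csum_sparse N u n : (1 <= N)%nat ->
  Csum (fun k => if Nat.eqb (k mod N) 0 then u (k / N)%nat else RtoC 0) n = Csum u ((n + N - 1) / N)%nat.
Proof.
  intros HN. induction n as [|n IH].
  - rewrite Nat.div_small by lia. easy.
  - assert (H := ceil_div_step N n HN). cbn [Csum]. rewrite IH.
    destruct (Nat.eqb (n mod N) 0).
    + destruct H as [-> ->]. easy.
    + rewrite H. ring.
Qed.

Lemma Rsum_sparse N u n : (1 <= N)%nat ->
  Rsum (fun k => if Nat.eqb (k mod N) 0 then u (k / N)%nat else 0) n = Rsum u ((n + N - 1) / N)%nat.
Proof.
  intros HN. induction n as [|n IH].
  - rewrite Nat.div_small by lia. easy.
  - assert (H := ceil_div_step N n HN). cbn [Rsum]. rewrite IH.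
    destruct (Nat.eqb (n mod N) 0).
    + destruct H as [-> ->]. easy.
    + rewrite H. ring.
Qed.

Lemma csums_sparse N u l : (1 <= N)%nat -> csums u l ->
  csums (fun k => if Nat.eqb (k mod N) 0 then u (k / N)%nat else RtoC 0) l.
Proof.
  intros HN H eps He. destruct (H eps He) as [n0 H0]. exists (N * n0)%nat. intros n Hn.
  rewrite Csum_sparse by easy. apply H0. apply Nat.div_le_lower_bound; lia.
Qed.

Lemma div_exact_facts N k : (1 <= N)%nat -> (k mod N = 0)%nat -> (k <> 0)%nat ->
  k = (N * (k / N))%nat /\ (1 <= k / N)%nat.
Proof.
  intros HN Hk Hk0. assert (H := Nat.div_mod k N ltac:(lia)).
  rewrite Hk, Nat.add_0_r in H. split; [easy|]. destruct (k / N)%nat; lia.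
Qed.

Lemma dshift_term N a k (f : nat -> C) (c : C) : (1 <= N)%nat -> a O = RtoC 0 ->
  (forall m, (1 <= m)%nat -> f (N * m)%nat = (c * f m)%C) ->
  (dshift N a k * f k)%C = (if Nat.eqb (k mod N) 0 then c * (a (k / N)%nat * f (k / N)%nat) else 0)%C.
Proof.
  intros HN H0 Hf. unfold dshift. destruct (Nat.eqb_spec (k mod N) 0) as [E|E]; [|ring].
  destruct (Nat.eq_dec k 0) as [->|Hk].
  - rewrite Nat.Div0.div_0_l. rewrite H0. ring.
  - destruct (div_exact_facts N k HN E Hk) as [E1 E2]. rewrite E1 at 2. rewrite Hf by easy. ring.
Qed.

Lemma dbd_shift N x a M : (1 <= N)%nat -> dbd x a M -> dbd x (dshift N a) (wt N x * M).
Proof.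
  intros HN [H0 H]. split.
  - unfold dshift. rewrite Nat.Div0.mod_0_l, Nat.Div0.div_0_l. easy.
  - intros n. rewrite (Rsum_ext _ (fun k => if Nat.eqb (k mod N) 0 then wt N x * (Cmod (a (k / N)%nat) * wt (k / N) x) else 0)).
    + rewrite (Rsum_sparse N (fun k => wt N x * (Cmod (a k) * wt k x))) by easy. rewrite Rsum_scal.
      apply Rmult_le_compat_l; [left; apply wt_pos|apply H].
    + intros k _. unfold dshift. destruct (Nat.eqb_spec (k mod N) 0) as [E|E]; [|rewrite Cmod_0; ring].
      destruct (Nat.eq_dec k 0) as [->|Hk].
      * rewrite Nat.Div0.div_0_l, H0, Cmod_0. ring.
      * destruct (div_exact_facts N k HN E Hk) as [E1 E2]. rewrite E1 at 2.
        rewrite wt_mult by easy. ring.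
Qed.

Lemma deval_shift N x a M s : (1 <= N)%nat -> dbd x a M -> x <= Re s ->
  deval (dshift N a) s = (npow_neg N s * deval a s)%C.
Proof.
  intros HN H Hs. apply deval_unique.
  apply csums_ext with (fun k => if Nat.eqb (k mod N) 0 then (npow_neg N s * (a (k / N)%nat * npow_neg (k / N) s))%C else RtoC 0).
  - intros k. symmetry. apply (dshift_term N a k (fun k => npow_neg k s)); [easy|apply H|].
    intros m Hm. now apply npow_mult.
  - apply (csums_sparse N (fun k => npow_neg N s * (a k * npow_neg k s))%C); [easy|].
    apply csums_scal. now apply deval_correct with x M.
Qed.

Lemma dshift_gt j b n : b O = RtoC 0 -> (n < j)%nat -> dshift j b n = RtoC 0.
Proof.
  intros Hb H. unfold dshift. rewrite Nat.mod_small, Nat.div_small by easy.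
  destruct (Nat.eqb_spec n 0); easy.
Qed.

(** Submultiplicativity of the norm: the copies [a_j j^-s] times [b] have norms [|a_j| j^-x M'],
    whose sum is at most [M M']. *)
Lemma dbd_conv x a b M M' : dbd x a M -> dbd x b M' ->
  dbd x (dconv a b) (M * M') /\
  forall s, x <= Re s -> deval (dconv a b) s = (deval a s * deval b s)%C.
Proof.
  intros Ha Hb.
  destruct (dfamily x (fun j => dscal (a j) (dshift j b)) (fun j => M' * (Cmod (a j) * wt j x)) (M * M')) as [X [H1 [H2 H3]]].
  (* Index 0 is treated apart because [dbd_shift] asks for a positive factor; there [a 0 = 0]. *)
  - intros [|j].
    + destruct Ha as [Ha0 _]. split; [unfold dscal; rewrite Ha0; ring|].
      intros n. rewrite Ha0, Cmod_0. rewrite (Rsum_ext _ (fun k => 0 * 0)).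
      * rewrite Rsum_scal. lra.
      * intros k _. unfold dscal. rewrite Cmult_0_l, Cmod_0. ring.
    + replace (M' * (Cmod (a (S j)) * wt (S j) x)) with (Cmod (a (S j)) * (wt (S j) x * M')) by ring.
      apply dbd_scal, dbd_shift; [lia|easy].
  - intros n. rewrite Rsum_scal, (Rmult_comm M). apply Rmult_le_compat_l; [now apply dbd_nonneg in Hb|apply Ha].
  - assert (E : forall n, X n = dconv a b n).
    { intros n. apply csums_unique with (1 := H1 n). apply csums_finite. intros i Hi.
      unfold dscal. rewrite dshift_gt; [ring|apply Hb|lia]. }
    split.
    + destruct H2 as [H20 H2]. split; [now rewrite <- E|]. intros n.
      rewrite (Rsum_ext _ (fun k => Cmod (X k) * wt k x)); [apply H2|]. intros; now rewrite E.
    + intros s Hs. transitivity (deval X s).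
      { apply deval_unique. apply csums_ext with (fun k => X k * npow_neg k s)%C; [intros; now rewrite E|].
        now apply deval_correct with x (M * M'). }
      apply csums_unique with (1 := H3 s Hs). rewrite Cmult_comm.
      apply csums_ext with (fun j => deval b s * (a j * npow_neg j s))%C.
      * intros [|j].
        { destruct Ha as [Ha0 _]. rewrite (deval_unique (dscal (a 0%nat) _) s (RtoC 0)); [rewrite Ha0; ring|].
          apply csums_ext with (fun _ => RtoC 0); [intros; unfold dscal; rewrite Ha0; ring|].
          apply (csums_finite (fun _ => RtoC 0) 0). easy. }
        rewrite (deval_scal _ x _ (wt (S j) x * M')); [|apply dbd_shift; [lia|easy]|easy].
        rewrite (deval_shift (S j) x b M'); [ring|lia|easy|easy].
      * apply csums_scal. now apply deval_correct with x M.
Qed.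

Lemma dbd_pow x a M k : dbd x a M -> dbd x (dpow a k) (M ^ k) /\
  forall s, x <= Re s -> deval (dpow a k) s = (deval a s ^ k)%C.
Proof.
  intros H. induction k as [|k [IH1 IH2]]; simpl.
  - split; [|intros; apply deval_const]. rewrite <- Cmod_1 at 2. apply dbd_const.
  - destruct (dbd_conv x a (dpow a k) M (M ^ k) H IH1) as [H1 H2]. split; [easy|].
    intros s Hs. rewrite H2, IH2 by easy. easy.
Qed.

(** Functional calculus: a power series that converges absolutely at a norm bound of [a] can be
    evaluated at [a] inside the algebra. *)
Lemma dcompose x a d (b : nat -> C) M : dbd x a d -> (forall n, Rsum (fun k => Cmod (b k) * d ^ k) n <= M) ->
  exists X, dbd x X M /\ forall s, x <= Re s -> csums (fun k => b k * deval a s ^ k)%C (deval X s).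
Proof.
  intros Ha HM.
  destruct (dfamily x (fun k => dscal (b k) (dpow a k)) (fun k => Cmod (b k) * d ^ k) M) as [X [_ [H2 H3]]].
  - intros k. apply dbd_scal. now apply dbd_pow.
  - exact HM.
  - exists X. split; [easy|]. intros s Hs. eapply csums_ext; [|apply (H3 s Hs)].
    intros k. cbv beta. destruct (dbd_pow x a d k Ha) as [P1 P2].
    rewrite (deval_scal _ x _ (d ^ k)), P2; easy.
Qed.

(** Without a constant term all weights that matter have index at least 2, so moving right by [t]
    gains a factor of at least [2^-t]. *)
Lemma dbd_small x a M d : dbd x a M -> a 1%nat = RtoC 0 -> 0 < d ->
  exists y, x <= y /\ dbd y a d.
Proof.
  intros [H0 H] H1 Hd. assert (HM : 0 <= M) by apply (H O).
  assert (Hl2 : 0 < ln (INR 2)) by (apply ln_INR_pos; lia).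
  (* Now [2^-t = exp (- M / d)], and [exp u >= 1 + u] at [u = M / d] gives [2^-t M <= d]. *)
  set (t := (M / d) / ln (INR 2)).
  assert (Ht : 0 <= t) by (unfold t; apply Rdiv_le_0_compat; [apply Rdiv_le_0_compat|]; lra).
  assert (Hw : wt 2 t * M <= d).
  { unfold wt. replace (- t * ln (INR 2)) with (- (M / d)) by (unfold t; field; lra).
    rewrite exp_Ropp. assert (He := exp_ineq1_le (M / d)).
    assert (Hp := exp_pos (M / d)).
    apply Rmult_le_reg_l with (exp (M / d)); [easy|].
    rewrite <- Rmult_assoc, Rinv_r, Rmult_1_l by lra.
    apply Rle_trans with (M / d * d); [right; field; lra|]. apply Rmult_le_compat_r; lra. }
  exists (x + t). split; [lra|]. split; [easy|]. intros n.
  eapply Rle_trans; [|exact Hw].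
  apply Rle_trans with (wt 2 t * Rsum (fun k => Cmod (a k) * wt k x) n).
  - rewrite <- Rsum_scal. apply Rsum_le. intros k _.
    destruct k as [|[|k]].
    + rewrite H0, Cmod_0. lra.
    + rewrite H1, Cmod_0. lra.
    + rewrite wt_plus. replace (wt 2 t * (Cmod (a (S (S k))) * wt (S (S k)) x))
        with (Cmod (a (S (S k))) * (wt (S (S k)) x * wt 2 t)) by ring.
      apply Rmult_le_compat_l; [apply Cmod_ge_0|]. apply Rmult_le_compat_l; [left; apply wt_pos|].
      unfold wt. assert (ln (INR 2) <= ln (INR (S (S k)))).
      { apply ln_le; [apply (lt_INR 0); lia|apply le_INR; lia]. }
      apply Rnot_lt_le; intros Hlt. apply exp_lt_inv in Hlt. nra.
  - apply Rmult_le_compat_l; [left; apply wt_pos|apply H].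
Qed.

Lemma dbd_dlog x a M : dbd x a M -> dbd (x + 1) (dlog a) M.
Proof.
  intros [H0 H]. split; [unfold dlog; rewrite H0; ring|]. intros n.
  eapply Rle_trans; [|apply (H n)]. apply Rsum_le. intros [|k] _.
  - unfold dlog. rewrite H0, Cmult_0_r, Cmod_0. lra.
  - unfold dlog. assert (Hl := ln_INR_nonneg (S k)).
    rewrite Cmod_mult, Cmod_R, Rabs_Ropp, Rabs_pos_eq, wt_plus by easy.
    assert (H1 := ln_wt_1 (S k) ltac:(lia)).
    replace (ln (INR (S k)) * Cmod (a (S k)) * (wt (S k) x * wt (S k) 1))
      with (Cmod (a (S k)) * wt (S k) x * (ln (INR (S k)) * wt (S k) 1)) by ring.
    assert (H2 := dbd_term_nonneg a x (S k)). nra.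
Qed.

(** The second-order remainder of [n^-s] carries [(ln n)^2], which costs two units of abscissa; the
    positive surplus [d] absorbs the factor [exp (ln n |h|)]. *)
Lemma cderiv_deval x a M s : dbd x a M -> x + 2 < Re s -> cderiv (deval a) s (deval (dlog a) s).
Proof.
  intros Ha Hs. set (d := Re s - x - 2). assert (Hd : 0 < d) by (unfold d; lra).
  apply (cderiv_termwise (fun k s => a k * npow_neg k s)%C (fun k => dlog a k * npow_neg k s)%C _ s _
    (fun k => Cmod (a k) * wt k x) M d); auto.
  - apply Ha.
  - intros [|k] h Hh.
    { destruct Ha as [Ha0 _]. unfold dlog. rewrite Ha0.
      replace (_ - _ - _)%C with (RtoC 0) by ring. rewrite Cmod_0; lra. }
    set (n := S k) in *. set (L := ln (INR n)). assert (HL : 0 <= L) by apply ln_INR_nonneg.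
    unfold dlog. fold L.
    rewrite npow_plus.
    replace (a n * (npow_neg n s * npow_neg n h) - a n * npow_neg n s - RtoC (- L) * a n * npow_neg n s * h)%C
      with (a n * (npow_neg n s * (npow_neg n h - 1 - RtoC (- L) * h)))%C by ring.
    rewrite !Cmod_mult, Cmod_npow, Rmult_assoc. apply Rmult_le_compat_l; [apply Cmod_ge_0|].
    assert (H := cexp_remainder (RtoC (- L) * h)). unfold L in H at 1; rewrite <- npow_cexp in H.
    rewrite Cmod_mult, Cmod_R, Rabs_Ropp, (Rabs_pos_eq L HL) in H.
    assert (Hh0 := Cmod_ge_0 h).
    assert (He : exp (L * Cmod h) <= wt n (- d)).
    { unfold wt. fold L. apply Rnot_lt_le; intros Hlt. apply exp_lt_inv in Hlt. nra. }
    replace (Re s) with (x + 1 + 1 + d) by (unfold d; ring). rewrite !wt_plus.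
    assert (H1 := ln_wt_1 n ltac:(unfold n; lia)). fold L in H1.
    assert (Hw1 := wt_pos n 1). assert (Hwd := wt_pos n d). assert (Hwx := wt_pos n x).
    apply Rle_trans with (wt n x * wt n 1 * wt n 1 * wt n d * (L * Cmod h * (L * Cmod h) * wt n (- d))).
    + apply Rmult_le_compat_l; [repeat apply Rmult_le_pos; lra|].
      eapply Rle_trans; [exact H|]. apply Rmult_le_compat_l; [|easy].
      apply Rmult_le_pos; now apply Rmult_le_pos.
    + replace (wt n x * wt n 1 * wt n 1 * wt n d * (L * Cmod h * (L * Cmod h) * wt n (- d)))
        with (wt n x * (Cmod h * Cmod h) * ((L * wt n 1) * (L * wt n 1)) * (wt n (- d) * wt n d)) by ring.
      rewrite wt_nonpos_exp, Rmult_1_r.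
      assert (0 <= L * wt n 1) by (apply Rmult_le_pos; lra).
      assert (0 <= wt n x * (Cmod h * Cmod h)) by (apply Rmult_le_pos; nra).
      rewrite <- (Rmult_1_r (wt n x * (Cmod h * Cmod h))) at 2. apply Rmult_le_compat_l; [easy|nra].
  - intros h Hh. apply (deval_correct x a M); [easy|].
    rewrite re_plus. assert (H := Re_le_Cmod h). apply Rabs_le_between in H. unfold d in Hh. lra.
  - apply (deval_correct (x + 1) _ M); [now apply dbd_dlog|lra].
Qed.

(** * Leading coefficients and uniqueness *)

Definition leads (a : nat -> C) (N : nat) : Prop := a N <> RtoC 0 /\ forall n, (n < N)%nat -> a n = RtoC 0.

Lemma leads_ex a n : a n <> RtoC 0 -> exists N, leads a N.
Proof.
  induction n as [n IH] using lt_wf_ind. intros Hn.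
  destruct (classic (exists j, (j < n)%nat /\ a j <> RtoC 0)) as [[j [Hj Ha]]|Hno].
  - now apply (IH j).
  - exists n. split; [easy|]. intros j Hj. apply NNPP. intros Ha. apply Hno. now exists j.
Qed.

Lemma leads_pos x a M N : dbd x a M -> leads a N -> (1 <= N)%nat.
Proof. intros [H0 _] [HN _]. destruct N; [easy|lia]. Qed.

(** After index [N] each factor [n^-t] is at most [(N + 1)^-t], which is of smaller order in [t]
    than the [N^-t] of the leading term. *)
Lemma deval_tail x a M N t s : dbd x a M -> leads a N -> 0 <= t -> Re s = x + t ->
  Cmod (deval a s - a N * npow_neg N s) <= wt (S N) t * M.
Proof.
  intros Ha [_ IH] Ht Hs.
  assert (HS := deval_correct x a M s Ha ltac:(rewrite Hs; lra)).
  assert (HS1 := csums_single (fun k => if Nat.eqb k N then a N * npow_neg N s else 0)%C N).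
  cbv beta in HS1. rewrite Nat.eqb_refl in HS1.
  specialize (HS1 ltac:(intros i Hi; destruct (Nat.eqb_spec i N); [easy|reflexivity])).
  assert (HD := csums_minus _ _ _ _ HS HS1).
  apply (csums_le _ (fun k => wt (S N) t * (Cmod (a k) * wt k x)) _ _) with (3 := HD).
  - intros k. cbv beta. destruct (Nat.eqb_spec k N) as [->|Hk].
    + replace (_ - _)%C with (RtoC 0) by ring. rewrite Cmod_0.
      apply Rmult_le_pos; [left; apply wt_pos|apply dbd_term_nonneg].
    + destruct (Nat.lt_ge_cases k N) as [Hlt|Hge].
      * rewrite (IH k Hlt). replace (_ - _)%C with (RtoC 0) by ring. rewrite Cmod_0. lra.
      * replace (a k * npow_neg k s - 0)%C with (a k * npow_neg k s)%C by ring.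
        rewrite Cmod_mult, Cmod_npow, Hs, wt_plus.
        replace (wt (S N) t * (Cmod (a k) * wt k x)) with (Cmod (a k) * (wt k x * wt (S N) t)) by ring.
        apply Rmult_le_compat_l; [apply Cmod_ge_0|]. apply Rmult_le_compat_l; [left; apply wt_pos|].
        unfold wt. assert (ln (INR (S N)) <= ln (INR k)).
        { apply ln_le; [apply (lt_INR 0); lia|apply le_INR; lia]. }
        apply Rnot_lt_le; intros Hlt. apply exp_lt_inv in Hlt. nra.
  - intros n. rewrite Rsum_scal. apply Rmult_le_compat_l; [left; apply wt_pos|apply Ha].
Qed.

Lemma wt_tail_small N A v y : (1 <= N)%nat -> 0 <= A -> 0 < v ->
  exists t, 0 <= t /\ y < t /\ wt (S N) t * A < wt N t * v.
Proof.
  intros HN HA Hv.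
  set (q := ln (INR (S N)) - ln (INR N)).
  assert (Hq : 0 < q).
  { unfold q. assert (ln (INR N) < ln (INR (S N))); [|lra].
    apply ln_increasing; [apply (lt_INR 0); lia|apply lt_INR; lia]. }
  assert (HAv : 0 <= A / v) by (apply Rdiv_le_0_compat; lra).
  assert (HAq : 0 <= A / v / q) by (apply Rdiv_le_0_compat; lra).
  (* The maximum secures [0 <= t] and [y < t]. The second summand makes [t q >= A / v], so that
     [exp (t q) >= 1 + t q] exceeds [A / v]. *)
  exists (Rmax (y + 1) 0 + A / v / q). set (t := Rmax (y + 1) 0 + A / v / q).
  assert (H1 := Rmax_l (y + 1) 0). assert (H2 := Rmax_r (y + 1) 0).
  split; [unfold t; lra|]. split; [unfold t; lra|].
  assert (Htq : A / v <= t * q).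
  { unfold t. rewrite Rmult_plus_distr_r. replace (A / v / q * q) with (A / v) by (field; lra).
    assert (0 <= Rmax (y + 1) 0 * q) by (apply Rmult_le_pos; lra). lra. }
  assert (E : wt (S N) t = wt N t * exp (- (t * q))).
  { unfold wt. rewrite <- exp_plus. f_equal. unfold q. ring. }
  rewrite E, Rmult_assoc. apply Rmult_lt_compat_l; [apply wt_pos|].
  rewrite exp_Ropp. assert (He := exp_ineq1_le (t * q)). assert (Hep := exp_pos (t * q)).
  apply Rmult_lt_reg_l with (exp (t * q)); [easy|]. rewrite <- Rmult_assoc, Rinv_r, Rmult_1_l by lra.
  replace A with (A / v * v) at 1 by (field; lra). apply Rmult_lt_compat_r; lra.
Qed.

(** If some coefficient were nonzero, far to the right the leading term would exceed the tail in
    modulus, and the sum could not vanish there. *)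
Lemma deval_0_unique x a M y : dbd x a M -> (forall s, y < Re s -> deval a s = RtoC 0) ->
  forall n, a n = RtoC 0.
Proof.
  intros Ha Hz n. apply NNPP; intros Hn. destruct (leads_ex a n Hn) as [N HN].
  assert (Hne := proj1 (Cmod_gt_0 _) (proj1 HN)).
  destruct (wt_tail_small N M (Cmod (a N) * wt N x) (y - x)) as [t [Ht [Hyt Hlt]]].
  { now apply leads_pos with x a M. }
  { now apply dbd_nonneg in Ha. }
  { apply Rmult_lt_0_compat; [easy|apply wt_pos]. }
  set (s := RtoC (x + t)). assert (Hs : Re s = x + t) by apply re_RtoC.
  assert (HB := deval_tail x a M N t s Ha HN Ht Hs). rewrite Hz in HB by (rewrite Hs; lra).
  replace (0 - a N * npow_neg N s)%C with (- (a N * npow_neg N s))%C in HB by ring.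
  rewrite Cmod_opp, Cmod_mult, Cmod_npow, Hs, wt_plus in HB. lra.
Qed.

(** * From conditional to absolute convergence *)

Lemma Rsum_wt_2 n : Rsum (fun k => if Nat.eqb k 0 then 0 else wt k 2) n <= 2.
Proof.
  (* The sharper bound [2 - 1/n] passes through the induction because [1/n^2 <= 1/(n-1) - 1/n]. *)
  assert (A : forall m, Rsum (fun k => if Nat.eqb k 0 then 0 else wt k 2) (S (S m)) <= 2 - / INR (S m)).
  { induction m; [simpl; rewrite wt_1; lra|].
    change (Rsum (fun k => if Nat.eqb k 0 then 0 else wt k 2) (S (S m)) + wt (S (S m)) 2 <= 2 - / INR (S (S m))).
    replace (wt (S (S m)) 2) with (wt (S (S m)) 1 * wt (S (S m)) 1) by (rewrite <- wt_plus; f_equal; ring).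
    rewrite !wt_inv by lia.
    assert (Hp := pos_INR m). rewrite !S_INR in *. set (r := INR m) in *.
    assert (/ (r + 1) - / (r + 1 + 1) - / (r + 1 + 1) * / (r + 1 + 1) >= 0); [|lra].
    replace (/ (r + 1) - / (r + 1 + 1) - / (r + 1 + 1) * / (r + 1 + 1))
      with (/ ((r + 1) * ((r + 1 + 1) * (r + 1 + 1)))) by (field; lra).
    apply Rle_ge. left. apply Rinv_0_lt_compat. repeat apply Rmult_lt_0_compat; lra. }
  destruct n as [|[|n]]; [simpl; lra|simpl; lra|].
  eapply Rle_trans; [apply A|]. assert (0 < / INR (S n)); [|lra].
  apply Rinv_0_lt_compat, (lt_INR 0). lia.
Qed.

Lemma csums_bounded u l : csums u l -> exists B, forall k, Cmod (u k) <= B.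
Proof.
  intros H. destruct (H 1 ltac:(lra)) as [N HN].
  exists (Rsum (fun k => Cmod (u k)) N + 2). intros k.
  assert (H0 : 0 <= Rsum (fun k => Cmod (u k)) N) by (apply Rsum_nonneg; intros; apply Cmod_ge_0).
  destruct (Nat.lt_ge_cases k N) as [Hk|Hk].
  - assert (H1 := Rsum_term (fun k => Cmod (u k)) N k (fun i => Cmod_ge_0 _) Hk). simpl in H1. lra.
  - assert (H1 := HN k Hk). assert (H2 := HN (S k) ltac:(lia)). simpl in H2.
    assert (H3 := Cmod_triangle3 (Csum u k + u k) l (Csum u k)).
    replace (Csum u k + u k - Csum u k)%C with (u k) in H3 by ring.
    rewrite (Cmod_minus_sym l) in H3. lra.
Qed.

(** Convergence at the real point [sg + 1] bounds the terms there; two more units bring in the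
    convergent sum of [k^-2]. *)
Lemma in_D_dbd g : in_D g -> exists a x M, dbd x a M /\ forall s, x <= Re s -> g s = deval a s.
Proof.
  intros [a0 [sg H]].
  set (a := fun n => if Nat.eqb n 0 then RtoC 0 else a0 n).
  assert (HS : forall s, sg < Re s -> csums (fun k => a k * npow_neg k s)%C (g s)).
  { intros s Hs. specialize (H s Hs). apply csums_is_series in H.
    assert (H1 := csums_unshift1 (fun k => a k * npow_neg k s)%C (g s) H).
    cbv beta in H1. replace (g s + a O * npow_neg 0 s)%C with (g s) in H1; [exact H1|]. unfold a; simpl; ring. }
  destruct (csums_bounded _ _ (HS (RtoC (sg + 1)) ltac:(rewrite re_RtoC; lra))) as [B HB].
  assert (HB0 : 0 <= B) by (eapply Rle_trans; [apply Cmod_ge_0|apply (HB O)]).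
  exists a, (sg + 1 + 2), (B * 2). split; [split; [easy|]|].
  - intros n. apply Rle_trans with (B * Rsum (fun k => if Nat.eqb k 0 then 0 else wt k 2) n).
    + rewrite <- Rsum_scal. apply Rsum_le. intros k _. destruct (Nat.eqb_spec k 0) as [->|Hk].
      * unfold a; simpl. rewrite Cmod_0. lra.
      * rewrite wt_plus, <- Rmult_assoc. apply Rmult_le_compat_r; [left; apply wt_pos|].
        specialize (HB k). rewrite Cmod_mult, Cmod_npow, re_RtoC in HB. exact HB.
    + apply Rmult_le_compat_l; [easy|apply Rsum_wt_2].
  - intros s Hs. symmetry. apply deval_unique, HS. lra.
Qed.

Lemma dbd_in_D g a x M : dbd x a M -> (forall s, x < Re s -> g s = deval a s) -> in_D g.
Proof.
  intros Ha H. exists a, x. intros s Hs. apply csums_is_series. rewrite H by easy.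
  assert (H1 := csums_shift1 _ _ (deval_correct x a M s Ha ltac:(unfold in_halfplane in Hs; lra))).
  cbv beta in H1. replace (deval a s - a O * npow_neg 0 s)%C with (deval a s) in H1; [exact H1|].
  destruct Ha as [-> _]. ring.
Qed.

(** * Cauchy's theorem on rectangles and Taylor expansion *)

(** Componentwise, so that linearity, the Chasles relation and the fundamental theorem are those of
    the real integral. *)
Definition CI (f : R -> C) (a b : R) : C :=
  (RInt (fun t => Re (f t)) a b, RInt (fun t => Im (f t)) a b).

Definition ex_CI (f : R -> C) (a b : R) : Prop :=
  ex_RInt (fun t => Re (f t)) a b /\ ex_RInt (fun t => Im (f t)) a b.

Lemma CI_ext f g a b : a <= b -> (forall t, a <= t <= b -> f t = g t) -> CI f a b = CI g a b.
Proof.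
  intros Hab H. unfold CI. f_equal; apply RInt_ext; intros t Ht;
    rewrite Rmin_left, Rmax_right in Ht by lra; rewrite H by lra; easy.
Qed.

Lemma CI_plus f g a b : ex_CI f a b -> ex_CI g a b ->
  CI (fun t => f t + g t)%C a b = (CI f a b + CI g a b)%C.
Proof.
  intros [H1 H2] [H3 H4]. apply injective_projections; simpl.
  - exact (RInt_plus (fun t => Re (f t)) (fun t => Re (g t)) a b H1 H3).
  - exact (RInt_plus (fun t => Im (f t)) (fun t => Im (g t)) a b H2 H4).
Qed.

Lemma CI_scal c f a b : ex_CI f a b -> CI (fun t => c * f t)%C a b = (c * CI f a b)%C.
Proof.
  intros [H1 H2].
  assert (S1 := fun r => ex_RInt_scal (fun t => Re (f t)) a b r H1).
  assert (S2 := fun r => ex_RInt_scal (fun t => Im (f t)) a b r H2).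
  assert (T1 := fun r => RInt_scal (fun t => Re (f t)) a b r H1).
  assert (T2 := fun r => RInt_scal (fun t => Im (f t)) a b r H2).
  apply injective_projections; simpl.
  - change (fst c * RInt (fun t => Re (f t)) a b) with (scal (fst c) (RInt (fun t => Re (f t)) a b)).
    change (snd c * RInt (fun t => Im (f t)) a b) with (scal (snd c) (RInt (fun t => Im (f t)) a b)).
    rewrite <- T1, <- T2. exact (RInt_minus _ _ a b (S1 (fst c)) (S2 (snd c))).
  - change (fst c * RInt (fun t => Im (f t)) a b) with (scal (fst c) (RInt (fun t => Im (f t)) a b)).
    change (snd c * RInt (fun t => Re (f t)) a b) with (scal (snd c) (RInt (fun t => Re (f t)) a b)).
    rewrite <- T1, <- T2. exact (RInt_plus _ _ a b (S2 (fst c)) (S1 (snd c))).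
Qed.

Lemma ex_CI_scal c f a b : ex_CI f a b -> ex_CI (fun t => c * f t)%C a b.
Proof.
  intros [H1 H2].
  assert (S1 := fun r => ex_RInt_scal (fun t => Re (f t)) a b r H1).
  assert (S2 := fun r => ex_RInt_scal (fun t => Im (f t)) a b r H2). split.
  - exact (ex_RInt_minus _ _ a b (S1 (fst c)) (S2 (snd c))).
  - exact (ex_RInt_plus _ _ a b (S2 (fst c)) (S1 (snd c))).
Qed.

Lemma CI_Chasles f a b c : ex_CI f a b -> ex_CI f b c -> CI f a c = (CI f a b + CI f b c)%C.
Proof.
  intros [H1 H2] [H3 H4]. apply injective_projections; simpl; symmetry.
  - exact (RInt_Chasles (fun t => Re (f t)) a b c H1 H3).
  - exact (RInt_Chasles (fun t => Im (f t)) a b c H2 H4).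
Qed.

(* The factor 2 comes from bounding the real and the imaginary part separately. *)
Lemma CI_bound f a b M : a <= b -> ex_CI f a b -> (forall t, a <= t <= b -> Cmod (f t) <= M) ->
  Cmod (CI f a b) <= 2 * M * (b - a).
Proof.
  intros Hab [H1 H2] HM. eapply Rle_trans; [apply Cmod_le_Re_Im|]. simpl.
  assert (A1 := norm_RInt_le_const (fun t => Re (f t)) a b _ M Hab
    (fun t Ht => Rle_trans _ _ _ (Re_le_Cmod (f t)) (HM t Ht)) (RInt_correct _ _ _ H1)).
  assert (A2 := norm_RInt_le_const (fun t => Im (f t)) a b _ M Hab
    (fun t Ht => Rle_trans _ _ _ (Im_le_Cmod (f t)) (HM t Ht)) (RInt_correct _ _ _ H2)).
  change (Rabs (RInt (fun t => Re (f t)) a b) <= (b - a) * M) in A1.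
  change (Rabs (RInt (fun t => Im (f t)) a b) <= (b - a) * M) in A2. lra.
Qed.

Lemma ccont_path g (p : R -> C) t : (forall t', Cmod (p t' - p t) <= Rabs (t' - t)) -> ccont g (p t) ->
  continuous (fun t => Re (g (p t))) t /\ continuous (fun t => Im (g (p t))) t.
Proof.
  intros Hp Hg.
  assert (A : forall eps : posreal, exists d : posreal, forall t', Rabs (t' - t) < d ->
    Cmod (g (p t') - g (p t)) < eps).
  { intros eps. destruct (Hg eps (cond_pos eps)) as [d [Hd H]]. exists (mkposreal d Hd). simpl.
    intros t' Ht'. specialize (H (p t' - p t)%C (Rle_lt_trans _ _ _ (Hp t') Ht')).
    now replace (p t + (p t' - p t))%C with (p t') in H by ring. }
  split; apply filterlim_locally; intros eps; destruct (A eps) as [d Hd]; exists d; intros t' Ht';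
    (eapply Rle_lt_trans; [|apply (Hd t' Ht')]).
  - apply (Re_le_Cmod (g (p t') - g (p t))).
  - apply (Im_le_Cmod (g (p t') - g (p t))).
Qed.

Lemma ex_CI_path g (p : R -> C) a b : a <= b ->
  (forall t t', Cmod (p t' - p t) <= Rabs (t' - t)) ->
  (forall t, a <= t <= b -> ccont g (p t)) -> ex_CI (fun t => g (p t)) a b.
Proof.
  intros Hab Hp Hg.
  split; apply (ex_RInt_continuous (V := R_CompleteNormedModule)); intros t Ht;
    rewrite Rmin_left, Rmax_right in Ht by lra; apply (ccont_path g p t); auto.
Qed.

Lemma hpath y t t' : Cmod ((t', y) - (t, y)) <= Rabs (t' - t).
Proof.
  rewrite <- Cmod_R. right. f_equal. apply injective_projections; simpl; ring.
Qed.

Lemma vpath x t t' : Cmod ((x, t') - (x, t)) <= Rabs (t' - t).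
Proof.
  rewrite <- (Rmult_1_l (Rabs (t' - t))), <- Cmod_Ci, <- Cmod_R, <- Cmod_mult.
  right. f_equal. apply injective_projections; simpl; ring.
Qed.

(** Used with [d = 1] and [d = Ci], for horizontal and vertical sides. [Cmod d <= 1] makes the path
    1-Lipschitz, as [ccont_path] asks. *)
Lemma CI_ftc F g z d a b : a <= b -> Cmod d <= 1 -> (forall t, cderiv F (z + RtoC t * d)%C (g (z + RtoC t * d)%C)) ->
  (forall t, ccont g (z + RtoC t * d)%C) ->
  CI (fun t => g (z + RtoC t * d)%C * d)%C a b = (F (z + RtoC b * d)%C - F (z + RtoC a * d)%C)%C.
Proof.
  intros Hab Hd HF Hg.
  assert (Hc : forall t, continuous (fun t => Re (g (z + RtoC t * d)%C * d)) t /\ continuous (fun t => Im (g (z + RtoC t * d)%C * d)) t).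
  { intros t. apply (ccont_path (fun w => g w * d)%C (fun t => (z + RtoC t * d)%C)).
    - intros t'. replace (z + t' * d - (z + t * d))%C with (RtoC (t' - t) * d)%C by (rewrite RtoC_minus; ring).
      rewrite Cmod_mult, Cmod_R. assert (H := Rabs_pos (t' - t)). assert (H' := Cmod_ge_0 d). nra.
    - intros eps He. assert (H' := Cmod_ge_0 d).
      destruct (Hg t (eps / 2) ltac:(lra)) as [e [He' H]]. exists e; split; [easy|]. intros h Hh. specialize (H h Hh).
      replace (g (z + t * d + h)%C * d - g (z + t * d)%C * d)%C with ((g (z + t * d + h)%C - g (z + t * d)%C) * d)%C by ring.
      rewrite Cmod_mult. assert (H0 := Cmod_ge_0 (g (z + t * d + h)%C - g (z + t * d)%C)). nra. }
  apply injective_projections; simpl.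
  - apply is_RInt_unique.
    apply (is_RInt_derive (fun t => Re (F (z + RtoC t * d)%C)) (fun t => Re (g (z + RtoC t * d)%C * d))).
    + intros t _. now apply cderiv_line.
    + intros t _. exact (proj1 (Hc t)).
  - apply is_RInt_unique.
    apply (is_RInt_derive (fun t => Im (F (z + RtoC t * d)%C)) (fun t => Im (g (z + RtoC t * d)%C * d))).
    + intros t _. now apply cderiv_line.
    + intros t _. exact (proj2 (Hc t)).
Qed.

(** The contour integral around the rectangle, counterclockwise: bottom minus top, plus [Ci] times
    right minus left. *)
Definition rint (g : C -> C) (x0 x1 y0 y1 : R) : C :=
  (CI (fun t => g (t, y0)) x0 x1 - CI (fun t => g (t, y1)) x0 x1
   + Ci * (CI (fun t => g (x1, t)) y0 y1 - CI (fun t => g (x0, t)) y0 y1))%C.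

Definition bdry (x0 x1 y0 y1 : R) (z : C) : Prop :=
  (x0 <= Re z <= x1 /\ (Im z = y0 \/ Im z = y1)) \/ (y0 <= Im z <= y1 /\ (Re z = x0 \/ Re z = x1)).

Lemma bdry_ex_CI g x0 x1 y0 y1 : x0 <= x1 -> y0 <= y1 -> (forall z, bdry x0 x1 y0 y1 z -> ccont g z) ->
  ex_CI (fun t => g (t, y0)) x0 x1 /\ ex_CI (fun t => g (t, y1)) x0 x1 /\
  ex_CI (fun t => g (x0, t)) y0 y1 /\ ex_CI (fun t => g (x1, t)) y0 y1.
Proof.
  intros Hx Hy Hg.
  repeat split; try (apply (ex_CI_path g (fun t => (t, y0))); auto using hpath; intros t Ht; apply Hg; left; simpl; tauto);
  try (apply (ex_CI_path g (fun t => (t, y1))); auto using hpath; intros t Ht; apply Hg; left; simpl; tauto);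
  try (apply (ex_CI_path g (fun t => (x0, t))); auto using vpath; intros t Ht; apply Hg; right; simpl; tauto);
  try (apply (ex_CI_path g (fun t => (x1, t))); auto using vpath; intros t Ht; apply Hg; right; simpl; tauto).
Qed.

Lemma rint_ext f g x0 x1 y0 y1 : x0 <= x1 -> y0 <= y1 -> (forall z, bdry x0 x1 y0 y1 z -> f z = g z) ->
  rint f x0 x1 y0 y1 = rint g x0 x1 y0 y1.
Proof.
  intros Hx Hy H. unfold rint.
  rewrite (CI_ext (fun t => f (t, y0)) (fun t => g (t, y0))),
    (CI_ext (fun t => f (t, y1)) (fun t => g (t, y1))),
    (CI_ext (fun t => f (x0, t)) (fun t => g (x0, t))),
    (CI_ext (fun t => f (x1, t)) (fun t => g (x1, t))); auto;
  intros t Ht; apply H; unfold bdry; simpl; tauto.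
Qed.

Lemma rint_plus f g x0 x1 y0 y1 : x0 <= x1 -> y0 <= y1 ->
  (forall z, bdry x0 x1 y0 y1 z -> ccont f z) -> (forall z, bdry x0 x1 y0 y1 z -> ccont g z) ->
  rint (fun z => f z + g z)%C x0 x1 y0 y1 = (rint f x0 x1 y0 y1 + rint g x0 x1 y0 y1)%C.
Proof.
  intros Hx Hy Hf Hg.
  destruct (bdry_ex_CI f x0 x1 y0 y1 Hx Hy Hf) as [F1 [F2 [F3 F4]]].
  destruct (bdry_ex_CI g x0 x1 y0 y1 Hx Hy Hg) as [G1 [G2 [G3 G4]]].
  unfold rint. rewrite !CI_plus by easy. ring.
Qed.

Lemma rint_scal c f x0 x1 y0 y1 : x0 <= x1 -> y0 <= y1 ->
  (forall z, bdry x0 x1 y0 y1 z -> ccont f z) ->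
  rint (fun z => c * f z)%C x0 x1 y0 y1 = (c * rint f x0 x1 y0 y1)%C.
Proof.
  intros Hx Hy Hf.
  destruct (bdry_ex_CI f x0 x1 y0 y1 Hx Hy Hf) as [F1 [F2 [F3 F4]]].
  unfold rint. rewrite !CI_scal by easy. ring.
Qed.

Lemma rint_bound f x0 x1 y0 y1 M : x0 <= x1 -> y0 <= y1 ->
  (forall z, bdry x0 x1 y0 y1 z -> ccont f z) ->
  (forall z, bdry x0 x1 y0 y1 z -> Cmod (f z) <= M) ->
  Cmod (rint f x0 x1 y0 y1) <= 4 * M * ((x1 - x0) + (y1 - y0)).
Proof.
  intros Hx Hy Hf HM.
  destruct (bdry_ex_CI f x0 x1 y0 y1 Hx Hy Hf) as [F1 [F2 [F3 F4]]].
  assert (B1 := CI_bound _ _ _ M Hx F1 ltac:(intros t Ht; apply HM; unfold bdry; simpl; tauto)).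
  assert (B2 := CI_bound _ _ _ M Hx F2 ltac:(intros t Ht; apply HM; unfold bdry; simpl; tauto)).
  assert (B3 := CI_bound _ _ _ M Hy F3 ltac:(intros t Ht; apply HM; unfold bdry; simpl; tauto)).
  assert (B4 := CI_bound _ _ _ M Hy F4 ltac:(intros t Ht; apply HM; unfold bdry; simpl; tauto)).
  unfold rint. eapply Rle_trans; [apply Cmod_triangle|]. rewrite Cmod_mult, Cmod_Ci, Rmult_1_l.
  assert (T : forall a b, Cmod (a - b) <= Cmod a + Cmod b).
  { intros a b. unfold Cminus. rewrite <- (Cmod_opp b). apply Cmod_triangle. }
  eapply Rle_trans; [apply Rplus_le_compat; apply T|]. lra.
Qed.

Lemma rint_split_x g x0 m x1 y0 y1 : x0 <= m <= x1 -> y0 <= y1 ->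
  (forall z, bdry x0 m y0 y1 z -> ccont g z) -> (forall z, bdry m x1 y0 y1 z -> ccont g z) ->
  rint g x0 x1 y0 y1 = (rint g x0 m y0 y1 + rint g m x1 y0 y1)%C.
Proof.
  intros Hm Hy H1 H2.
  destruct (bdry_ex_CI g x0 m y0 y1 ltac:(lra) Hy H1) as [F1 [F2 [F3 F4]]].
  destruct (bdry_ex_CI g m x1 y0 y1 ltac:(lra) Hy H2) as [G1 [G2 [G3 G4]]].
  unfold rint. rewrite (CI_Chasles _ x0 m x1 F1 G1), (CI_Chasles _ x0 m x1 F2 G2). ring.
Qed.

Lemma rint_split_y g x0 x1 y0 m y1 : x0 <= x1 -> y0 <= m <= y1 ->
  (forall z, bdry x0 x1 y0 m z -> ccont g z) -> (forall z, bdry x0 x1 m y1 z -> ccont g z) ->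
  rint g x0 x1 y0 y1 = (rint g x0 x1 y0 m + rint g x0 x1 m y1)%C.
Proof.
  intros Hx Hm H1 H2.
  destruct (bdry_ex_CI g x0 x1 y0 m Hx ltac:(lra) H1) as [F1 [F2 [F3 F4]]].
  destruct (bdry_ex_CI g x0 x1 m y1 Hx ltac:(lra) H2) as [G1 [G2 [G3 G4]]].
  unfold rint. rewrite (CI_Chasles _ y0 m y1 F3 G3), (CI_Chasles _ y0 m y1 F4 G4). ring.
Qed.

Lemma ccont_affine a b z : ccont (fun w => a * w + b)%C z.
Proof. apply (cderiv_ccont _ _ a), cderiv_lin. Qed.

(** The primitive [a z^2 / 2 + b z] turns each side into a difference of corner values, and these
    cancel around the contour. *)
Lemma rint_affine a b x0 x1 y0 y1 : x0 <= x1 -> y0 <= y1 -> rint (fun z => a * z + b)%C x0 x1 y0 y1 = RtoC 0.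
Proof.
  intros Hx Hy.
  set (F := fun z => (RtoC (/2) * a * (z * z) + b * z)%C).
  assert (HF : forall z, cderiv F z (a * z + b)%C).
  { intros z. assert (H := cderiv_plus _ _ _ _ _ (cderiv_scal (RtoC (/2) * a)%C _ _ _ (cderiv_sqr z))
      (cderiv_scal b _ _ _ (cderiv_id z))).
    replace (a * z + b)%C with (RtoC (/2) * a * (2 * z) + b * 1)%C; [exact H|].
    rewrite RtoC_inv by lra. field. }
  assert (Hh : forall y, CI (fun t => a * (t, y) + b)%C x0 x1 = (F (x1, y) - F (x0, y))%C).
  { intros y. assert (E : forall t, ((0, y) + RtoC t * 1)%C = (t, y)).
    { intros t. apply injective_projections; simpl; ring. }
    rewrite <- (E x1), <- (E x0). rewrite <- (CI_ftc F (fun z => a * z + b)%C (0, y) 1 x0 x1); auto.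
    - apply CI_ext; [easy|]. intros t _. rewrite E. ring.
    - rewrite Cmod_1; lra.
    - intros; apply ccont_affine. }
  assert (Hv : forall x, (Ci * CI (fun t => a * (x, t) + b)%C y0 y1)%C = (F (x, y1) - F (x, y0))%C).
  { intros x. assert (E : forall t, ((x, 0) + RtoC t * Ci)%C = (x, t)).
    { intros t. apply injective_projections; simpl; ring. }
    rewrite <- (E y1), <- (E y0). rewrite <- (CI_ftc F (fun z => a * z + b)%C (x, 0) Ci y0 y1); auto.
    - rewrite <- CI_scal.
      + apply CI_ext; [easy|]. intros t _. rewrite E. ring.
      + apply (ex_CI_path (fun w => a * w + b)%C (fun t => (x, t))); auto using vpath.
        intros; apply ccont_affine.
    - rewrite Cmod_Ci; lra.
    - intros; apply ccont_affine. }
  unfold rint. replace (Ci * (CI (fun t => a * (x1, t) + b)%C y0 y1 - CI (fun t => a * (x0, t) + b)%C y0 y1))%C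
    with (Ci * CI (fun t => a * (x1, t) + b)%C y0 y1 - Ci * CI (fun t => a * (x0, t) + b)%C y0 y1)%C by ring.
  rewrite !Hh, !Hv. ring.
Qed.

(* [P x y w h] is about the rectangle with lower left corner [(x, y)] and side lengths [w], [h]. *)
Lemma cousin_rectangles (P : R -> R -> R -> R -> Prop) :
  (forall x y w h, 0 <= w -> 0 <= h -> P x y (w/2) (h/2) -> P (x + w/2) y (w/2) (h/2) ->
     P x (y + h/2) (w/2) (h/2) -> P (x + w/2) (y + h/2) (w/2) (h/2) -> P x y w h) ->
  forall x0 y0 w0 h0, 0 <= w0 -> 0 <= h0 ->
  (forall u v, x0 <= u <= x0 + w0 -> y0 <= v <= y0 + h0 -> exists d, 0 < d /\
     forall x y w h, 0 <= w -> 0 <= h -> x <= u <= x + w -> y <= v <= y + h -> w + h < d -> P x y w h) ->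
  P x0 y0 w0 h0.
Proof.
  intros Hadd x0 y0 w0 h0 Hw0 Hh0 Hloc. apply NNPP; intros HnP.
  assert (step : forall x y w h, 0 <= w -> 0 <= h -> ~ P x y w h ->
    exists x' y', x <= x' <= x + w/2 /\ y <= y' <= y + h/2 /\ ~ P x' y' (w/2) (h/2)).
  { intros x y w h Hw Hh HP. apply NNPP; intros Hno. apply HP. apply Hadd; auto; apply NNPP; intros Hc; apply Hno.
    - exists x, y; repeat split; auto; lra.
    - exists (x + w/2), y; repeat split; auto; lra.
    - exists x, (y + h/2); repeat split; auto; lra.
    - exists (x + w/2), (y + h/2); repeat split; auto; lra. }
  set (W := fun n => w0 / 2 ^ n). set (H := fun n => h0 / 2 ^ n).
  assert (H2 : forall n, 0 < 2 ^ n) by (intros; apply pow_lt; lra).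
  assert (HW : forall n, 0 <= W n) by (intros; apply Rdiv_le_0_compat; auto).
  assert (HH : forall n, 0 <= H n) by (intros; apply Rdiv_le_0_compat; auto).
  assert (EW : forall n, W (S n) = W n / 2) by (intros n; unfold W; simpl; specialize (H2 n); field; lra).
  assert (EH : forall n, H (S n) = H n / 2) by (intros n; unfold H; simpl; specialize (H2 n); field; lra).
  (* Stated as an implication so that a successor exists for every corner; a choice function can
     then be extracted and iterated. *)
  assert (next : forall n (p : R * R), exists q : R * R, ~ P (fst p) (snd p) (W n) (H n) ->
    fst p <= fst q <= fst p + W n / 2 /\ snd p <= snd q <= snd p + H n / 2 /\ ~ P (fst q) (snd q) (W (S n)) (H (S n))).
  { intros n p. destruct (classic (P (fst p) (snd p) (W n) (H n))) as [Hp|Hp].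
    - exists p. intros; contradiction.
    - destruct (step _ _ _ _ (HW n) (HH n) Hp) as [x' [y' [A [B D]]]]. exists (x', y'). intros _. simpl.
      rewrite EW, EH. auto. }
  set (nx := fun n p => proj1_sig (constructive_indefinite_description _ (next n p))).
  set (sq := fix sq n := match n with O => (x0, y0) | S m => nx m (sq m) end).
  assert (Hsq : forall n, ~ P (fst (sq n)) (snd (sq n)) (W n) (H n) /\
    fst (sq n) <= fst (sq (S n)) <= fst (sq n) + W n / 2 /\ snd (sq n) <= snd (sq (S n)) <= snd (sq n) + H n / 2).
  { assert (A : forall n, ~ P (fst (sq n)) (snd (sq n)) (W n) (H n)).
    { induction n.
      - simpl. unfold W, H; simpl. unfold Rdiv. now rewrite Rinv_1, !Rmult_1_r.
      - apply (proj2_sig (constructive_indefinite_description _ (next n (sq n)))). exact IHn. }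
    intros n. split; [apply A|].
    destruct (proj2_sig (constructive_indefinite_description _ (next n (sq n))) (A n)) as [B [D _]]. easy. }
  (* Nested intervals whose lengths halve have a common point; this is applied to each
     coordinate. *)
  assert (lim : forall (u L : nat -> R), (forall n, 0 <= L n) -> (forall n, L (S n) = L n / 2) ->
    (forall n, u n <= u (S n) <= u n + L n / 2) -> exists X, forall n, u n <= X <= u n + L n).
  { intros u L HL EL Hu.
    assert (up : forall n m, (n <= m)%nat -> u n <= u m /\ u m + L m <= u n + L n).
    { intros n m; induction 1 as [|m Hm IH]; [lra|]. specialize (Hu m). rewrite EL. lra. }
    destruct (completeness (fun x => exists n, x = u n)) as [X [HX1 HX2]].
    - exists (u O + L O). intros x [n ->]. destruct (up O n ltac:(lia)). specialize (HL n). lra.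
    - exists (u O). now exists O.
    - exists X. intros n. split; [apply HX1; now exists n|].
      apply HX2. intros x [m ->]. destruct (Nat.le_ge_cases n m) as [Hc|Hc].
      + destruct (up n m Hc). specialize (HL m). lra.
      + destruct (up m n Hc). specialize (HL n). lra. }
  destruct (lim (fun n => fst (sq n)) W HW EW ltac:(intros n; apply Hsq)) as [X HX].
  destruct (lim (fun n => snd (sq n)) H HH EH ltac:(intros n; apply Hsq)) as [Y HY].
  assert (HX0 := HX O). assert (HY0 := HY O). simpl in HX0, HY0. unfold W at 1 in HX0. unfold H at 1 in HY0.
  simpl in HX0, HY0. unfold Rdiv in HX0, HY0. rewrite Rinv_1, Rmult_1_r in HX0, HY0.
  destruct (Hloc X Y HX0 HY0) as [d [Hd HP]].
  destruct (pow_lt_1_zero (/2) ltac:(rewrite Rabs_pos_eq; lra) (d / (w0 + h0 + 1))) as [N HN].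
  { apply Rdiv_lt_0_compat; lra. }
  specialize (HN N (le_n _)). rewrite Rabs_pos_eq in HN by (apply pow_le; lra). rewrite pow_inv in HN.
  destruct (Hsq N) as [A _]. apply A. apply HP; auto.
  unfold W, H. replace (w0 / 2 ^ N + h0 / 2 ^ N) with (/ 2 ^ N * (w0 + h0)) by (field; specialize (H2 N); lra).
  assert (Hi : 0 < / 2 ^ N) by (apply Rinv_0_lt_compat, H2).
  apply Rle_lt_trans with (/ 2 ^ N * (w0 + h0 + 1)); [nra|].
  apply Rlt_le_trans with (d / (w0 + h0 + 1) * (w0 + h0 + 1)); [apply Rmult_lt_compat_r; lra|].
  right; field; lra.
Qed.

Definition inrect (x0 x1 y0 y1 : R) (z : C) : Prop := x0 <= Re z <= x1 /\ y0 <= Im z <= y1.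

Lemma bdry_inrect x0 x1 y0 y1 z : x0 <= x1 -> y0 <= y1 -> bdry x0 x1 y0 y1 z -> inrect x0 x1 y0 y1 z.
Proof. unfold bdry, inrect. intros Hx Hy H. lra. Qed.

(** Goursat's theorem. The bound [4 eps (w + h)^2] is reproduced exactly by quartering, and it holds
    locally because near a point [g] differs from an affine function, whose integral is 0, by at
    most [eps (w + h)]. *)
Lemma rint_goursat g x0 x1 y0 y1 : x0 <= x1 -> y0 <= y1 ->
  (forall z, inrect x0 x1 y0 y1 z -> exists l, cderiv g z l) -> rint g x0 x1 y0 y1 = RtoC 0.
Proof.
  intros Hx Hy Hg.
  assert (Hc : forall z, inrect x0 x1 y0 y1 z -> ccont g z).
  { intros z Hz. destruct (Hg z Hz) as [l Hl]. now apply cderiv_ccont with l. }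
  assert (A : forall eps, 0 < eps -> Cmod (rint g x0 x1 y0 y1) <= 4 * eps * ((x1 - x0) + (y1 - y0)) * ((x1 - x0) + (y1 - y0))).
  { intros eps He.
    (* Containment in the large rectangle is part of the predicate, since the bisection principle
       ranges over all rectangles. *)
    assert (B := cousin_rectangles (fun x y w h => x0 <= x -> x + w <= x1 -> y0 <= y -> y + h <= y1 ->
      Cmod (rint g x (x + w) y (y + h)) <= 4 * eps * (w + h) * (w + h))).
    cbv beta in B. replace x1 with (x0 + (x1 - x0)) at 1 by ring. replace y1 with (y0 + (y1 - y0)) at 1 by ring.
    apply B; try lra; clear B.
    - intros x y w h Hw Hh P1 P2 P3 P4 B1 B2 B3 B4.
      specialize (P1 ltac:(lra) ltac:(lra) ltac:(lra) ltac:(lra)).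
      specialize (P2 ltac:(lra) ltac:(lra) ltac:(lra) ltac:(lra)).
      specialize (P3 ltac:(lra) ltac:(lra) ltac:(lra) ltac:(lra)).
      specialize (P4 ltac:(lra) ltac:(lra) ltac:(lra) ltac:(lra)).
      replace (x + w/2 + w/2) with (x + w) in * by field.
      replace (y + h/2 + h/2) with (y + h) in * by field.
      assert (Hcc : forall a b c d, x <= a -> a <= b -> b <= x + w -> y <= c -> c <= d -> d <= y + h ->
        forall z, bdry a b c d z -> ccont g z).
      { intros a b c d E1 E2 E3 E4 E5 E6 z Hz. apply Hc. apply bdry_inrect in Hz; [|lra|lra].
        unfold inrect in *. lra. }
      rewrite (rint_split_x g x (x + w/2) (x + w)); [|lra|lra|apply Hcc; lra|apply Hcc; lra].
      rewrite (rint_split_y g x (x + w/2) y (y + h/2) (y + h)); [|lra|lra|apply Hcc; lra|apply Hcc; lra].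
      rewrite (rint_split_y g (x + w/2) (x + w) y (y + h/2) (y + h)); [|lra|lra|apply Hcc; lra|apply Hcc; lra].
      eapply Rle_trans; [apply Cmod_triangle|].
      eapply Rle_trans; [apply Rplus_le_compat; apply Cmod_triangle|].
      replace (4 * eps * (w + h) * (w + h)) with (4 * (4 * eps * (w/2 + h/2) * (w/2 + h/2))) by field. lra.
    - intros u v Hu Hv.
      destruct (Hg (u, v)) as [l Hl]; [unfold inrect; simpl; lra|].
      destruct (Hl eps He) as [d [Hd Hl']]. exists d; split; [easy|].
      intros x y w h Hw Hh E1 E2 Hwh B1 B2 B3 B4.
      (* The error of the affine approximation of [g] at [(u, v)]; it has the same contour integral
         as [g]. *)
      set (e := fun z => (g z + ((- l) * z + (l * (u, v) - g (u, v))))%C).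
      assert (Hcg : forall z, bdry x (x + w) y (y + h) z -> ccont g z).
      { intros z Hz. apply Hc. apply bdry_inrect in Hz; [|lra|lra]. unfold inrect in *. lra. }
      assert (Hce : forall z, bdry x (x + w) y (y + h) z -> ccont e z).
      { intros z Hz. destruct (Hg z) as [l' Hl0].
        - apply bdry_inrect in Hz; [|lra|lra]. unfold inrect in *. lra.
        - apply (cderiv_ccont _ _ (l' + (- l))%C). unfold e. apply cderiv_plus; [easy|apply cderiv_lin]. }
      assert (E : rint e x (x + w) y (y + h) = rint g x (x + w) y (y + h)).
      { unfold e. rewrite (rint_plus g (fun z => (- l) * z + (l * (u, v) - g (u, v)))%C); try lra.
        - rewrite rint_affine by lra. ring.
        - exact Hcg.
        - intros; apply ccont_affine. }
      rewrite <- E. eapply Rle_trans; [apply (rint_bound e _ _ _ _ (eps * (w + h))); try lra|].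
      + exact Hce.
      + intros z Hz. apply bdry_inrect in Hz; [|lra|lra]. unfold inrect in Hz.
        assert (Hm : Cmod (z - (u, v)) <= w + h).
        { eapply Rle_trans; [apply Cmod_le_Re_Im|].
          change (Re (z - (u, v))) with (Re z - u). change (Im (z - (u, v))) with (Im z - v).
          apply Rplus_le_compat; apply Rabs_le; lra. }
        specialize (Hl' (z - (u, v))%C ltac:(lra)). replace ((u, v) + (z - (u, v)))%C with z in Hl' by ring.
        unfold e. replace (g z + ((- l) * z + (l * (u, v) - g (u, v))))%C with (g z - g (u, v) - l * (z - (u, v)))%C by ring.
        eapply Rle_trans; [exact Hl'|]. apply Rmult_le_compat_l; lra.
      + right. ring. }
  apply Cmod_eq_0. apply Rle_antisym; [|apply Cmod_ge_0]. apply Rnot_lt_le; intros Hp.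
  set (L := (x1 - x0) + (y1 - y0)) in *. assert (HL : 0 <= L) by (unfold L; lra).
  set (m := Cmod (rint g x0 x1 y0 y1)) in *.
  specialize (A (m / 8 / (L * L + 1)) ltac:(apply Rdiv_lt_0_compat; nra)).
  assert (4 * (m / 8 / (L * L + 1)) * L * L <= m / 2); [|lra].
  replace (4 * (m / 8 / (L * L + 1)) * L * L) with (m / 2 * (L * L / (L * L + 1))) by (field; nra).
  rewrite <- (Rmult_1_r (m / 2)) at 2. apply Rmult_le_compat_l; [lra|].
  apply Rmult_le_reg_r with (L * L + 1); [nra|]. unfold Rdiv. rewrite Rmult_assoc, Rinv_l; nra.
Qed.

(** Cutting off strips left, right, below and above the small square leaves four rectangles that
    avoid [(u, v)], and Goursat's theorem makes their integrals vanish. *)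
Lemma rint_hole g x0 x1 y0 y1 u v e : 0 < e ->
  x0 <= u - e -> u + e <= x1 -> y0 <= v - e -> v + e <= y1 ->
  (forall z, inrect x0 x1 y0 y1 z -> z <> (u, v) -> exists l, cderiv g z l) ->
  rint g x0 x1 y0 y1 = rint g (u - e) (u + e) (v - e) (v + e).
Proof.
  intros He X0 X1 Y0 Y1 Hg.
  assert (Z : forall a b c d, x0 <= a -> a <= b -> b <= x1 -> y0 <= c -> c <= d -> d <= y1 ->
    (b < u \/ u < a \/ d < v \/ v < c) -> rint g a b c d = RtoC 0).
  { intros a b c d A1 A2 A3 A4 A5 A6 A7. apply rint_goursat; auto.
    intros z Hz. unfold inrect in Hz. apply Hg; [unfold inrect; lra|].
    intros ->. simpl in Hz. lra. }
  assert (K : forall a b c d, x0 <= a -> a <= b -> b <= x1 -> y0 <= c -> c <= d -> d <= y1 ->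
    a <> u -> b <> u -> c <> v -> d <> v -> forall z, bdry a b c d z -> ccont g z).
  { intros a b c d A1 A2 A3 A4 A5 A6 N1 N2 N3 N4 z Hz.
    destruct (Hg z) as [l Hl].
    - apply bdry_inrect in Hz; auto. unfold inrect in *. lra.
    - intros ->. unfold bdry in Hz. simpl in Hz. lra.
    - now apply cderiv_ccont with l. }
  rewrite (rint_split_x g x0 (u - e) x1); [|lra|lra| |].
  2: { intros z Hz. destruct (Hg z) as [l Hl]; [apply bdry_inrect in Hz; try lra; unfold inrect in *; lra| |now apply cderiv_ccont with l].
       intros ->. apply bdry_inrect in Hz; try lra. unfold inrect in Hz; simpl in Hz. lra. }
  2: { destruct (Req_dec x1 u); [lra|]. apply K; lra. }
  rewrite (Z x0 (u - e) y0 y1) by lra.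
  rewrite (rint_split_x g (u - e) (u + e) x1); [|lra|lra|apply K; lra|].
  2: { intros z Hz. destruct (Hg z) as [l Hl]; [apply bdry_inrect in Hz; try lra; unfold inrect in *; lra| |now apply cderiv_ccont with l].
       intros ->. apply bdry_inrect in Hz; try lra. unfold inrect in Hz; simpl in Hz. lra. }
  rewrite (Z (u + e) x1 y0 y1) by lra.
  rewrite (rint_split_y g (u - e) (u + e) y0 (v - e) y1); [|lra|lra|apply K; lra|apply K; lra].
  rewrite (Z (u - e) (u + e) y0 (v - e)) by lra.
  rewrite (rint_split_y g (u - e) (u + e) (v - e) (v + e) y1); [|lra|lra|apply K; lra|apply K; lra].
  rewrite (Z (u - e) (u + e) (v + e) y1) by lra. ring.
Qed.

(** * Cauchy's integral formula *)

Lemma sqr_plus_sqr_pos x e : 0 < e -> 0 < x ^ 2 + e ^ 2.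
Proof. intros He. assert (H := pow2_ge_0 x). assert (H' := pow_lt e 2 He). lra. Qed.

Lemma RInt_atan u e : 0 < e -> RInt (fun t => 2 * e / ((t - u) ^ 2 + e ^ 2)) (u - e) (u + e) = PI.
Proof.
  intros He. apply is_RInt_unique.
  replace PI with (minus (2 * atan ((u + e - u) / e)) (2 * atan ((u - e - u) / e))).
  - apply (is_RInt_derive (fun t => 2 * atan ((t - u) / e))).
    + intros t _. auto_derive; [easy|].
      assert (Hq := sqr_plus_sqr_pos (t - u) e He). field. split; lra.
    + intros t _. apply (ex_derive_continuous (fun t => 2 * e / ((t - u) ^ 2 + e ^ 2))).
      auto_derive. assert (Hq := sqr_plus_sqr_pos (t - u) e He). simpl in Hq. lra.
  - replace ((u + e - u) / e) with 1 by (field; lra). replace ((u - e - u) / e) with (Ropp 1) by (field; lra).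
    rewrite atan_opp, atan_1. unfold minus, plus, opp; simpl. field.
Qed.

Lemma ccont_inv z0 z : z <> z0 -> ccont (fun w => / (w - z0))%C z.
Proof.
  intros Hz. apply (cderiv_ccont _ _ (- / ((z - z0) * (z - z0)) * 1)%C).
  apply (cderiv_comp Cinv (fun w => w - z0)%C).
  - apply cderiv_ext with (fun w => 1 * w + (- z0))%C; [intros; ring|apply cderiv_lin].
  - apply cderiv_inv. now apply Cminus_eq_contra.
Qed.

(** Opposite sides are combined before integrating: their odd parts cancel, and each pair leaves the
    kernel [2 e / (t^2 + e^2)], centred at [u] or [v], with integral [PI]. *)
Lemma rint_inv_square u v e : 0 < e ->
  rint (fun z => / (z - (u, v)))%C (u - e) (u + e) (v - e) (v + e) = (RtoC 2 * Ci * RtoC PI)%C.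
Proof.
  intros He.
  assert (Hc : forall z, bdry (u - e) (u + e) (v - e) (v + e) z -> ccont (fun z => / (z - (u, v)))%C z).
  { intros z Hz. apply ccont_inv. intros ->. unfold bdry in Hz; simpl in Hz. lra. }
  destruct (bdry_ex_CI _ (u - e) (u + e) (v - e) (v + e) ltac:(lra) ltac:(lra) Hc) as [F1 [F2 [F3 F4]]].
  assert (M : forall f g a b, ex_CI f a b -> ex_CI g a b -> (CI f a b - CI g a b)%C = CI (fun t => f t + RtoC (-1) * g t)%C a b).
  { intros f g a b Hf Hg. rewrite CI_plus, CI_scal; auto; [ring|now apply ex_CI_scal]. }
  unfold rint. rewrite (M _ _ _ _ F1 F2), (M _ _ _ _ F4 F3).
  assert (E1 : CI (fun t => / ((t, (v - e)%R) - (u, v)) + RtoC (-1) * / ((t, (v + e)%R) - (u, v)))%C (u - e) (u + e) = (Ci * RtoC PI)%C).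
  { rewrite (CI_ext _ (fun t => (0, 2 * e / ((t - u) ^ 2 + e ^ 2)))); [|lra|].
    - unfold CI, Re, Im; cbn [fst snd]. rewrite RInt_const, (RInt_atan u e He).
      apply injective_projections; simpl; unfold scal; simpl; unfold mult; simpl; ring.
    - intros t _. assert (Hq := sqr_plus_sqr_pos (t - u) e He).
      apply injective_projections; simpl; field; repeat split; nra. }
  assert (E2 : CI (fun t => / (((u + e)%R, t) - (u, v)) + RtoC (-1) * / (((u - e)%R, t) - (u, v)))%C (v - e) (v + e) = RtoC PI).
  { rewrite (CI_ext _ (fun t => (2 * e / ((t - v) ^ 2 + e ^ 2), 0))); [|lra|].
    - unfold CI, Re, Im; cbn [fst snd]. rewrite RInt_const, (RInt_atan v e He).
      apply injective_projections; simpl; unfold scal; simpl; unfold mult; simpl; ring.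
    - intros t _. assert (Hq := sqr_plus_sqr_pos (t - v) e He).
      apply injective_projections; simpl; field; repeat split; nra. }
  rewrite E1, E2. ring.
Qed.

Definition twopii : C := (RtoC 2 * Ci * RtoC PI)%C.

Lemma twopii_neq_0 : twopii <> RtoC 0.
Proof.
  unfold twopii. repeat apply Cmult_neq_0; [|apply Ci_nz|]; intros H; apply RtoC_inj in H; [lra|].
  assert (H0 := PI_RGT_0). lra.
Qed.

(** The difference quotient [g] of [f] at [p] is bounded near [p], so its integral, equal to that
    over arbitrarily small squares, is 0. What remains is [f p] times the integral of
    [1 / (z - p)]. *)
Lemma cauchy_formula f x0 x1 y0 y1 u v : x0 < u < x1 -> y0 < v < y1 ->
  (forall z, inrect x0 x1 y0 y1 z -> exists l, cderiv f z l) ->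
  rint (fun z => f z * / (z - (u, v)))%C x0 x1 y0 y1 = (f (u, v) * twopii)%C.
Proof.
  intros Hu Hv Hf. set (p := (u, v) : C) in *.
  set (g := fun z => ((f z + (- f p)) * / (z - p))%C).
  assert (Hd : forall z, inrect x0 x1 y0 y1 z -> z <> p -> exists l, cderiv g z l).
  { intros z Hz Hzp. destruct (Hf z Hz) as [l Hl]. eexists. unfold g.
    apply cderiv_mult.
    - apply cderiv_plus; [exact Hl|apply cderiv_const].
    - apply (cderiv_comp Cinv (fun w => w - p)%C).
      + apply cderiv_ext with (fun w => 1 * w + (- p))%C; [intros; ring|apply cderiv_lin].
      + apply cderiv_inv. now apply Cminus_eq_contra. }
  assert (Hg0 : rint g x0 x1 y0 y1 = RtoC 0).
  { destruct (Hf p) as [l Hl]; [unfold inrect, p; simpl; lra|].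
    destruct (Hl 1 ltac:(lra)) as [d [Hd0 Hd1]].
    apply Cmod_eq_0. apply Rle_antisym; [|apply Cmod_ge_0]. apply Rnot_lt_le; intros Hp.
    set (m := Cmod (rint g x0 x1 y0 y1)) in *. set (B := Cmod l + 1).
    assert (HB : 1 <= B) by (unfold B; assert (H := Cmod_ge_0 l); lra).
    (* On the square of half-side [e] the integral of [g] is at most [4 B * 4 e = 16 B e]; the entry
       [m / (32 * B)] makes this at most [m / 2]. The entry [d / 4] keeps the square in the range
       where [|g| <= B]. *)
    set (e := Rmin (Rmin (Rmin (u - x0) (x1 - u)) (Rmin (v - y0) (y1 - v))) (Rmin (d / 4) (m / (32 * B)))).
    assert (Hmb : 0 < m / (32 * B)) by (apply Rdiv_lt_0_compat; lra).
    assert (He : 0 < e /\ e <= u - x0 /\ e <= x1 - u /\ e <= v - y0 /\ e <= y1 - v /\ e <= d / 4 /\ e <= m / (32 * B)).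
    { unfold e, Rmin. repeat destruct Rle_dec; lra. }
    assert (E := rint_hole g x0 x1 y0 y1 u v e ltac:(lra) ltac:(lra) ltac:(lra) ltac:(lra) ltac:(lra) Hd).
    assert (Bd : Cmod (rint g (u - e) (u + e) (v - e) (v + e)) <= 4 * B * ((u + e - (u - e)) + (v + e - (v - e)))).
    { apply rint_bound; try lra.
      - intros z Hz. destruct (Hd z) as [l' Hl']; [| |now apply cderiv_ccont with l'].
        + apply bdry_inrect in Hz; try lra. unfold inrect in *. lra.
        + intros ->. unfold bdry, p in Hz; simpl in Hz. lra.
      - intros z Hz. assert (Hzp : (z - p)%C <> RtoC 0).
        { apply Cminus_eq_contra. intros ->. unfold bdry, p in Hz; simpl in Hz. lra. }
        assert (Hzm := proj1 (Cmod_gt_0 _) Hzp).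
        unfold g. rewrite Cmod_mult, Cmod_inv by easy.
        apply Rmult_le_reg_r with (Cmod (z - p)); [easy|]. rewrite Rmult_assoc, Rinv_l, Rmult_1_r by lra.
        assert (Hzd : Cmod (z - p) < d).
        { eapply Rle_lt_trans; [apply Cmod_le_Re_Im|].
          change (Re (z - p)) with (Re z - u). change (Im (z - p)) with (Im z - v).
          apply bdry_inrect in Hz; try lra. unfold inrect in Hz.
          apply Rle_lt_trans with (e + e); [|lra]. apply Rplus_le_compat; apply Rabs_le; lra. }
        specialize (Hd1 _ Hzd). replace (p + (z - p))%C with z in Hd1 by ring.
        replace (f z + - f p)%C with ((f z - f p - l * (z - p)) + l * (z - p))%C by ring.
        eapply Rle_trans; [apply Cmod_triangle|]. rewrite Cmod_mult. unfold B. lra. }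
    rewrite <- E in Bd. fold m in Bd.
    assert (e * (32 * B) <= m).
    { replace m with (m / (32 * B) * (32 * B)) by (field; lra). apply Rmult_le_compat_r; lra. }
    nra. }
  assert (Hb : forall z, bdry x0 x1 y0 y1 z -> z <> p).
  { intros z Hz ->. unfold bdry, p in Hz; simpl in Hz. lra. }
  assert (Hi : forall z, bdry x0 x1 y0 y1 z -> inrect x0 x1 y0 y1 z).
  { intros z Hz. apply bdry_inrect; auto; lra. }
  rewrite (rint_ext _ (fun z => g z + f p * / (z - p))%C); [|lra|lra|intros z _; unfold g; ring].
  rewrite rint_plus; [|lra|lra| |].
  - rewrite Hg0, rint_scal; [|lra|lra|intros z Hz; apply ccont_inv; auto].
    set (e := Rmin (Rmin (u - x0) (x1 - u)) (Rmin (v - y0) (y1 - v))).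
    assert (He : 0 < e /\ e <= u - x0 /\ e <= x1 - u /\ e <= v - y0 /\ e <= y1 - v).
    { unfold e, Rmin. repeat destruct Rle_dec; lra. }
    rewrite (rint_hole _ x0 x1 y0 y1 u v e); try lra.
    + unfold p. rewrite rint_inv_square by lra. unfold twopii. ring.
    + intros z _ Hz. eexists. apply (cderiv_comp Cinv (fun w => w - p)%C).
      * apply cderiv_ext with (fun w => 1 * w + (- p))%C; [intros; ring|apply cderiv_lin].
      * apply cderiv_inv. now apply Cminus_eq_contra.
  - intros z Hz. destruct (Hd z) as [l Hl]; auto. now apply cderiv_ccont with l.
  - intros z Hz. eapply cderiv_ccont. apply cderiv_scal.
    apply (cderiv_comp Cinv (fun w => w - p)%C).
    + apply cderiv_ext with (fun w => 1 * w + (- p))%C; [intros; ring|apply cderiv_lin].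
    + apply cderiv_inv, Cminus_eq_contra; auto.
Qed.

(** The bisection principle replaces compactness of the rectangle. *)
Lemma ccont_bounded_rect f x0 x1 y0 y1 : x0 <= x1 -> y0 <= y1 ->
  (forall z, inrect x0 x1 y0 y1 z -> ccont f z) ->
  exists M, forall z, inrect x0 x1 y0 y1 z -> Cmod (f z) <= M.
Proof.
  intros Hx Hy Hf.
  assert (B := cousin_rectangles (fun x y w h => exists M, forall z, inrect x (x + w) y (y + h) z -> Cmod (f z) <= M)).
  cbv beta in B. replace x1 with (x0 + (x1 - x0)) by ring. replace y1 with (y0 + (y1 - y0)) by ring.
  apply B; try lra; clear B.
  - intros x y w h Hw Hh [M1 P1] [M2 P2] [M3 P3] [M4 P4].
    exists (Rmax (Rmax M1 M2) (Rmax M3 M4)). intros z Hz. unfold inrect in *.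
    assert (R1 := Rmax_l M1 M2). assert (R2 := Rmax_r M1 M2). assert (R3 := Rmax_l M3 M4).
    assert (R4 := Rmax_r M3 M4). assert (R5 := Rmax_l (Rmax M1 M2) (Rmax M3 M4)).
    assert (R6 := Rmax_r (Rmax M1 M2) (Rmax M3 M4)).
    destruct (Rle_dec (Re z) (x + w / 2)); destruct (Rle_dec (Im z) (y + h / 2)).
    + specialize (P1 z ltac:(lra)). lra.
    + specialize (P3 z ltac:(lra)). lra.
    + specialize (P2 z ltac:(lra)). lra.
    + specialize (P4 z ltac:(lra)). lra.
  - intros u v Hu Hv. destruct (Hf (u, v) ltac:(unfold inrect; simpl; lra) 1 ltac:(lra)) as [d [Hd H]].
    exists d; split; [easy|]. intros x y w h Hw Hh E1 E2 Hwh. exists (Cmod (f (u, v)) + 1).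
    intros z Hz. unfold inrect in Hz.
    assert (Hm : Cmod (z - (u, v)) < d).
    { eapply Rle_lt_trans; [apply Cmod_le_Re_Im|].
      change (Re (z - (u, v))) with (Re z - u). change (Im (z - (u, v))) with (Im z - v).
      apply Rle_lt_trans with (w + h); [|easy]. apply Rplus_le_compat; apply Rabs_le; lra. }
    specialize (H _ Hm). replace ((u, v) + (z - (u, v)))%C with z in H by ring.
    assert (T := Cmod_triangle_rev (f z) (f (u, v))). lra.
Qed.

(** The Cauchy kernel is expanded geometrically over the square of half-side [rho] around [c], whose
    boundary lies at distance at least [rho] from [c]. A square takes the place of a circle because
    only rectangles are available as contours. *)
Lemma taylor f c rho : 0 < rho ->
  (forall z, Rabs (Re z - Re c) <= rho -> Rabs (Im z - Im c) <= rho -> exists l, cderiv f z l) ->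
  exists b M, (forall k, Cmod (b k) * rho ^ k <= M) /\
    forall w, Cmod w < rho -> csums (fun k => b k * w ^ k)%C (f (c + w)%C).
Proof.
  intros Hrho Hf.
  set (x0 := Re c - rho). set (x1 := Re c + rho). set (y0 := Im c - rho). set (y1 := Im c + rho).
  assert (Hx : x0 <= x1) by (unfold x0, x1; lra). assert (Hy : y0 <= y1) by (unfold y0, y1; lra).
  assert (Hf' : forall z, inrect x0 x1 y0 y1 z -> exists l, cderiv f z l).
  { intros z Hz. unfold inrect, x0, x1, y0, y1 in Hz. apply Hf; apply Rabs_le; lra. }
  assert (Hfc : forall z, inrect x0 x1 y0 y1 z -> ccont f z).
  { intros z Hz. destruct (Hf' z Hz) as [l Hl]. now apply cderiv_ccont with l. }
  destruct (ccont_bounded_rect f x0 x1 y0 y1 Hx Hy Hfc) as [M0 HM0].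
  assert (HM0p : 0 <= M0).
  { eapply Rle_trans; [apply Cmod_ge_0|]. apply (HM0 c). unfold inrect, x0, x1, y0, y1; lra. }
  assert (Hi : forall z, bdry x0 x1 y0 y1 z -> inrect x0 x1 y0 y1 z).
  { intros z Hz. apply bdry_inrect; auto. }
  assert (Hfar : forall z, bdry x0 x1 y0 y1 z -> rho <= Cmod (z - c)).
  { intros z Hz. assert (R := Re_le_Cmod (z - c)). assert (I := Im_le_Cmod (z - c)).
    change (Re (z - c)) with (Re z - Re c) in R. change (Im (z - c)) with (Im z - Im c) in I.
    apply Rabs_le_between in R. apply Rabs_le_between in I.
    unfold bdry, x0, x1, y0, y1 in Hz. lra. }
  set (k0 := fun k z => (f z * (/ (z - c)) ^ S k)%C).
  assert (Hdinv : forall p z, z <> p -> cderiv (fun z => / (z - p))%C z (- / ((z - p) * (z - p)) * 1)%C).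
  { intros p z Hz. apply (cderiv_comp Cinv (fun w => w - p)%C).
    - apply cderiv_ext with (fun w => 1 * w + (- p))%C; [intros; ring|apply cderiv_lin].
    - now apply cderiv_inv, Cminus_eq_contra. }
  assert (Hdpow : forall g z l n, cderiv g z l -> exists l', cderiv (fun z => g z ^ n)%C z l').
  { intros g z l n Hg. induction n as [|n [l' IH]].
    - exists (RtoC 0). apply (cderiv_ext (fun _ => RtoC 1)); [easy|apply cderiv_const].
    - eexists. apply (cderiv_ext (fun z => g z * g z ^ n)%C); [easy|]. apply cderiv_mult; [exact Hg|exact IH]. }
  assert (Hnc : forall p z, Cmod (p - c) < rho -> bdry x0 x1 y0 y1 z -> z <> p).
  { intros p z Hp Hz ->. specialize (Hfar p Hz). lra. }
  assert (Hck : forall k z, bdry x0 x1 y0 y1 z -> ccont (k0 k) z).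
  { intros k z Hz. destruct (Hf' z (Hi z Hz)) as [l Hl].
    destruct (Hdpow _ z _ (S k) (Hdinv c z (Hnc c z ltac:(replace (c - c)%C with (RtoC 0) by ring; rewrite Cmod_0; lra) Hz))) as [l' Hl'].
    eapply cderiv_ccont. apply (cderiv_mult _ _ _ _ _ Hl Hl'). }
  set (B := fun k => rint (k0 k) x0 x1 y0 y1).
  (* The constant: 4 from [rint_bound] times [4 rho] for the two side lengths, with
     [rho^k / rho^(k+1)] cancelling that [rho]. *)
  exists (fun k => / twopii * B k)%C, (/ Cmod twopii * (16 * M0)).
  assert (Htp := proj1 (Cmod_gt_0 _) twopii_neq_0).
  split.
  - intros k. rewrite Cmod_mult, Cmod_inv by apply twopii_neq_0. rewrite Rmult_assoc.
    apply Rmult_le_compat_l; [left; now apply Rinv_0_lt_compat|].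
    assert (HB : Cmod (B k) <= 4 * (M0 * (/ rho) ^ S k) * ((x1 - x0) + (y1 - y0))).
    { unfold B. apply (rint_bound (k0 k) x0 x1 y0 y1 (M0 * (/ rho) ^ S k)); [exact Hx|exact Hy|exact (Hck k)|]. intros z Hz. unfold k0. specialize (Hfar z Hz).
      rewrite Cmod_mult, Cmod_pow, Cmod_inv by (apply Cmod_gt_0; lra).
      apply Rmult_le_compat; [apply Cmod_ge_0|apply pow_le; left; apply Rinv_0_lt_compat; lra|exact (HM0 z (Hi z Hz))|].
      apply pow_incr. split; [left; apply Rinv_0_lt_compat; lra|]. apply Rinv_le_contravar; lra. }
    apply Rle_trans with (4 * (M0 * (/ rho) ^ S k) * ((x1 - x0) + (y1 - y0)) * rho ^ k).
    + apply Rmult_le_compat_r; [apply pow_le; lra|exact HB].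
    + right. unfold x0, x1, y0, y1. rewrite pow_inv. simpl. field. split; [apply pow_nonzero|]; lra.
  - intros w Hw. set (p := (c + w)%C). assert (Hw0 := Cmod_ge_0 w).
    assert (Hp : Cmod (p - c) < rho) by (unfold p; replace (c + w - c)%C with w by ring; easy).
    assert (Hpr : x0 < Re p < x1 /\ y0 < Im p < y1).
    { assert (R := Re_le_Cmod w). assert (I := Im_le_Cmod w). apply Rabs_le_between in R. apply Rabs_le_between in I.
      unfold p, x0, x1, y0, y1. rewrite re_plus, im_plus. lra. }
    (* The remainder after [n] terms of the expansion, up to the factor [twopii]; [T 0] is given by
       Cauchy's formula. *)
    set (T := fun n => rint (fun z => (f z * / (z - p)) * (w * / (z - c)) ^ n)%C x0 x1 y0 y1).
    assert (HT0 : T O = (f p * twopii)%C).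
    { assert (E := cauchy_formula f x0 x1 y0 y1 (Re p) (Im p) ltac:(lra) ltac:(lra) Hf').
      change (Re p, Im p) with (fst p, snd p) in E. rewrite <- surjective_pairing in E. rewrite <- E.
      unfold T. apply (rint_ext _ _ x0 x1 y0 y1 Hx Hy). intros z Hz. simpl. ring. }
    assert (HcT : forall n z, bdry x0 x1 y0 y1 z -> ccont (fun z => (f z * / (z - p)) * (w * / (z - c)) ^ n)%C z).
    { intros n z Hz. destruct (Hf' z (Hi z Hz)) as [l Hl].
      assert (D1 := Hdinv c z (Hnc c z ltac:(replace (c - c)%C with (RtoC 0) by ring; rewrite Cmod_0; lra) Hz)).
      assert (D2 := Hdinv p z (Hnc p z Hp Hz)).
      destruct (Hdpow _ z _ n (cderiv_scal w _ _ _ D1)) as [l' Hl'].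
      eapply cderiv_ccont. apply (cderiv_mult _ _ _ _ _ (cderiv_mult _ _ _ _ _ Hl D2) Hl'). }
    assert (HTS : forall n, T n = (w ^ n * B n + T (S n))%C).
    { intros n. unfold T, B. rewrite <- rint_scal by first [exact Hx|exact Hy|exact (Hck n)].
      rewrite <- rint_plus; [|exact Hx|exact Hy| |exact (HcT (S n))].
      - apply (rint_ext _ _ x0 x1 y0 y1 Hx Hy). intros z Hz. unfold k0.
        assert (N1 : (z - c)%C <> RtoC 0) by (apply Cmod_gt_0; specialize (Hfar z Hz); lra).
        assert (N2 : (z - p)%C <> RtoC 0) by (apply Cminus_eq_contra, Hnc; [exact Hp|exact Hz]).
        rewrite !Cpow_mult_l, !Cpow_S.
        (* One step of the geometric expansion of [1 / (z - p)] around [c]. *)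
        assert (EQ : (/ (z - p))%C = (/ (z - c) + w * / (z - c) * / (z - p))%C).
        { unfold p in *. field. split; [exact N2|exact N1]. }
        transitivity (f z * (/ (z - c) + w * / (z - c) * / (z - p)) * (w ^ n * (/ (z - c)) ^ n))%C; [|ring].
        rewrite <- EQ. ring.
      - intros z Hz. destruct (Hf' z (Hi z Hz)) as [l Hl].
        destruct (Hdpow _ z _ (S n) (Hdinv c z (Hnc c z ltac:(replace (c - c)%C with (RtoC 0) by ring; rewrite Cmod_0; lra) Hz))) as [l' Hl'].
        eapply cderiv_ccont. apply cderiv_scal. apply (cderiv_mult _ _ _ _ _ Hl Hl'). }
    assert (HTn : forall n, (f p * twopii)%C = (Csum (fun k => w ^ k * B k)%C n + T n)%C).
    { induction n; simpl; [rewrite HT0; ring|]. rewrite IHn, (HTS n). ring. }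
    set (q := Cmod w / rho).
    assert (Hq : 0 <= q < 1).
    { unfold q. split; [apply Rdiv_le_0_compat; lra|]. apply Rmult_lt_reg_r with rho; [easy|].
      unfold Rdiv. rewrite Rmult_assoc, Rinv_l; lra. }
    set (K := 4 * (M0 * / (rho - Cmod w)) * ((x1 - x0) + (y1 - y0))).
    assert (HK : 0 <= K).
    { unfold K, x0, x1, y0, y1. apply Rmult_le_pos; [|lra]. apply Rmult_le_pos; [lra|].
      apply Rmult_le_pos; [easy|]. left; apply Rinv_0_lt_compat; lra. }
    assert (HTb : forall n, Cmod (T n) <= K * q ^ n).
    { intros n. replace (K * q ^ n) with (4 * (M0 * / (rho - Cmod w) * q ^ n) * ((x1 - x0) + (y1 - y0))) by (unfold K; ring).
      unfold T. apply (rint_bound _ x0 x1 y0 y1 (M0 * / (rho - Cmod w) * q ^ n)); [exact Hx|exact Hy|exact (HcT n)|]. intros z Hz. specialize (Hfar z Hz).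
      assert (Hzp : rho - Cmod w <= Cmod (z - p)).
      { assert (H := Cmod_triangle_rev (z - c) w). unfold p. replace (z - (c + w))%C with (z - c - w)%C by ring. lra. }
      rewrite !Cmod_mult, Cmod_pow, Cmod_mult, !Cmod_inv by (apply Cmod_gt_0; lra).
      apply Rmult_le_compat.
      - apply Rmult_le_pos; [apply Cmod_ge_0|left; apply Rinv_0_lt_compat; lra].
      - apply pow_le, Rmult_le_pos; [easy|left; apply Rinv_0_lt_compat; lra].
      - apply Rmult_le_compat; [apply Cmod_ge_0|left; apply Rinv_0_lt_compat; lra|exact (HM0 z (Hi z Hz))|apply Rinv_le_contravar; lra].
      - apply pow_incr. split; [apply Rmult_le_pos; [easy|left; apply Rinv_0_lt_compat; lra]|].
        unfold q, Rdiv. apply Rmult_le_compat_l; [easy|]. apply Rinv_le_contravar; lra. }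
    assert (HS : csums (fun k => w ^ k * B k)%C (f p * twopii)%C).
    { intros eps He. destruct (pow_lt_1_zero q ltac:(rewrite Rabs_pos_eq; lra) (eps / (K + 1))) as [N HN].
      { apply Rdiv_lt_0_compat; lra. }
      exists N; intros n Hn. specialize (HN n Hn). rewrite Rabs_pos_eq in HN by (apply pow_le; lra).
      rewrite (HTn n). replace (_ - _)%C with (- T n)%C by ring. rewrite Cmod_opp.
      eapply Rle_lt_trans; [apply HTb|]. assert (0 <= q ^ n) by (apply pow_le; lra).
      apply Rle_lt_trans with ((K + 1) * q ^ n); [nra|].
      replace eps with ((K + 1) * (eps / (K + 1))) by (field; lra). apply Rmult_lt_compat_l; lra. }
    assert (H := csums_scal (/ twopii)%C _ _ HS).
    replace (/ twopii * (f p * twopii))%C with (f p) in H by (field; apply twopii_neq_0).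
    revert H. apply csums_ext. intros; ring.
Qed.

(** * Exponents that map all integers to integers *)

Fixpoint fdiff (n : nat) (f : R -> R) : R -> R :=
  match n with O => f | S m => fdiff m (fun x => f (x + 1) - f x) end.

(** With [g i] the [i]-th derivative of [g 0], the induction hypothesis is applied to the family of
    first differences, and one more mean value theorem finishes. *)
Lemma fdiff_mean_value n : forall g : nat -> R -> R,
  (forall i x, 0 < x -> is_derive (g i) x (g (S i) x)) ->
  forall x, 0 < x -> exists xi, x <= xi /\ fdiff n (g O) x = g n xi.
Proof.
  induction n as [|n IH]; intros g Hg x Hx.
  - exists x. split; [lra|easy].
  - destruct (IH (fun i x => g i (x + 1) - g i x)) with (x := x) as [xi [H1 H2]]; [|easy|].
    + intros i y Hy.
      apply (is_derive_minus (fun y => g i (y + 1)) (g i)); [|now apply Hg].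
      replace (g (S i) (y + 1)) with (1 * g (S i) (y + 1)) by ring.
      apply (is_derive_comp (g i) (fun y => y + 1)); [apply Hg; lra|].
      auto_derive; [easy|ring].
    + destruct (MVT_gen (g n) xi (xi + 1) (g (S n))) as [z [Hz1 Hz2]].
      * intros y Hy. rewrite Rmin_left, Rmax_right in Hy by lra. apply Hg. lra.
      * intros y Hy. rewrite Rmin_left, Rmax_right in Hy by lra.
        apply continuity_pt_filterlim, (ex_derive_continuous (g n)). exists (g (S n) y). apply Hg; lra.
      * rewrite Rmin_left, Rmax_right in Hz1 by lra.
        exists z. split; [lra|]. simpl. rewrite H2, Hz2. ring.
Qed.

Lemma fdiff_integer n : forall f : R -> R, (forall k, (1 <= k)%nat -> exists z, f (INR k) = IZR z) ->
  forall k, (1 <= k)%nat -> exists z, fdiff n f (INR k) = IZR z.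
Proof.
  induction n as [|n IH]; intros f Hf k Hk; [now apply Hf|].
  simpl. apply IH; [|easy]. intros j Hj. destruct (Hf j Hj) as [z1 H1]. destruct (Hf (S j) ltac:(lia)) as [z2 H2].
  exists (z2 - z1)%Z. rewrite <- S_INR, H1, H2. now rewrite minus_IZR.
Qed.

(** If [m < c < m + 1], the derivative of order [m + 1] of [x^c] is positive and tends to 0, so the
    difference of that order at a large integer would be an integer strictly between 0 and 1. *)
Lemma integer_exponent c : 0 <= c ->
  (forall k, (1 <= k)%nat -> exists N : nat, exp (c * ln (INR k)) = INR N) -> exists c0 : nat, c = INR c0.
Proof.
  intros Hc Hk. apply NNPP; intros Hno.
  assert (Hm : exists m : nat, INR m < c < INR (S m)).
  { destruct (nfloor_ex c Hc) as [m Hm]. exists m. rewrite S_INR.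
    destruct (Req_dec c (INR m)) as [E|E]; [elim Hno; now exists m|]. lra. }
  destruct Hm as [m Hm].
  (* The falling factorial [c (c - 1) ... (c - i + 1)], the constant in the [i]-th derivative of
     [x^c]. *)
  set (P := fix P i := match i with O => 1 | S j => P j * (c - INR j) end).
  set (g := fun i x => P i * exp ((c - INR i) * ln x)).
  assert (Hg : forall i x, 0 < x -> is_derive (g i) x (g (S i) x)).
  { intros i x Hx. unfold g. change (P (S i)) with (P i * (c - INR i)). generalize (P i). intros q.
    replace (q * (c - INR i) * exp ((c - INR (S i)) * ln x)) with (q * ((c - INR i) * (/ x * exp ((c - INR i) * ln x)))).
    - auto_derive; [easy|]. ring.
    - rewrite S_INR. replace ((c - (INR i + 1)) * ln x) with ((c - INR i) * ln x + - ln x) by ring.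
      rewrite exp_plus, exp_Ropp, exp_ln by easy. ring. }
  assert (HP : forall i, (i <= S m)%nat -> 0 < P i).
  { induction i as [|i IH]; intros Hi; simpl; [lra|]. apply Rmult_lt_0_compat; [apply IH; lia|].
    assert (INR i <= INR m) by (apply le_INR; lia). lra. }
  specialize (HP (S m) (le_n _)). set (p := P (S m)) in *. set (t := INR (S m) - c). assert (Ht : 0 < t) by (unfold t; lra).
  (* For [xi >= k > exp (p / t)] one has [p < t ln xi < xi^t], hence [p xi^-t < 1]. *)
  destruct (nfloor_ex (exp (p / t)) ltac:(left; apply exp_pos)) as [k0 Hk0]. set (k := S k0).
  assert (Hkk : exp (p / t) < INR k) by (unfold k; rewrite S_INR; lra).
  assert (Hkp : 0 < INR k) by (apply (lt_INR 0); unfold k; lia).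
  destruct (fdiff_mean_value (S m) g Hg (INR k) Hkp) as [xi [Hx1 Hx2]].
  destruct (fdiff_integer (S m) (g O)) with (k := k) as [z Hz]; [|unfold k; lia|].
  { intros j Hj. destruct (Hk j Hj) as [N HN]. exists (Z.of_nat N). unfold g. simpl.
    rewrite Rminus_0_r, HN, <- INR_IZR_INZ. ring. }
  rewrite Hz in Hx2. unfold g in Hx2. fold p in Hx2.
  assert (Hl : p / t < ln xi).
  { rewrite <- (ln_exp (p / t)). apply ln_increasing; [apply exp_pos|lra]. }
  assert (Hpt : p < t * ln xi).
  { replace p with (t * (p / t)) by (field; lra). now apply Rmult_lt_compat_l. }
  replace ((c - INR (S m)) * ln xi) with (- (t * ln xi)) in Hx2 by (unfold t; ring).
  rewrite exp_Ropp in Hx2. set (T := t * ln xi) in *. assert (He := exp_ineq1_le T). assert (HeP := exp_pos T).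
  assert (Hz0 : 0 < IZR z < 1).
  { rewrite Hx2. split; [apply Rmult_lt_0_compat; [easy|now apply Rinv_0_lt_compat]|].
    apply Rmult_lt_reg_r with (exp T); [easy|]. rewrite Rmult_assoc, Rinv_l; lra. }
  destruct Hz0 as [Hz1 Hz2]. apply lt_IZR in Hz1. apply lt_IZR in Hz2. lia.
Qed.

(** * Symbols of composition-differentiation operators *)

Lemma cderiv_npow n z : cderiv (npow_neg n) z (RtoC (- ln (INR n)) * npow_neg n z)%C.
Proof.
  apply cderiv_ext with (fun z => cexp (RtoC (- ln (INR n)) * z + 0)).
  - intros w. rewrite npow_cexp. f_equal; ring.
  - rewrite npow_cexp, Cmult_comm. replace (RtoC (- ln (INR n)) * z)%C with (RtoC (- ln (INR n)) * z + 0)%C by ring.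
    apply (cderiv_comp cexp (fun z => RtoC (- ln (INR n)) * z + 0)%C); [apply cderiv_lin|apply cderiv_cexp].
Qed.

Lemma generates_npow Phi k : (2 <= k)%nat -> generates_CD_operator Phi -> in_D (fun s => npow_neg k (Phi s)).
Proof.
  intros Hk H. assert (Hl := ln_INR_pos k Hk).
  set (c := RtoC (- / ln (INR k))).
  assert (Ha : dbd 0 (dconst c) (Cmod c)) by apply dbd_const.
  apply (H (fun s => c * npow_neg k s)%C (npow_neg k)).
  - intros z _. apply cderiv_is_derive.
    replace (npow_neg k z) with (c * (RtoC (- ln (INR k)) * npow_neg k z))%C.
    + apply cderiv_scal, cderiv_npow.
    + rewrite Cmult_assoc. unfold c. rewrite <- RtoC_mult.
      replace (- / ln (INR k) * - ln (INR k)) with 1 by (field; lra). ring.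
  - apply (dbd_in_D _ _ _ _ (dbd_shift k 0 _ _ ltac:(lia) Ha)).
    intros s Hs. rewrite (deval_shift k 0 _ (Cmod c)), deval_const; [ring|lia|easy|lra].
Qed.

(* Both sides are the coefficients of [- ln k ln l Phi' k^-Phi l^-Phi]. *)
Lemma proportional_log_derivatives th Phi k l a b x y M M' :
  (forall s, th < Re s -> exists d, cderiv Phi s d) ->
  dbd x a M -> (forall s, x <= Re s -> npow_neg k (Phi s) = deval a s) ->
  dbd y b M' -> (forall s, y <= Re s -> npow_neg l (Phi s) = deval b s) ->
  forall p, (RtoC (ln (INR l)) * dconv (dlog a) b p)%C = (RtoC (ln (INR k)) * dconv a (dlog b) p)%C.
Proof.
  intros HPhi Ha Ea Hb Eb p.
  set (X := Rmax x y + 1). assert (HX : x + 1 <= X /\ y + 1 <= X).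
  { unfold X. assert (H1 := Rmax_l x y). assert (H2 := Rmax_r x y). lra. }
  assert (Ha' := dbd_le x X _ _ M ltac:(lra) (Rle_refl _) Ha).
  assert (Hb' := dbd_le y X _ _ M' ltac:(lra) (Rle_refl _) Hb).
  assert (Hla := dbd_le (x + 1) X _ _ M ltac:(lra) (Rle_refl _) (dbd_dlog _ _ _ Ha)).
  assert (Hlb := dbd_le (y + 1) X _ _ M' ltac:(lra) (Rle_refl _) (dbd_dlog _ _ _ Hb)).
  destruct (dbd_conv X _ _ _ _ Hla Hb') as [C1 V1]. destruct (dbd_conv X _ _ _ _ Ha' Hlb) as [C2 V2].
  assert (S1 := dbd_scal (RtoC (ln (INR l))) _ _ _ C1). assert (S2 := dbd_scal (RtoC (- ln (INR k))) _ _ _ C2).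
  (* The derivative of [m^-Phi] computed twice: termwise from its series, and by the chain rule. *)
  assert (D : forall q m c z N s, dbd z c N -> (forall s, z <= Re s -> npow_neg m (Phi s) = deval c s) ->
    z + 2 < Re s -> cderiv Phi s q -> deval (dlog c) s = (RtoC (- ln (INR m)) * deval c s * q)%C).
  { intros q m c z N s Hc Ec Hs Hq. rewrite <- Ec by lra.
    apply (cderiv_unique (deval c) s); [now apply (cderiv_deval z c N)|].
    apply (cderiv_ext_loc (fun s => npow_neg m (Phi s)) _ _ _ 1); [lra| |].
    - intros h Hh. apply Ec. rewrite re_plus. assert (H := Re_le_Cmod h). apply Rabs_le_between in H. lra.
    - apply (cderiv_comp (npow_neg m) Phi); [easy|apply cderiv_npow]. }
  assert (H0 := deval_0_unique X _ _ (Rmax (X + 2) th) (dbd_add _ _ _ _ _ S1 S2)).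
  assert (H : forall s, Rmax (X + 2) th < Re s ->
    deval (dadd (dscal (RtoC (ln (INR l))) (dconv (dlog a) b)) (dscal (RtoC (- ln (INR k))) (dconv a (dlog b)))) s = RtoC 0).
  { intros s Hs. assert (R1 := Rmax_l (X + 2) th). assert (R2 := Rmax_r (X + 2) th).
    destruct (HPhi s ltac:(lra)) as [q Hq].
    rewrite (deval_add X _ _ _ _ s S1 S2) by lra.
    rewrite (deval_scal _ X _ _ s C1), (deval_scal _ X _ _ s C2), V1, V2 by lra.
    rewrite (D q k a x M s Ha Ea), (D q l b y M' s Hb Eb) by (auto; lra).
    rewrite !RtoC_opp. ring. }
  specialize (H0 H p). unfold dadd, dscal in H0. rewrite RtoC_opp in H0.
  apply Ceq_minus. rewrite <- H0. ring.
Qed.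

(** In the convolutions at index [n K] only the pair [(n, K)] survives: a divisor [j < n] meets a
    zero of [a], and for [j > n] the cofactor is below [K], where [b] vanishes. The condition on [j]
    is restricted to divisors of [n K] so that [n] need not be the leading index of [a]. *)
Lemma coefficient_relation k l a b n K :
  (forall p, (RtoC (ln (INR l)) * dconv (dlog a) b p)%C = (RtoC (ln (INR k)) * dconv a (dlog b) p)%C) ->
  a O = RtoC 0 -> leads b K -> (1 <= n)%nat -> (1 <= K)%nat -> a n <> RtoC 0 ->
  (forall j, (j < n)%nat -> Nat.divide j (n * K) -> a j = RtoC 0) ->
  ln (INR l) * ln (INR n) = ln (INR k) * ln (INR K).
Proof.
  intros Hrel Ha0 [HbK Hb] Hn HK Han Hj.
  assert (only : forall (a' b' : nat -> C), (forall j, a j = RtoC 0 -> a' j = RtoC 0) ->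
    (forall j, b j = RtoC 0 -> b' j = RtoC 0) -> dconv a' b' (n * K) = (a' n * b' K)%C).
  { intros a' b' Ha' Hb'. unfold dconv. rewrite (Csum_only _ _ n).
    - unfold dshift. rewrite (Nat.mul_comm n K), Nat.Div0.mod_mul, Nat.div_mul by lia. easy.
    - nia.
    - intros j Hj1 Hj2. destruct (Nat.eq_dec j 0) as [->|Hj0]; [rewrite Ha' by easy; ring|].
      unfold dshift. destruct (Nat.eqb_spec ((n * K) mod j) 0) as [E|E]; [|ring].
      destruct (Nat.lt_ge_cases j n) as [Hlt|Hge].
      + rewrite Ha'; [ring|]. apply Hj; [easy|]. now apply Nat.Lcm0.mod_divide.
      + rewrite Hb'; [ring|]. apply Hb. apply Nat.Div0.div_lt_upper_bound. nia. }
  specialize (Hrel (n * K)%nat).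
  rewrite !only in Hrel; auto; try (intros j Hj'; unfold dlog; rewrite Hj'; ring).
  unfold dlog in Hrel.
  assert (E : (RtoC (ln (INR l) * ln (INR n)) * (a n * b K))%C = (RtoC (ln (INR k) * ln (INR K)) * (a n * b K))%C).
  { rewrite !RtoC_mult. rewrite !RtoC_opp in Hrel. apply Ceq_minus. apply Ceq_minus in Hrel.
    replace (RtoC 0) with (- RtoC 0)%C by ring. rewrite <- Hrel. ring. }
  apply RtoC_inj. apply Ceq_minus. apply NNPP; intros Hne.
  apply (Cmult_neq_0 _ _ Hne (Cmult_neq_0 _ _ Han HbK)).
  apply Ceq_minus in E. rewrite <- E. ring.
Qed.

Lemma ln_INR_inj n m : (1 <= n)%nat -> (1 <= m)%nat -> ln (INR n) = ln (INR m) -> n = m.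
Proof.
  intros Hn Hm H. apply INR_eq. apply ln_inv; [apply (lt_INR 0); lia|apply (lt_INR 0); lia|easy].
Qed.

Lemma ln_INR_pow n k : (1 <= n)%nat -> ln (INR (n ^ k)) = INR k * ln (INR n).
Proof.
  intros Hn. rewrite pow_INR. apply ln_pow. apply (lt_INR 0); lia.
Qed.

(** Taylor coefficients of [log (1 + w)]. *)
Definition log_coef (k : nat) : C := match k with O => RtoC 0 | S _ => RtoC (- (-1) ^ k / INR k) end.

Lemma log_coef_bound k : Cmod (log_coef k) <= 1.
Proof.
  destruct k as [|k]; unfold log_coef; [rewrite Cmod_0; lra|].
  rewrite Cmod_R. unfold Rdiv. rewrite Rabs_mult, Rabs_Ropp, pow_1_abs, Rmult_1_l.
  assert (1 <= INR (S k)) by (rewrite S_INR; assert (H := pos_INR k); lra).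
  rewrite Rabs_pos_eq by (left; apply Rinv_0_lt_compat; lra).
  rewrite <- Rinv_1. apply Rinv_le_contravar; lra.
Qed.

(** The differentiated series is geometric; its sum [l] is found from the shift relation
    [l - 1 = -w l]. Only the derivative of [Lam] is recorded, so no branch of the logarithm has to
    be discussed. *)
Lemma log_series : exists Lam : C -> C, (forall w, Cmod w < 1 -> csums (fun k => log_coef k * w ^ k)%C (Lam w)) /\
  forall w, Cmod w < 1 -> cderiv Lam w (/ (1 + w))%C.
Proof.
  set (Lam := fun w => cser (fun k => log_coef k * w ^ k)%C).
  assert (HL : forall w, Cmod w < 1 -> csums (fun k => log_coef k * w ^ k)%C (Lam w)).
  { intros w Hw. apply cser_correct.
    destruct (csums_abs (fun k => log_coef k * w ^ k)%C _ _ (fun k => Rle_refl _)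
      (power_series_bound log_coef 1 1 w ltac:(lra) Hw (fun k => ltac:(rewrite pow1, Rmult_1_r; apply log_coef_bound)))) as [l [Hl _]].
    now exists l. }
  exists Lam. split; [easy|]. intros w Hw.
  destruct (cderiv_power_series log_coef Lam 1 1 ltac:(lra) (fun k => ltac:(rewrite pow1, Rmult_1_r; apply log_coef_bound)) HL w Hw) as [l [H1 H2]].
  replace (/ (1 + w))%C with l; [easy|].
  assert (H3 : csums (fun k => (- w) ^ k)%C l).
  { revert H1. apply csums_ext. intros k.
    replace (log_coef (S k) * INR (S k))%C with (RtoC ((-1) ^ k)).
    - replace (- w)%C with (RtoC (-1) * w)%C by ring. rewrite Cpow_mult_l. f_equal.
      induction k; [easy|]. rewrite Cpow_S, <- IHk. simpl. now rewrite RtoC_mult.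
    - unfold log_coef. rewrite <- RtoC_mult. f_equal. simpl ((-1) ^ S k). field. apply not_0_INR; lia. }
  assert (H4 := csums_shift1 _ _ H3). cbv beta in H4.
  assert (H5 := csums_unique _ _ _ H4 (csums_scal (- w)%C _ _ H3)). simpl in H5.
  assert (Hne : (1 + w)%C <> RtoC 0).
  { apply Cmod_gt_0. assert (H := Cmod_triangle_rev 1 (- w)). rewrite Cmod_opp, Cmod_1 in H.
    replace (1 - - w)%C with (1 + w)%C in H by ring. lra. }
  assert (H6 : ((1 + w) * l)%C = 1%C).
  { replace ((1 + w) * l)%C with (l - 1 + 1 + w * l)%C by ring. rewrite H5. ring. }
  transitivity (/ (1 + w) * ((1 + w) * l))%C; [field; easy|rewrite H6; ring].
Qed.

(* [phi] is recovered from the Dirichlet series [2^-phi] by the logarithm series. *)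
Lemma in_D_of_npow2 th phi g x M :
  (forall s, th < Re s -> exists d, cderiv phi s d) ->
  dbd x g M -> g 1%nat <> RtoC 0 -> (forall s, x <= Re s -> npow_neg 2 (phi s) = deval g s) -> in_D phi.
Proof.
  intros Hphi Hg Hg1 Eg.
  set (e := dadd (dscal (/ g 1%nat)%C g) (dconst (RtoC (-1)))).
  assert (He := dbd_add _ _ _ _ _ (dbd_scal (/ g 1%nat)%C _ _ _ Hg) (dbd_const (RtoC (-1)) x)).
  assert (He1 : e 1%nat = RtoC 0) by (unfold e, dadd, dscal, dconst; simpl; field; easy).
  (* Norm [1/2] keeps the values of [e] inside the unit disc and makes the logarithm series converge
     in the algebra. *)
  destruct (dbd_small x e _ (/2) He He1 ltac:(lra)) as [y [Hxy Hey]].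
  assert (Ee : forall s, x <= Re s -> deval e s = (/ g 1%nat * npow_neg 2 (phi s) + RtoC (-1))%C).
  { intros s Hs. rewrite Eg by easy. unfold e.
    rewrite (deval_add x _ _ _ _ s (dbd_scal (/ g 1%nat)%C _ _ _ Hg) (dbd_const _ x)) by easy.
    now rewrite (deval_scal _ x g M), deval_const. }
  destruct (dcompose y e (/2) log_coef (/ (1 - /2)) Hey) as [X [HX1 HX2]].
  { intros n. eapply Rle_trans; [|apply (Rsum_geom (/2) n); lra]. apply Rsum_le. intros k _.
    rewrite <- (Rmult_1_l ((/2) ^ k)) at 2. apply Rmult_le_compat_r; [apply pow_le; lra|apply log_coef_bound]. }
  destruct log_series as [Lam [HL1 HL2]].
  assert (EX : forall s, y <= Re s -> deval X s = Lam (deval e s)).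
  { intros s Hs. apply csums_unique with (1 := HX2 s Hs). apply HL1.
    assert (H := deval_bound y e (/2) s Hey Hs). lra. }
  set (Y := Rmax th y). assert (HY1 := Rmax_l th y). assert (HY2 := Rmax_r th y). fold Y in HY1, HY2.
  assert (Hl2 := ln_INR_pos 2 ltac:(lia)). set (l2 := ln (INR 2)) in *.
  (* A logarithm undoes [2^-phi] only up to periods; comparing derivatives instead leaves a single
     additive constant. *)
  assert (HD : forall s, Y < Re s -> cderiv (fun s => phi s + RtoC (/ l2) * Lam (/ g 1%nat * npow_neg 2 (phi s) + RtoC (-1)))%C s 0).
  { intros s Hs. destruct (Hphi s ltac:(lra)) as [d Hd].
    assert (H1 := cderiv_comp _ _ _ _ _ Hd (cderiv_npow 2 (phi s))).
    assert (H2 := cderiv_plus _ _ _ _ _ (cderiv_scal (/ g 1%nat)%C _ _ _ H1) (cderiv_const (RtoC (-1)) s)).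
    assert (Hb := deval_bound y e (/2) s Hey ltac:(lra)). rewrite Ee in Hb by lra.
    assert (H3 := HL2 (/ g 1%nat * npow_neg 2 (phi s) + RtoC (-1))%C ltac:(lra)).
    assert (H4 := cderiv_comp Lam (fun s => / g 1%nat * npow_neg 2 (phi s) + RtoC (-1))%C s _ _ H2 H3).
    assert (H5 := cderiv_plus _ _ _ _ _ Hd (cderiv_scal (RtoC (/ l2)) _ _ _ H4)).
    replace (RtoC 0) with (d + RtoC (/ l2) * (/ (1 + (/ g 1%nat * npow_neg 2 (phi s) + RtoC (-1))) * (/ g 1%nat * (RtoC (- ln (INR 2)) * npow_neg 2 (phi s) * d) + 0)))%C at 1; [exact H5|].
    fold l2. rewrite RtoC_opp, RtoC_inv by lra. assert (Hn := npow_neq_0 2 (phi s)).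
    set (w := npow_neg 2 (phi s)) in *.
    replace (1 + (/ g 1%nat * w + RtoC (-1)))%C with (/ g 1%nat * w)%C by ring.
    field. repeat split; auto. intros H; apply RtoC_inj in H; lra. }
  set (s0 := RtoC (Y + 1)).
  set (c := (phi s0 + RtoC (/ l2) * Lam (/ g 1%nat * npow_neg 2 (phi s0) + RtoC (-1)))%C).
  assert (Hc : forall s, Y < Re s -> phi s = (c + RtoC (- / l2) * deval X s)%C).
  { intros s Hs. assert (H := cderiv_0_halfplane _ Y s0 s HD ltac:(unfold s0; rewrite re_RtoC; lra) Hs). cbv beta in H.
    fold c in H. rewrite <- H, EX, Ee by lra. rewrite RtoC_opp. ring. }
  assert (HF := dbd_add _ _ _ _ _ (dbd_const c Y) (dbd_scal (RtoC (- / l2)) _ _ _ (dbd_le _ Y _ _ _ HY2 (Rle_refl _) HX1))).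
  apply (dbd_in_D _ _ _ _ HF). intros s Hs.
  rewrite (deval_add Y _ _ _ _ s (dbd_const c Y) (dbd_scal (RtoC (- / l2)) _ _ _ (dbd_le _ Y _ _ _ HY2 (Rle_refl _) HX1))) by lra.
  rewrite deval_const, (deval_scal _ y X _ s HX1) by lra. now apply Hc.
Qed.

Lemma pow2_divide_odd_mul c : forall n t, Nat.even t = false ->
  Nat.divide (2 ^ c) (t * n) -> Nat.divide (2 ^ c) n.
Proof.
  induction c as [|c IH]; intros n t Ht H; [apply Nat.divide_1_l|].
  assert (He : Nat.even n = true).
  { destruct H as [q Hq]. assert (E : Nat.even (t * n) = true).
    { rewrite Hq, Nat.pow_succ_r', Nat.even_mul, Nat.even_mul. apply Bool.orb_true_r. }
    rewrite Nat.even_mul, Ht in E. exact E. }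
  apply Nat.even_spec in He. destruct He as [m ->].
  rewrite Nat.pow_succ_r' in *. apply Nat.mul_divide_mono_l. apply (IH m t Ht).
  destruct H as [q Hq]. exists q. nia.
Qed.

Lemma generates_form th Phi : (forall s, th < Re s -> exists d, cderiv Phi s d) -> generates_CD_operator Phi ->
  exists c0 : nat, in_D (fun s => Phi s - RtoC (INR c0) * s)%C.
Proof.
  intros HPhi Hgen.
  assert (A : forall k, (2 <= k)%nat -> exists a x M, dbd x a M /\ forall s, x <= Re s -> npow_neg k (Phi s) = deval a s).
  { intros k Hk. apply in_D_dbd. now apply generates_npow. }
  assert (L : forall k a x M, dbd x a M -> (forall s, x <= Re s -> npow_neg k (Phi s) = deval a s) -> exists N, (1 <= N)%nat /\ leads a N).
  { intros k a x M Ha Ea. destruct (classic (exists n, a n <> RtoC 0)) as [[n Hn]|Hno].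
    - destruct (leads_ex a n Hn) as [N HN]. exists N. split; [now apply leads_pos with x a M|easy].
    (* A power [k^-Phi] never vanishes, so its series cannot be zero. *)
    - exfalso. apply (npow_neq_0 k (Phi (RtoC x))). rewrite Ea by (rewrite re_RtoC; lra).
      apply deval_unique. apply csums_ext with (fun _ => RtoC 0).
      + intros n. replace (a n) with (RtoC 0); [ring|]. symmetry. apply NNPP. intros H. apply Hno. now exists n.
      + apply (csums_finite (fun _ => RtoC 0) 0). easy. }
  destruct (A 2%nat (le_n _)) as [a [x [M [Ha Ea]]]]. destruct (L 2%nat a x M Ha Ea) as [N2 [HN2 La]].
  assert (Hl2 := ln_INR_pos 2 (le_n _)).
  set (c := ln (INR N2) / ln (INR 2)).
  assert (Hc0 : 0 <= c) by (unfold c; apply Rdiv_le_0_compat; [apply ln_INR_nonneg|easy]).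
  assert (Hlead : forall k b y M', (2 <= k)%nat -> dbd y b M' -> (forall s, y <= Re s -> npow_neg k (Phi s) = deval b s) ->
    exists K, (1 <= K)%nat /\ leads b K /\ ln (INR K) = c * ln (INR k)).
  { intros k b y M' Hk Hb Eb. destruct (L k b y M' Hb Eb) as [K [HK Lb]]. exists K. repeat split; auto; try apply Lb.
    assert (R := coefficient_relation 2 k a b N2 K (proportional_log_derivatives th Phi 2 k a b x y M M' HPhi Ha Ea Hb Eb)
      (proj1 Ha) Lb HN2 HK (proj1 La) (fun j Hj _ => proj2 La j Hj)).
    unfold c. apply Rmult_eq_reg_l with (ln (INR 2)); [|lra]. rewrite <- R. field; lra. }
  destruct (integer_exponent c Hc0) as [c0 Hc].
  { intros k Hk. destruct (Nat.eq_dec k 1) as [->|Hk1].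
    (* The exponent statement includes the base 1, for which there is no test function because
       [ln 1 = 0]. *)
    - exists 1%nat. simpl. rewrite ln_1, Rmult_0_r. apply exp_0.
    - destruct (A k ltac:(lia)) as [b [y [M' [Hb Eb]]]]. destruct (Hlead k b y M' ltac:(lia) Hb Eb) as [K [HK [_ E]]].
      exists K. rewrite <- E. apply exp_ln. apply (lt_INR 0); lia. }
  exists c0.
  set (Q := (2 ^ c0)%nat). assert (HQ : (1 <= Q)%nat) by (unfold Q; assert (H := Nat.pow_nonzero 2 c0); lia).
  assert (EN2 : N2 = Q).
  { apply ln_INR_inj; auto. unfold Q. rewrite ln_INR_pow, <- Hc by lia. unfold c. field; lra. }
  assert (Hdiv : forall n, a n <> RtoC 0 -> Nat.divide Q n).
  { destruct (A 3%nat ltac:(lia)) as [b [y [M' [Hb Eb]]]].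
    destruct (Hlead 3%nat b y M' ltac:(lia) Hb Eb) as [K [HK [Lb EK]]].
    assert (EK' : K = (3 ^ c0)%nat).
    { apply ln_INR_inj; auto; [assert (H := Nat.pow_nonzero 3 c0); lia|]. now rewrite ln_INR_pow, <- Hc by lia. }
    (* Smaller support indices are multiples of [Q]. One of them dividing [n 3^c0] would give that
       [Q] divides [n 3^c0], hence [n]. So, if [Q] does not divide [n], [coefficient_relation]
       applies at [n] and forces [n = Q], a contradiction. *)
    intros n. induction n as [n IH] using lt_wf_ind. intros Hn. apply NNPP; intros Hnd.
    assert (Hn1 : (1 <= n)%nat) by (destruct n; [now destruct Ha|lia]).
    assert (R := coefficient_relation 2 3 a b n K (proportional_log_derivatives th Phi 2 3 a b x y M M' HPhi Ha Ea Hb Eb)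
      (proj1 Ha) Lb Hn1 HK Hn).
    apply Hnd. exists 1%nat. rewrite Nat.mul_1_l. apply ln_INR_inj; auto. unfold Q. rewrite ln_INR_pow, <- Hc by lia.
    assert (Hl3 := ln_INR_pos 3 ltac:(lia)). apply Rmult_eq_reg_l with (ln (INR 3)); [|lra].
    rewrite R, EK; [ring|]. intros j Hj Hjd. apply NNPP; intros Hja. apply Hnd.
    apply (pow2_divide_odd_mul c0 n K).
    - rewrite EK'. clear. induction c0 as [|c0 IH]; [easy|]. now rewrite Nat.pow_succ_r', Nat.even_mul, IH.
    - apply Nat.divide_trans with j; [now apply IH|]. now rewrite Nat.mul_comm. }
  (* The coefficients of [2^-(Phi - c0 s)]: division by [2^(-c0 s) = Q^-s] reindexes a series
     supported on the multiples of [Q]. *)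
  set (g := fun m => a (Q * m)%nat).
  assert (Eag : forall n, a n = dshift Q g n).
  { intros n. unfold dshift, g. destruct (Nat.eqb_spec (n mod Q) 0) as [E|E].
    - f_equal. apply Nat.Div0.div_exact in E. exact E.
    - apply NNPP. intros Hn. apply E. apply Nat.Lcm0.mod_divide, Hdiv. exact Hn. }
  assert (Hwq := wt_pos Q x).
  assert (Hg : dbd x g (M / wt Q x)).
  { destruct Ha as [Ha0 HaM]. split; [unfold g; rewrite Nat.mul_0_r; exact Ha0|]. intros n.
    apply Rmult_le_reg_l with (wt Q x); [easy|]. replace (wt Q x * (M / wt Q x)) with M by (field; lra).
    rewrite <- Rsum_scal. eapply Rle_trans; [|apply (HaM (Q * n)%nat)].
    (* Among the first [Q n] indices there are exactly [n] multiples of [Q]. *)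
    replace n with ((Q * n + Q - 1) / Q)%nat at 1.
    - rewrite <- Rsum_sparse by easy. right. apply Rsum_ext. intros k _. rewrite (Eag k). unfold dshift.
      destruct (Nat.eqb_spec (k mod Q) 0) as [E|E]; [|rewrite Cmod_0; ring].
      destruct (Nat.eq_dec k 0) as [->|Hk].
      + unfold g. rewrite Nat.Div0.div_0_l, Nat.mul_0_r, Ha0, Cmod_0. ring.
      + destruct (div_exact_facts Q k HQ E Hk) as [E1 E2]. rewrite E1 at 4. rewrite wt_mult by easy. ring.
    - symmetry. apply (Nat.div_unique _ _ _ (Q - 1)%nat); nia. }
  assert (EG : forall s, x <= Re s -> npow_neg 2 (Phi s - RtoC (INR c0) * s)%C = deval g s).
  { intros s Hs.
    assert (E : deval a s = (npow_neg Q s * deval g s)%C).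
    { rewrite <- (deval_shift Q x g (M / wt Q x)) by easy. apply deval_unique.
      apply csums_ext with (fun k => dshift Q g k * npow_neg k s)%C; [intros; now rewrite Eag|].
      apply (deval_correct x _ _ _ (dbd_shift Q x g _ HQ Hg) Hs). }
    rewrite <- Ea in E by easy.
    assert (EQ : npow_neg Q s = npow_neg 2 (RtoC (INR c0) * s)).
    { rewrite !npow_cexp. unfold Q. rewrite ln_INR_pow by lia. f_equal. rewrite !RtoC_opp, RtoC_mult. ring. }
    rewrite EQ in E.
    assert (Hn := npow_neq_0 2 (RtoC (INR c0) * s)).
    transitivity (npow_neg 2 (Phi s - RtoC (INR c0) * s)%C * npow_neg 2 (RtoC (INR c0) * s) * / npow_neg 2 (RtoC (INR c0) * s))%C; [field; easy|].
    rewrite <- npow_plus. replace (Phi s - RtoC (INR c0) * s + RtoC (INR c0) * s)%C with (Phi s) by ring.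
    rewrite E. field. easy. }
  apply (in_D_of_npow2 th _ g x (M / wt Q x)); auto.
  - intros s Hs. destruct (HPhi s Hs) as [d Hd]. eexists.
    apply (cderiv_ext (fun s => Phi s + (RtoC (- INR c0) * s + 0))%C); [intros; rewrite RtoC_opp; ring|].
    apply cderiv_plus; [exact Hd|apply cderiv_lin].
  - unfold g. rewrite Nat.mul_1_r, <- EN2. apply La.
Qed.

(** * Sufficiency of the form *)

Lemma rotate_to_negative_Re z : z <> RtoC 0 -> exists al, Re (z * cexp (0, al)) < 0.
Proof.
  intros Hz. unfold cexp; simpl. rewrite exp_0.
  destruct (Rtotal_order (Re z) 0) as [H|[H|H]].
  - exists 0. simpl. rewrite cos_0, sin_0. unfold Re in H. lra.
  - destruct (Rtotal_order (Im z) 0) as [H'|[H'|H']].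
    + exists (- (PI / 2)). simpl. rewrite cos_neg, sin_neg, cos_PI2, sin_PI2. unfold Im in H'. lra.
    + elim Hz. now apply injective_projections.
    + exists (PI / 2). simpl. rewrite cos_PI2, sin_PI2. unfold Im in H'. lra.
  - exists PI. simpl. rewrite cos_PI, sin_PI. unfold Re in H. lra.
Qed.

(* The choice of [Im s] prescribes the argument of the leading term of [deval e s]. *)
Lemma constant_term_gt x e M c y r : dbd x e M -> e 1%nat = RtoC 0 ->
  (forall s, y < Re s -> r < Re (c + deval e s)) -> r < Re c.
Proof.
  intros He He1 Hr. destruct (classic (exists n, e n <> RtoC 0)) as [[n Hn]|Hno].
  - destruct (leads_ex e n Hn) as [N HN]. assert (HN1 := leads_pos _ _ _ _ He HN).
    assert (HN2 : (2 <= N)%nat). { destruct HN as [HN _]. destruct N as [|[|N]]; [lia|easy|lia]. }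
    assert (Hl := ln_INR_pos N HN2).
    destruct (rotate_to_negative_Re (e N) (proj1 HN)) as [al Hal]. set (v := - Re (e N * cexp (0, al))).
    (* At such [t] the tail is smaller than [v N^-(x+t)], the amount by which the turned leading
       term lowers the real part; hence [Re (deval e s) < 0]. *)
    destruct (wt_tail_small N M (v * wt N x) (y - x)) as [t [Ht [Hyt Hlt]]]; auto.
    { now apply dbd_nonneg in He. }
    { apply Rmult_lt_0_compat; [unfold v; lra|apply wt_pos]. }
    set (s := (x + t, - al / ln (INR N)) : C). assert (Hs : Re s = x + t) by easy.
    assert (HB := deval_tail x e M N t s He HN Ht Hs).
    assert (Es : npow_neg N s = (RtoC (wt N (x + t)) * cexp (0, al))%C).
    { rewrite npow_cexp. unfold wt. rewrite <- cexp_R, <- cexp_plus. f_equal.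
      unfold s. apply injective_projections; simpl; field; lra. }
    specialize (Hr s ltac:(rewrite Hs; lra)).
    assert (HR := Re_le_Cmod (deval e s - e N * npow_neg N s)). apply Rabs_le_between in HR.
    assert (E2 : Re (deval e s - e N * npow_neg N s) = Re (deval e s) + wt N x * wt N t * v).
    { unfold Cminus. rewrite re_plus, re_opp, Es, wt_plus. unfold v.
      replace (e N * (RtoC (wt N x * wt N t) * cexp (0, al)))%C with (RtoC (wt N x * wt N t) * (e N * cexp (0, al)))%C by ring.
      rewrite re_scal_l. ring. }
    rewrite re_plus in Hr. lra.
  - specialize (Hr (RtoC (y + 1)) ltac:(rewrite re_RtoC; lra)).
    rewrite (deval_unique e _ (RtoC 0)) in Hr.
    + now rewrite Cplus_0_r in Hr.
    + apply csums_ext with (fun _ => RtoC 0).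
      * intros n. replace (e n) with (RtoC 0); [ring|]. symmetry. apply NNPP. intros H. apply Hno. now exists n.
      * apply (csums_finite (fun _ => RtoC 0) 0). easy.
Qed.

Lemma succ_le_pow2 k : INR (S k) <= 2 ^ k.
Proof.
  induction k as [|k IH]; [simpl; lra|].
  rewrite S_INR. assert (1 <= 2 ^ k) by (apply pow_R1_Rle; lra). simpl (2 ^ S k). lra.
Qed.

Lemma in_D_comp_bounded f f' x e M c :
  (forall z, 1/2 < Re z -> cderiv f z (f' z)) -> dbd x e M -> e 1%nat = RtoC 0 -> 1/2 < Re c ->
  in_D (fun s => f' (c + deval e s)%C).
Proof.
  (* Half the distance from [c] to the line [Re z = 1/2], so that the closed square needed by
     [taylor] lies in the domain of [f]. *)
  intros Hf He He1 Hc. set (rho := (Re c - 1/2) / 2). assert (Hrho : 0 < rho) by (unfold rho; lra).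
  destruct (taylor f c rho Hrho) as [b [B [Hb Hs]]].
  { intros z Hz _. exists (f' z). apply Hf. apply Rabs_le_between in Hz. unfold rho in Hz. lra. }
  set (b' := fun k => (b (S k) * INR (S k))%C).
  assert (Hb' : forall w, Cmod w < rho -> csums (fun k => b' k * w ^ k)%C (f' (c + w)%C)).
  { intros w Hw. destruct (cderiv_power_series b (fun w => f (c + w)%C) rho B Hrho Hb Hs w Hw) as [l [H1 H2]].
    replace (f' (c + w)%C) with l; [exact H1|].
    apply (cderiv_unique _ _ _ _ H2). replace (f' (c + w)%C) with (f' (1 * w + c)%C * 1)%C.
    - apply cderiv_ext with (fun w => f (1 * w + c)%C); [intros; f_equal; ring|].
      apply (cderiv_comp f (fun w => 1 * w + c)%C); [apply cderiv_lin|]. apply Hf.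
      rewrite re_plus, re_scal_l. assert (R := Re_le_Cmod w). apply Rabs_le_between in R. unfold rho in Hw. lra.
    - replace (1 * w + c)%C with (c + w)%C by ring. ring. }
  destruct (dbd_small x e M (rho / 4) He He1 ltac:(lra)) as [y [Hxy Hey]].
  assert (HB : 0 <= B) by (eapply Rle_trans; [|apply (Hb O)]; simpl; assert (H := Cmod_ge_0 (b O)); lra).
  (* At norm [rho / 4] one factor [2^-k] absorbs the [k + 1] from differentiation and another is
     left for the geometric sum. *)
  destruct (dcompose y e (rho / 4) b' (B / rho * / (1 - /2)) Hey) as [X [HX1 HX2]].
  { intros n. apply Rle_trans with (Rsum (fun k => B / rho * (/2) ^ k) n).
    - apply Rsum_le. intros k _. unfold b'. rewrite Cmod_mult, Cmod_R, Rabs_pos_eq by apply pos_INR.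
      specialize (Hb (S k)). assert (Hk := succ_le_pow2 k).
      assert (Hr : 0 < rho ^ k) by now apply pow_lt.
      assert (H2 : 0 < 2 ^ k) by (apply pow_lt; lra).
      assert (E4 : (rho / 4) ^ k = rho ^ k * / 2 ^ k * (/2) ^ k).
      { unfold Rdiv. rewrite Rpow_mult_distr, !pow_inv. replace 4 with (2 * 2) by ring.
        rewrite Rpow_mult_distr. field. lra. }
      rewrite E4. rewrite <- !Rmult_assoc. apply Rmult_le_compat_r; [apply pow_le; lra|].
      simpl in Hb. apply Rmult_le_reg_r with rho; [easy|].
      replace (B / rho * rho) with B by (field; lra).
      apply Rle_trans with (Cmod (b (S k)) * (rho * rho ^ k) * (INR (S k) * / 2 ^ k)); [right; ring|].
      apply Rle_trans with (Cmod (b (S k)) * (rho * rho ^ k) * 1); [|lra].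
      apply Rmult_le_compat_l; [apply Rmult_le_pos; [apply Cmod_ge_0|nra]|].
      apply Rmult_le_reg_r with (2 ^ k); [easy|]. rewrite Rmult_assoc, Rinv_l; lra.
    - rewrite Rsum_scal. apply Rmult_le_compat_l; [apply Rdiv_le_0_compat; lra|apply Rsum_geom; lra]. }
  apply (dbd_in_D _ X _ _ HX1). intros s Hs'.
  apply csums_unique with (2 := HX2 s ltac:(lra)). apply Hb'.
  assert (H := deval_bound y e _ s Hey ltac:(lra)). lra.
Qed.

(** The exponential series of [- E ln n] has norm at most [exp (ln n) = n] when [E] has norm at most
    1; this is the bound [wt n (-1)], a loss of one unit of abscissa. *)
Lemma npow_of_dirichlet y e n : dbd y e 1 -> exists Z, dbd y Z (wt n (-1)) /\
  forall s, y <= Re s -> deval Z s = npow_neg n (deval e s).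
Proof.
  intros He. assert (Hl := ln_INR_nonneg n).
  destruct (dcompose y e 1 (fun k => RtoC (/ INR (fact k)) * RtoC (- ln (INR n)) ^ k)%C (wt n (-1)) He) as [Z [H1 H2]].
  - intros N. replace (wt n (-1)) with (exp (ln (INR n))) by (unfold wt; f_equal; ring).
    eapply Rle_trans; [|apply (exp_partial_sum (ln (INR n)) N Hl)]. right. apply Rsum_ext. intros k _.
    rewrite Cmod_mult, Cmod_pow, !Cmod_R, Rabs_Ropp, !Rabs_pos_eq, pow1; [ring|easy|].
    left; apply Rinv_0_lt_compat, INR_fact_lt_0.
  - exists Z. split; [easy|]. intros s Hs. apply csums_unique with (1 := H2 s Hs).
    rewrite npow_cexp. generalize (cexp_series (RtoC (- ln (INR n)) * deval e s)). apply csums_ext.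
    intros k. rewrite Cpow_mult_l. ring.
Qed.

Lemma deval_dlog_deriv f f' a y N : (forall z, 1/2 < Re z -> cderiv f z (f' z)) -> dbd y a N ->
  (forall s, y <= Re s -> f s = deval a s) ->
  forall z, 1/2 < Re z -> y + 2 < Re z -> f' z = deval (dlog a) z.
Proof.
  intros Hf Ha Ea z H1 H2. apply (cderiv_unique f z); [now apply Hf|].
  apply (cderiv_ext_loc (deval a) f z _ 1); [lra| |now apply (cderiv_deval y a N)].
  intros h Hh. symmetry. apply Ea. rewrite re_plus. assert (H := Re_le_Cmod h). apply Rabs_le_between in H. lra.
Qed.

Lemma in_D_comp_unbounded f' a y N x e M c (c0 : nat) : (1 <= c0)%nat ->
  dbd y a N -> (forall z, 1/2 < Re z -> y + 2 < Re z -> f' z = deval (dlog a) z) ->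
  dbd x e M -> e 1%nat = RtoC 0 ->
  in_D (fun s => f' (RtoC (INR c0) * s + (c + deval e s))%C).
Proof.
  intros Hc0 Ha Hf He He1.
  destruct (dbd_small x e M 1 He He1 ltac:(lra)) as [w [Hxw Hew]].
  (* [K >= 1] gives [c0 K >= K]. The other entries make the norms below at most [n^-(y+1)] times the
     coefficient and place [Phi s] to the right of both [y + 2] and [1/2]. *)
  set (K := Rmax (Rmax w 1) (Rmax (y + 4 - Re c) (3 - Re c))).
  assert (HK : w <= K /\ 1 <= K /\ y + 4 - Re c <= K /\ 3 - Re c <= K).
  { unfold K, Rmax. repeat destruct Rle_dec; lra. }
  assert (HeK := dbd_le w K e 1 1 ltac:(lra) ltac:(lra) Hew).
  assert (Hc1 : 1 <= INR c0) by (apply (le_INR 1); lia).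
  assert (HZ : forall n, exists Z, dbd K Z (wt n (-1)) /\ forall s, K <= Re s -> deval Z s = npow_neg n (deval e s)).
  { intros n. now apply npow_of_dirichlet. }
  set (Z := fun n => proj1_sig (constructive_indefinite_description _ (HZ n))).
  assert (HZ1 : forall n, dbd K (Z n) (wt n (-1))) by (intros n; apply (proj2_sig (constructive_indefinite_description _ (HZ n)))).
  assert (HZ2 : forall n s, K <= Re s -> deval (Z n) s = npow_neg n (deval e s)).
  { intros n; apply (proj2_sig (constructive_indefinite_description _ (HZ n))). }
  assert (Hla := dbd_dlog y a N Ha).
  assert (Hpow : forall j, (1 <= S j ^ c0)%nat) by (intros j; assert (H := Nat.pow_nonzero (S j) c0); lia).
  set (m := fun n => Cmod (dlog a n) * wt n (y + 1)).
  (* The term of index [n] is [n^-Phi = (n^c0)^-s n^-c n^-E]: a shift by [n^c0], a constant factor,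
     and the series [Z n]. Starting from [S j] skips index 0, for which the shift would be
     undefined. *)
  destruct (dfamily K (fun j => dscal (dlog a (S j) * npow_neg (S j) c)%C (dshift (S j ^ c0) (Z (S j))))
    (fun j => m (S j)) N) as [X [_ [HX1 HX2]]].
  - intros j. set (n := S j).
    assert (H := dbd_scal (dlog a n * npow_neg n c)%C _ _ _ (dbd_shift (n ^ c0) K _ _ (Hpow j) (HZ1 n))).
    revert H. apply dbd_le; [lra|]. rewrite Cmod_mult, Cmod_npow. unfold m.
    rewrite Rmult_assoc. apply Rmult_le_compat_l; [apply Cmod_ge_0|].
    replace (wt (n ^ c0) K) with (wt n (INR c0 * K)).
    + rewrite <- !wt_plus. apply wt_le. nra.
    + unfold wt. rewrite ln_INR_pow by (unfold n; lia). f_equal; ring.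
  - intros n. apply Rle_trans with (Rsum m (S n)); [|apply Hla].
    assert (Hm : forall k, 0 <= m k) by (intros; apply dbd_term_nonneg).
    clear - Hm. induction n; simpl in *; [specialize (Hm O); lra|lra].
  - apply (dbd_in_D _ X _ _ HX1). intros s Hs.
    assert (Hb := deval_bound K e 1 s HeK ltac:(lra)).
    assert (HR := Re_le_Cmod (deval e s)). apply Rabs_le_between in HR.
    set (P := (RtoC (INR c0) * s + (c + deval e s))%C).
    assert (HP : Re s + Re c - 1 <= Re P).
    { unfold P. rewrite !re_plus, re_scal_l. nra. }
    rewrite Hf by lra.
    assert (HS := csums_shift1 _ _ (deval_correct (y + 1) _ N P Hla ltac:(lra))). cbv beta in HS.
    replace (dlog a 0 * npow_neg 0 P)%C with (RtoC 0) in HS by (rewrite (proj1 Hla); ring).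
    replace (deval (dlog a) P - 0)%C with (deval (dlog a) P) in HS by ring.
    apply csums_unique with (1 := HS). eapply csums_ext; [|apply (HX2 s ltac:(lra))].
    intros j. cbv beta. set (n := S j).
    rewrite (deval_scal _ K _ _ s (dbd_shift (n ^ c0) K _ _ (Hpow j) (HZ1 n))) by lra.
    rewrite (deval_shift (n ^ c0) K _ _ s (Hpow j) (HZ1 n)) by lra. rewrite HZ2 by lra.
    unfold P. rewrite !npow_plus.
    replace (npow_neg (n ^ c0) s) with (npow_neg n (RtoC (INR c0) * s)); [ring|].
    rewrite !npow_cexp, ln_INR_pow by (unfold n; lia). f_equal. rewrite !RtoC_opp, RtoC_mult. ring.
Qed.

Lemma in_D_ext_loc th g h : (forall s, th < Re s -> g s = h s) -> in_D g -> in_D h.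
Proof.
  intros E [a [sg H]]. exists a, (Rmax sg th). intros s Hs. unfold in_halfplane in *.
  assert (H1 := Rmax_l sg th). assert (H2 := Rmax_r sg th).
  rewrite <- E by lra. apply H. lra.
Qed.

Lemma form_generates th Phi (c0 : nat) phi :
  (forall s, th < Re s -> 1/2 < Re (Phi s)) -> in_D phi ->
  (forall s, th < Re s -> Phi s = (RtoC (INR c0) * s + phi s)%C) -> generates_CD_operator Phi.
Proof.
  intros Hmap Hphi HPhi f f' Hder Hf.
  assert (Hder' : forall z, 1/2 < Re z -> cderiv f z (f' z)).
  { intros z Hz. apply cderiv_is_derive. now apply Hder. }
  destruct (in_D_dbd phi Hphi) as [cf [x [M [Hc Ec]]]].
  set (c := cf 1%nat). set (e := dadd cf (dconst (- c)%C)).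
  assert (He := dbd_add _ _ _ _ _ Hc (dbd_const (- c)%C x)).
  assert (He1 : e 1%nat = RtoC 0) by (unfold e, dadd, dconst, c; simpl; ring).
  assert (Ee : forall s, x <= Re s -> phi s = (c + deval e s)%C).
  { intros s Hs. rewrite Ec by easy. unfold e. rewrite (deval_add x _ _ _ _ s Hc (dbd_const (- c)%C x)) by easy.
    rewrite deval_const. ring. }
  set (X := Rmax th x). assert (HX1 := Rmax_l th x). assert (HX2 := Rmax_r th x). fold X in HX1, HX2.
  destruct c0 as [|c0].
  - assert (EP : forall s, X < Re s -> Phi s = (c + deval e s)%C).
    { intros s Hs. rewrite HPhi, Ee by lra. simpl. ring. }
    apply (in_D_ext_loc X (fun s => f' (c + deval e s)%C)).
    + intros s Hs. now rewrite EP.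
    + apply (in_D_comp_bounded f f' x e _ c Hder' He He1).
      (* Here the assumption that [Phi] maps into the half-plane [Re z > 1/2] enters. *)
      apply (constant_term_gt x e _ c X (1/2) He He1). intros s Hs. rewrite <- EP by easy. apply Hmap. lra.
  - destruct (in_D_dbd f Hf) as [a [y [N [Ha Ea]]]].
    apply (in_D_ext_loc X (fun s => f' (RtoC (INR (S c0)) * s + (c + deval e s))%C)).
    + intros s Hs. now rewrite HPhi, Ee by lra.
    + apply (in_D_comp_unbounded f' a y N x e (M + Cmod (- c)) c (S c0) ltac:(lia) Ha); auto.
      now apply (deval_dlog_deriv f f' a y N).
Qed.

Theorem theorem2p1 (theta : R) (Phi : C -> C)
  (Hhol : holomorphic_on (in_halfplane theta) Phi)
  (Hmap : forall s, in_halfplane theta s -> in_halfplane (1/2) (Phi s)) :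
  generates_CD_operator Phi <->
  exists (c0 : nat) (phi : C -> C),
    in_D phi /\
    forall s, in_halfplane theta s ->
      Phi s = Cplus (Cmult (RtoC (INR c0)) s) (phi s).
Proof.
  split.
  - intros Hgen. destruct (generates_form theta Phi) as [c0 Hc0]; [|easy|].
    + intros s Hs. destruct (Hhol s Hs) as [d Hd]. exists d. now apply cderiv_is_derive.
    + exists c0, (fun s => Phi s - RtoC (INR c0) * s)%C. split; [easy|]. intros s _. ring.
  - intros [c0 [phi [Hphi HPhi]]]. now apply (form_generates theta Phi c0 phi).
Qed.
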